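(* Fix an integer $d\ge 2$, $\lambda>0$ and $L>0$. If the heat-bath dynamics with update radius $L$ has optimal temporal mixing on $\mathbb{R}^d$ at fugacity $\lambda$, then the hard sphere model on $\mathbb{R}^d$ at fugacity $\lambda$ exhibits strong spatial mixing.
   Context: Let $r=r_d>0$ be the radius for which a ball of radius $r$ in $\mathbb{R}^d$ has volume $1$; $B_\ell(x)$ is the open ball of radius $\ell$ about $x$, $|A|$ is Lebesgue measure, and $A^{(\ell)}=\{x\in\mathbb{R}^d:\mathrm{dist}(x,A)\le\ell\}$. For compact measurable $\Lambda\subset\mathbb{R}^d$ let $\Lambda_{\mathrm{Int}}=\{x\in\Lambda:\mathrm{dist}(x,\Lambda^c)\ge r\}$. A boundary condition is a (measurable) set $\tau\subseteq\Lambda_{\mathrm{Int}}$ of forbidden locations for centers. $\Omega_\Lambda$ is the set of all finite point sets in $\Lambda_{\mathrm{Int}}$ with pairwise distances at least $2r$, and $\Omega_\Lambda^\tau\subseteq\Omega_\Lambda$ is the set of those contained in $\Lambda_{\mathrm{Int}}\setminus\tau$. The hard sphere model $\mu_\Lambda^\tau$ at fugacity $\lambda$ with boundary condition $\tau$ is the law of a Poisson point process of intensity $\lambda$ on $\Lambda_{\mathrm{Int}}\setminus\tau$ conditioned on all points being at pairwise distance at least $2r$. For $\Lambda'\subseteq\Lambda$ and probability measures $\mu_1,\mu_2$ on $\Omega_\Lambda$, $\|\mu_1-\mu_2\|_{\Lambda'}$ is the total variation distance between the pushforwards of $\mu_1,\mu_2$ to $\Omega_{\Lambda'}$ under the projection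 $X\mapsto X\cap\Lambda'_{\mathrm{Int}}$. Strong spatial mixing (SSM): the hard sphere model at fugacity $\lambda$ exhibits strong spatial mixing on $\mathbb{R}^d$ if there exist $\alpha,\beta>0$ such that for all compact measurable $\Lambda'\subseteq\Lambda\subset\mathbb{R}^d$ and any pair of boundary conditions $\tau,\tau'$ on $\Lambda$, $$\|\mu_\Lambda^\tau-\mu_\Lambda^{\tau'}\|_{\Lambda'}\le\beta|\Lambda'|\exp(-\alpha\cdot\mathrm{dist}(\tau\triangle\tau',\Lambda')).$$ Heat-bath dynamics with update radius $L$: the Markov chain on $\Omega_\Lambda^\tau$ (with $\Lambda_{\mathrm{Int}}\neq\emptyset$) which at each step picks $x\in\Lambda_{\mathrm{Int}}^{(L)}=(\Lambda_{\mathrm{Int}})^{(L)}$ uniformly at random and resamples the centers in $B_L(x)$ subject to the boundary conditions induced by $\tau$ and the other centers of the current configuration; i.e. $X_t\cap B_L(x)$ is replaced by a sample of a Poisson process of intensity $\lambda$ on $(\Lambda_{\mathrm{Int}}\setminus\tau)\cap B_L(x)$ conditioned on its union with $X_t\setminus B_L(x)$ having all pairwise distances at least $2r$. Optimal temporal mixing: the heat-bath dynamics with update radius $L$ has optimal temporal mixing on $\mathbb{R}^d$ at fugacity $\lambda$ if there exist $b,c>0$ such that for any compact measurable $\Lambda\subset\mathbb{R}^d$ (for which the chain is defined), with $n=|\Lambda|$, any boundary condition $\tau$, any $s>0$, and any two instances $(X_t),(Y_t)$ of the dynamics on $\Omega_\Lambda^\tau$ (with arbitrary initial distributions), the total variation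 distance between the laws of $X_{\lfloor sn\rfloor}$ and $Y_{\lfloor sn\rfloor}$ is at most $b\,n\,e^{-cs}$. *)

(* Defs.v *)
From HB Require Import structures.
From mathcomp Require Import all_boot all_order all_algebra finmap.
From mathcomp Require Import all_classical all_reals all_analysis.

Set Implicit Arguments.
Unset Strict Implicit.
Unset Printing Implicit Defensive.

Import Order.TTheory GRing.Theory Num.Theory.
Import numFieldNormedType.Exports.

Local Open Scope classical_set_scope.
Local Open Scope ring_scope.

Section tuple_measure.
Context d (T : measurableType d) (R : realType).

Definition cons_pair n (p : T * n.-tuple T) : n.+1.-tuple T :=
  [tuple of p.1 :: p.2].

Lemma measurable_cons_pair n : measurable_fun setT (@cons_pair n).
Proof. exact: measurable_cons. Qed.

Lemma measurable_uncons n : measurable_fun setT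
  (fun t : n.+1.-tuple T => (tnth t ord0, [tuple of behead t])).
Proof.
apply/measurable_fun_pair; [exact: measurable_tnth|exact: measurable_behead].
Qed.

Section step.
Variables (m : {sigma_finite_measure set T -> \bar R}) (n : nat).
Variable mn : {sigma_finite_measure set (n.-tuple T) -> \bar R}.

Definition cons_measure : set (n.+1.-tuple T) -> \bar R :=
  pushforward (m \x mn)%E (@cons_pair n).

Let cons_measure0 : cons_measure set0 = 0%E.
Proof. by rewrite /cons_measure /pushforward preimage_set0 measure0. Qed.

Let cons_measure_ge0 A : (0 <= cons_measure A)%E.
Proof. by rewrite /cons_measure /pushforward measure_ge0. Qed.

Let cons_measure_sigma_additive : semi_sigma_additive cons_measure.
Proof.
have mf := @measurable_cons_pair n.
have mpre A : measurable A -> measurable (@cons_pair n @^-1` A).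
  by move=> mA; rewrite -[X in measurable X]setTI; exact: mf.
move=> F mF tF mUF; rewrite /cons_measure /pushforward preimage_bigcup.
apply: measure_semi_sigma_additive.
- by move=> k; exact: mpre.
- apply/trivIsetP => /= i j _ _ ij; rewrite -preimage_setI.
  by move/trivIsetP : tF => /(_ _ _ _ _ ij) ->//; rewrite preimage_set0.
- by rewrite -preimage_bigcup; exact: mpre.
Qed.

HB.instance Definition _ := isMeasure.Build _ _ _ cons_measure
  cons_measure0 cons_measure_ge0 cons_measure_sigma_additive.

Let cons_measure_sigma_finite : sigma_finite setT cons_measure.
Proof.
have /sigma_finiteP[F [TF ndF Foo]] := sigma_finiteT m.
have /sigma_finiteP[G [TG ndG Goo]] := sigma_finiteT mn.
pose g (t : n.+1.-tuple T) := (tnth t ord0, [tuple of behead t]).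
have gK : cancel (@cons_pair n) g.
  by move=> [x t]; rewrite /g /cons_pair /=; congr pair; exact/val_inj.
exists (fun i => g @^-1` (F i `*` G i)).
  apply/esym/seteqP; split=> // t _.
  have [i _ Fi] : (\bigcup_k F k) (g t).1 by rewrite -TF.
  have [j _ Gj] : (\bigcup_k G k) (g t).2 by rewrite -TG.
  exists (maxn i j) => //; split.
    by move: Fi; exact/subsetPset/ndF/leq_maxl.
  by move: Gj; exact/subsetPset/ndG/leq_maxr.
move=> i; have [mFi Fioo] := Foo i; have [mGi Gioo] := Goo i; split.
  by rewrite -[X in measurable X]setTI; apply: (@measurable_uncons n) => //;
    exact: measurableX.
rewrite /cons_measure /pushforward -comp_preimage.
rewrite (_ : g \o _ = id); last by apply/funext => x; exact: gK.
by rewrite preimage_id product_measure1E// lte_mul_pinfty// ge0_fin_numE.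
Qed.

HB.instance Definition _ := Measure_isSigmaFinite.Build _ _ _ cons_measure
  cons_measure_sigma_finite.

End step.

(* [tuple_measure m n] is the n-fold product measure of [m]; in dimension 0 it
   is the unit mass at the empty tuple. *)
Fixpoint tuple_measure (m : {sigma_finite_measure set T -> \bar R}) (n : nat) :
    {sigma_finite_measure set (n.-tuple T) -> \bar R} :=
  if n is n'.+1 then cons_measure m (tuple_measure m n')
  else (\d_[tuple] : set (0.-tuple T) -> \bar R).

End tuple_measure.

Section euclidean.
Context (R : realType) (d : nat).
Implicit Types (x y : 'rV[R]_d) (A B : set 'rV[R]_d).

(* The coordinate projections; the sigma-algebra they generate on ['rV[R]_d]
   is the Borel one. *)
Definition coord_proj (i : 'I_d) (x : 'rV[R]_d) : measurableTypeR R :=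
  x ord0 i.

HB.instance Definition _ := @isMeasurable.Build default_measure_display
  'rV[R]_d (g_sigma_preimage coord_proj)
  (@sigma_algebra0 _ _ _) (@sigma_algebraC _ _) (@sigma_algebra_bigcup _ _ _).

Definition row_of_tuple (t : d.-tuple (measurableTypeR R)) : 'rV[R]_d :=
  \row_i tnth t i.

Lemma measurable_row_of_tuple : measurable_fun setT row_of_tuple.
Proof.
pose h i (t : d.-tuple (measurableTypeR R)) := tnth t i.
have hE : (fun i => coord_proj i \o row_of_tuple) = h.
  by apply/funext => i; apply/funext => t; rewrite /coord_proj /= mxE.
have := g_sigma_preimage_comp coord_proj row_of_tuple; rewrite hE => E.
by move=> _ A mA; rewrite /measurable /= E; exists A.
Qed.

Definition lebesgue_row : set 'rV[R]_d -> \bar R :=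
  pushforward (tuple_measure (@lebesgue_measure R) d) row_of_tuple.

Let lebesgue_row0 : lebesgue_row set0 = 0%E.
Proof. by rewrite /lebesgue_row /pushforward preimage_set0 measure0. Qed.

Let lebesgue_row_ge0 A : (0 <= lebesgue_row A)%E.
Proof. by rewrite /lebesgue_row /pushforward measure_ge0. Qed.

Let row_preimage A : measurable A -> measurable (row_of_tuple @^-1` A).
Proof.
by move=> mA; rewrite -[X in measurable X]setTI; exact: measurable_row_of_tuple.
Qed.

Let lebesgue_row_sigma_additive : semi_sigma_additive lebesgue_row.
Proof.
move=> F mF tF mUF; rewrite /lebesgue_row /pushforward preimage_bigcup.
apply: measure_semi_sigma_additive.
- by move=> k; exact: row_preimage.
- apply/trivIsetP => /= i j _ _ ij; rewrite -preimage_setI.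
  by move/trivIsetP : tF => /(_ _ _ _ _ ij) ->//; rewrite preimage_set0.
- by rewrite -preimage_bigcup; exact: row_preimage.
Qed.

HB.instance Definition _ := isMeasure.Build _ _ _ lebesgue_row
  lebesgue_row0 lebesgue_row_ge0 lebesgue_row_sigma_additive.

Let tuple_of_row (x : 'rV[R]_d) : d.-tuple (measurableTypeR R) :=
  [tuple x ord0 i | i < d].

Let row_of_tupleK : cancel row_of_tuple tuple_of_row.
Proof. by move=> t; apply: eq_from_tnth => i; rewrite tnth_mktuple mxE. Qed.

Let measurable_tuple_of_row : measurable_fun setT tuple_of_row.
Proof.
apply/measurable_fun_tnthP => i.
rewrite (_ : _ \o _ = coord_proj i); last first.
  by apply/funext => x; rewrite /= tnth_mktuple.
move=> _ A mA; rewrite setTI; apply: sub_sigma_algebra.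
by rewrite -bigcup_seq; exists i => /=; [rewrite mem_index_enum|exists A;
  rewrite ?setTI].
Qed.

Let lebesgue_row_sigma_finite : sigma_finite setT lebesgue_row.
Proof.
have [F UF mF] := sigma_finiteT (tuple_measure (@lebesgue_measure R) d).
exists (fun i => tuple_of_row @^-1` F i).
  by rewrite -preimage_bigcup -UF.
move=> i; have [mFi Foo] := mF i; split.
  by rewrite -[X in measurable X]setTI; exact: measurable_tuple_of_row.
rewrite /lebesgue_row /pushforward -comp_preimage.
by rewrite (_ : _ \o _ = id)//; apply/funext => t; exact: row_of_tupleK.
Qed.

HB.instance Definition _ := Measure_isSigmaFinite.Build _ _ _ lebesgue_row
  lebesgue_row_sigma_finite.

(* The library's norm on ['rV[R]_d] is the sup norm. *)
Definition enorm x : R := Num.sqrt (\sum_i x ord0 i ^+ 2).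

Definition eball (l : R) x : set 'rV[R]_d := [set y | enorm (y - x) < l].

(* [+oo] as soon as one of the sets is empty. *)
Definition set_dist A B : \bar R :=
  ereal_inf [set (enorm (p.1 - p.2))%:E | p in A `*` B].

Definition thickening (l : R) A : set 'rV[R]_d :=
  [set x | (set_dist [set x] A <= l%:E)%E].

Definition inner_set (r : R) A : set 'rV[R]_d :=
  [set x | A x /\ (r%:E <= set_dist [set x] (~` A))%E].

End euclidean.

Section configurations.
Context (R : realType) (d : nat).
Implicit Types (X Y : {fset 'rV[R]_d}) (A : set 'rV[R]_d).

Definition fset_restr X A : {fset 'rV[R]_d} := [fset x in X | x \in A]%fset.

Definition count_events : set (set {fset 'rV[R]_d}) :=
  [set E | exists A k, measurable A /\ E = [set X | #|` fset_restr X A| = k]].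

HB.instance Definition _ := @isMeasurable.Build default_measure_display
  {fset 'rV[R]_d} <<s count_events >>
  (@sigma_algebra0 _ _ _) (@sigma_algebraC _ _) (@sigma_algebra_bigcup _ _ _).

Definition hard_core (r : R) : set {fset 'rV[R]_d} :=
  [set X | forall x y, x \in X -> y \in X -> x != y -> 2 * r <= enorm (x - y)].

Definition configs_in (r : R) A : set {fset 'rV[R]_d} :=
  [set X | hard_core r X /\ [set` X] `<=` A].

(* The Poisson point process of intensity [lam] on [S], for [S] of finite
   volume: a Poisson number of points, which given their number are independent
   and uniform in [S]. Tuples with a repeated point form a null set when
   [0 < d]. *)
Definition poisson_process (lam : R) (S : set 'rV[R]_d)
    (E : set {fset 'rV[R]_d}) : \bar R :=
  ((expR (- (lam * fine (lebesgue_row S))))%:E *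
   \sum_(0 <= n <oo) ((lam ^+ n / n`!%:R)%:E *
     tuple_measure (@lebesgue_row R d) n
       [set t : n.-tuple 'rV[R]_d |
         (forall i, S (tnth t i)) /\ E [fset x in val t]%fset]))%E.

Definition tv_dist dT (T : measurableType dT) (mu nu : set T -> \bar R)
    : \bar R :=
  ereal_sup [set `|mu E - nu E|%E | E in measurable].

Definition cond_law T (P : set T -> \bar R) (H E : set T) : \bar R :=
  (P (E `&` H) * ((fine (P H))^-1)%:E)%E.

End configurations.

Section hard_sphere.
Context (R : realType) (d : nat).
(* [r] is the radius of the spheres, [lam] the fugacity. *)
Variables (r lam : R).
Implicit Types (Lam tau : set 'rV[R]_d) (X : {fset 'rV[R]_d}).

Definition boundary_condition Lam tau : Prop :=
  measurable tau /\ tau `<=` inner_set r Lam.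

Definition hard_sphere Lam tau : set {fset 'rV[R]_d} -> \bar R :=
  cond_law (poisson_process lam (inner_set r Lam `\` tau)) (hard_core r).

(* [X |-> X `&` Lam'_Int] *)
Definition proj_config Lam' X : {fset 'rV[R]_d} :=
  fset_restr X (inner_set r Lam').

Definition tv_dist_on Lam' (mu nu : set {fset 'rV[R]_d} -> \bar R) : \bar R :=
  tv_dist (pushforward mu (proj_config Lam'))
          (pushforward nu (proj_config Lam')).

Definition strong_spatial_mixing : Prop :=
  exists alpha beta : R, [/\ 0 < alpha, 0 < beta &
    forall Lam' Lam, compact Lam -> measurable Lam ->
      compact Lam' -> measurable Lam' -> Lam' `<=` Lam ->
    forall tau tau', boundary_condition Lam tau ->
      boundary_condition Lam tau' ->
    (tv_dist_on Lam' (hard_sphere Lam tau) (hard_sphere Lam tau') <=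
     beta%:E * lebesgue_row Lam' *
     expeR (- (alpha%:E * set_dist (tau `+` tau') Lam')))%E].

Variable L : R.

(* Law of [X] after its centers in [B_L(x)] are resampled given the others. *)
Definition resample Lam tau X (x : 'rV[R]_d) (E : set {fset 'rV[R]_d}) :
    \bar R :=
  let B := eball L x in
  let glue (Y : {fset 'rV[R]_d}) := (fset_restr X (~` B) `|` Y)%fset in
  cond_law (poisson_process lam ((inner_set r Lam `\` tau) `&` B))
    (glue @^-1` hard_core r) (glue @^-1` E).

Definition heat_bath_kernel Lam tau X (E : set {fset 'rV[R]_d}) : \bar R :=
  let U := thickening L (inner_set r Lam) in
  (((fine (lebesgue_row U))^-1)%:E *
   \int[@lebesgue_row R d]_(x in U) resample Lam tau X x E)%E.

(* [nu t] is the law at time [t] of a Markov chain on [Omega_Lam^tau] with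
   transition kernel [heat_bath_kernel Lam tau]. *)
Definition heat_bath_laws Lam tau (nu : nat -> probability {fset 'rV[R]_d} R)
    : Prop :=
  nu 0%N (configs_in r (inner_set r Lam `\` tau)) = 1%E /\
  forall t E, measurable E ->
    nu t.+1 E = (\int[nu t]_X heat_bath_kernel Lam tau X E)%E.

Definition optimal_temporal_mixing : Prop :=
  exists b c : R, [/\ 0 < b, 0 < c &
    forall Lam, compact Lam -> measurable Lam -> inner_set r Lam !=set0 ->
    forall tau, boundary_condition Lam tau ->
    forall s : R, 0 < s ->
    forall mu nu, heat_bath_laws Lam tau mu -> heat_bath_laws Lam tau nu ->
    let n := fine (lebesgue_row Lam) in
    (tv_dist (mu (Num.truncn (s * n))) (nu (Num.truncn (s * n))) <=
     (b * n * expR (- (c * s)))%:E)%E].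

End hard_sphere.

(* Main.v *)
Require Import Defs.
From HB Require Import structures.
From mathcomp Require Import all_boot all_order all_algebra finmap.
From mathcomp Require Import all_classical all_reals all_analysis measurable_realfun.
From mathcomp Require Import lra.
Import Order.TTheory GRing.Theory Num.Theory.
Import numFieldNormedType.Exports.
Set Implicit Arguments.
Unset Strict Implicit.
Unset Printing Implicit Defensive.
Local Open Scope classical_set_scope.
Local Open Scope ring_scope.

(* Let [A] be the set of possible centers in [Lam'] and [l] the distance from [Lam'] to the
   places where the boundary conditions differ. Conditioning on the centers at distance at
   least [l] from [A] only changes the allowed region, so it suffices to compare two hard
   sphere measures whose allowed regions lie within distance about [l] of [A] and agree
   up to distance [l - 2 r]. The volume of this domain is polynomial in [l]. Run both
   heat-bath chains in it from the empty configuration up to time [s n] with [s] a small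
   multiple of [l + 1]. Each hard sphere measure is stationary for its chain, so by
   optimal temporal mixing both chains are exponentially close in [l] to equilibrium. On the
   other hand, under the identity coupling a disagreement spreads by a bounded distance per
   update: with weight [exp (- dist (y, A))] integrated over the neighbourhood of the
   disagreement set, the expected weight grows at most by the factor
   [1 + const / volume] per step, hence by at most [exp (const * s)] in total, while it
   starts of order [exp (- l)] and is bounded below as soon as the disagreement reaches
   [A]. *)

(** * Measurability on the space of configurations *)

(** The final bound may involve [|Lam'|] but not [|Lam|], whereas temporal mixing costs the volume
    of the domain in which it is applied. This is why the problem is moved to a domain around [A]
    before any chain is run, and why volumes are compared by packing, uniformly in the shape of
    [Lam']. A fixed center nearby excludes sites just as a boundary condition does, so after
    conditioning the only datum left is the region allowed to the centers. The coupling is never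
    built as a joint law. The Poisson process is the exponential series of the operator that inserts
    one point, and a coupling becomes a relation between two configurations that survives the
    insertion of the same point in both. Induction on time proves [g X <= g' X' + error] for the
    observables of the two chains, with an error depending on a set that contains all disagreements:
    an update far from this set leaves it as it is, an update near it adds the whole ball. The
    logarithm of the weight is Lipschitz, so a new disagreement costs at most a constant times the
    weight at the center of the update, and the estimate reproduces itself at each step. *)

Section counting.
Context (R : realType) (d : nat).
Local Notation E := 'rV[R]_d.
Local Notation C := {fset 'rV[R]_d}.
Implicit Types (X Y : C) (A : set E).

(** Counting is packaged as a measure, a finite sum of Dirac masses, so that the measurability of
    sections under a kernel applies to counts. *)
Definition point_measure X : {measure set E -> \bar R} :=
  msum (fun n => \d_(nth 0 X n)) #|`X|.

Lemma in_fset_restr X A x : (x \in fset_restr X A) = (x \in X) && (x \in A).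
Proof. by rewrite /fset_restr !inE. Qed.

Lemma fset_restrP X A x : reflect (x \in X /\ A x) (x \in fset_restr X A).
Proof.
by rewrite in_fset_restr; apply: (iffP andP) => -[? ?]; split => //;
  apply/mem_set || apply/set_mem.
Qed.

Lemma point_measureE X A : point_measure X A = (#|` fset_restr X A|%:R)%:E.
Proof.
rewrite /point_measure /msum /=.
have -> : #|` fset_restr X A| = count (mem A) (enum_fset X).
  rewrite -size_filter; apply/perm_size/uniq_perm => [||x].
  - exact: fset_uniq.
  - exact/filter_uniq/fset_uniq.
  - by rewrite mem_filter in_fset_restr andbC.
rewrite -sum1_count natr_sum -sumEFin.
rewrite (big_nth 0) big_mkord big_mkcond /=; apply: eq_bigr => i _.
by rewrite [LHS]diracE; case: ifP.
Qed.

Lemma measurable_count A k : measurable A ->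
  measurable [set X : C | #|` fset_restr X A| = k].
Proof. by move=> mA; apply: sub_sigma_algebra; exists A, k. Qed.

Lemma measurable_point_measure A : measurable A ->
  measurable_fun setT (fun X => point_measure X A).
Proof.
move=> mA; under eq_fun do rewrite point_measureE.
apply/measurable_EFinP; apply: (@measurableT_comp _ _ _ _ _ _ (fun n : nat => n%:R : R)) => //.
move=> _ B mB; rewrite setTI.
rewrite (_ : _ @^-1` B = \bigcup_(k in B) [set X | #|` fset_restr X A| = k]).
  by apply: bigcup_measurable => k _; exact: measurable_count.
by apply/seteqP; split=> [X BX|X [k Bk /= Xk]]; [|by rewrite /preimage /= Xk];
  exists #|` fset_restr X A|.
Qed.

Section joint_count.
Context dT (T : measurableType dT).

(** Constant in the first component, which only carries the parameter on which the counting window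
    will depend. *)
Definition point_kernel (z : T * C) : {measure set E -> \bar R} :=
  point_measure z.2.

Let measurable_point_kernel U : measurable U ->
  measurable_fun [set: T * C] (point_kernel ^~ U).
Proof.
move=> mU; apply: (@measurableT_comp _ _ _ _ _ _ (fun X => point_measure X U)) => //.
exact: measurable_point_measure.
Qed.

HB.instance Definition _ := isKernel.Build _ _ _ _ R point_kernel
  measurable_point_kernel.

(** The window moves with the parameter: the count is the mass of a section of [M'] under
    [point_kernel], and such masses depend measurably on the base point. *)
Lemma measurable_joint_count (M : set (T * E)) k : measurable M ->
  measurable [set z : T * C | #|` fset_restr z.2 (xsection M z.1)| = k].
Proof.
move=> mM.
pose M' := [set u : (T * C) * E | M (u.1.1, u.2)].
have mM' : measurable M'.
  rewrite -[M']setTI; apply: (_ : measurable_fun setT (fun u : (T * C) * E =>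
    (u.1.1, u.2))) => //.
  apply/measurable_fun_pair => //.
  exact: (measurableT_comp measurable_fst measurable_fst).
(* The bound may depend on [z], so the cardinality of the configuration will do; the successor makes
   it strict. *)
have bnd z : exists m : R, forall A, measurable A ->
    (mrestr (point_kernel z) measurableT A < m%:E)%E.
  exists (#|` z.2|.+1%:R) => A mA.
  rewrite /mrestr /= setIT point_measureE lte_fin ltr_nat ltnS.
  by apply: fsubset_leq_card; apply/fsubsetP => x; rewrite in_fset_restr => /andP[].
have [_] := measurable_prod_subset_xsection_kernel bnd mM'.
move=> /(_ measurableT [set k%:R%:E] (emeasurable_set1 _)); rewrite setTI.
move=> mP; rewrite (_ : mkset _ = (fun z => mrestr (point_kernel z) measurableT
  (xsection M' z)) @^-1` [set k%:R%:E])//.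
apply/funext => z; apply/propext; rewrite /=; rewrite /mrestr setIT point_measureE.
have -> : xsection M' z = xsection M z.1.
  by apply/funext => p; apply/propext; rewrite /xsection /= !inE.
by split=> [->//|[] /eqP]; rewrite eqr_nat => /eqP.
Qed.

End joint_count.

Lemma measurable_fun_config dT (T : measurableType dT) (f : T -> C) :
  (forall A k, measurable A -> measurable [set t | #|` fset_restr (f t) A| = k]) ->
  measurable_fun setT f.
Proof.
move=> mf; apply: (measurability (@count_events R d)) => //.
by move=> _ [_ [A [k [mA ->]]] <-]; rewrite setTI; exact: mf.
Qed.

Lemma measurable_fset_restr dT (T : measurableType dT) (M : set (T * E)) :
  measurable M ->
  measurable_fun setT (fun z : T * C => fset_restr z.2 (xsection M z.1)).
Proof.
move=> mM; apply: measurable_fun_config => A k mA.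
rewrite (_ : [set _ | _] = [set z : T * C | #|` fset_restr z.2
   (xsection (M `&` (setT `*` A)) z.1)| = k]).
  by apply: measurable_joint_count; apply: measurableI => //; exact: measurableX.
suff E z : fset_restr (fset_restr z.2 (xsection M z.1)) A =
    fset_restr z.2 (xsection (M `&` (setT `*` A)) z.1).
  by apply/funext => z; rewrite /= E.
apply/fsetP => x; apply/fset_restrP/fset_restrP.
  by move=> [/fset_restrP[xz /set_mem Mx] Ax]; split => //; apply/mem_set.
move=> [xz /set_mem[Mx [_ Ax]]]; split => //.
by apply/fset_restrP; split => //; apply/mem_set.
Qed.

Lemma measurable_diagonal : measurable [set u : E * E | u.1 = u.2].
Proof.
rewrite (_ : [set _ | _] = \bigcap_(i in [set: 'I_d])
   ((fun u => (coord_proj i u.1 - coord_proj i u.2)) @^-1` [set 0])).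
  apply: fin_bigcap_measurable; first exact: finite_finset.
  move=> i _; rewrite -[X in measurable X]setTI.
  have mc : measurable_fun setT (@coord_proj R d i).
    move=> _ A mA; rewrite setTI; apply: sub_sigma_algebra.
    rewrite -bigcup_seq; exists i => /=; [by rewrite mem_index_enum|exists A => //].
    by rewrite setTI.
  suff : measurable_fun setT (fun u : E * E => (coord_proj i u.1 - coord_proj i u.2)) by apply.
  by apply: measurable_funB; apply: measurableT_comp.
apply/seteqP; split => [u /= uE i _|u /= H]; first by rewrite /= uE subrr.
by apply/rowP => i; apply/eqP; rewrite -subr_eq0; apply/eqP; exact: H.
Qed.

End counting.

(** * The Euclidean norm and the measurability of balls *)

Section enorm.
Context (R : realType) (d : nat).
Local Notation E := 'rV[R]_d.
Implicit Types (x y z : E) (A : set E).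

Lemma enorm_ge0 x : 0 <= enorm x.
Proof. exact: sqrtr_ge0. Qed.

Lemma sum_sqr_ge0 x : 0 <= \sum_i x ord0 i ^+ 2.
Proof. by apply: sumr_ge0 => i _; exact: sqr_ge0. Qed.

Lemma enorm_sqr x : enorm x ^+ 2 = \sum_i x ord0 i ^+ 2.
Proof. by rewrite sqr_sqrtr// sum_sqr_ge0. Qed.

Lemma enorm0 : enorm (0 : E) = 0.
Proof. by rewrite /enorm big1 ?sqrtr0// => i _; rewrite mxE expr0n. Qed.

Lemma enormZ (a : R) x : enorm (a *: x) = `|a| * enorm x.
Proof.
rewrite /enorm; under eq_bigr do rewrite mxE exprMn.
by rewrite -mulr_sumr sqrtrM ?sqr_ge0// sqrtr_sqr.
Qed.

Lemma enormN x : enorm (- x) = enorm x.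
Proof. by rewrite -scaleN1r enormZ normrN1 mul1r. Qed.

Lemma enormB x y : enorm (x - y) = enorm (y - x).
Proof. by rewrite -enormN opprB. Qed.

(** The polynomial [H] in [t] is the squared norm of [t *: x + y], hence nonnegative; the bound
    comes from evaluating it at one well chosen point. *)
Lemma cauchy_schwarz x y :
  \sum_i x ord0 i * y ord0 i <= enorm x * enorm y.
Proof.
have H (t : R) : 0 <= enorm x ^+ 2 * t ^+ 2 + 2 * t * (\sum_i x ord0 i * y ord0 i) + enorm y ^+ 2.
  rewrite !enorm_sqr mulr_suml mulr_sumr -!big_split /=.
  apply: sumr_ge0 => i _.
  have -> : x ord0 i ^+ 2 * t ^+ 2 + 2 * t * (x ord0 i * y ord0 i) + y ord0 i ^+ 2 =
    (x ord0 i * t + y ord0 i) ^+ 2 by lra.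
  exact: sqr_ge0.
set s := \sum_i _ in H *.
have [s0|s0] := leP s 0; first by rewrite (le_trans s0)// mulr_ge0 ?enorm_ge0.
have x0 := enorm_ge0 x; have y0 := enorm_ge0 y.
have [x00|xn0] := eqVneq (enorm x) 0.
  (* When [x] has norm zero the polynomial is affine, and here it would take the value [-1]. *)
  pose t := s^-1 * (- (enorm y ^+ 2 + 1) / 2).
  have st : s * t = - (enorm y ^+ 2 + 1) / 2 by rewrite mulVKf// gt_eqF.
  have := H t; rewrite x00 expr0n /= mul0r add0r -mulrA [t * s]mulrC st; lra.
have xp : 0 < enorm x by rewrite lt_neqAle eq_sym xn0.
rewrite -ler_sqr ?nnegrE ?mulr_ge0 ?(ltW s0)//.
(* The polynomial attains its minimum at [- t]. *)
pose t := (enorm x ^+ 2)^-1 * s.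
have xt : enorm x ^+ 2 * t = s by rewrite mulVKf// expf_neq0.
have {}H := H (- t).
have {}H : 0 <= enorm y ^+ 2 - t * s.
  move: H; rewrite sqrrN [t ^+ 2]expr2 mulrA xt; lra.
have : 0 <= enorm x ^+ 2 * (enorm y ^+ 2 - t * s) by rewrite mulr_ge0// sqr_ge0.
by rewrite mulrBr [_ * (t * s)]mulrA xt subr_ge0 exprMn [s ^+ 2]expr2.

Qed.

Lemma enormD x y : enorm (x + y) <= enorm x + enorm y.
Proof.
rewrite -ler_sqr ?nnegrE ?addr_ge0 ?enorm_ge0// enorm_sqr.
under eq_bigr do rewrite mxE sqrrD.
rewrite !big_split /= -!enorm_sqr sqrrD lerD2r lerD2l.
by rewrite mulr2n lerD ?cauchy_schwarz.
Qed.

Lemma enorm_triangle y x z : enorm (x - z) <= enorm (x - y) + enorm (y - z).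
Proof. by rewrite (le_trans _ (enormD _ _))// addrA subrK. Qed.

Lemma coord_le_enorm x i : `|x ord0 i| <= enorm x.
Proof.
rewrite -ler_sqr ?nnegrE ?enorm_ge0// enorm_sqr real_normK ?num_real//.
by rewrite (bigD1 i)//= lerDl sumr_ge0// => j _; exact: sqr_ge0.
Qed.

Lemma enorm_le_sum x : enorm x <= \sum_i `|x ord0 i|.
Proof.
have -> : x = \sum_i x ord0 i *: delta_mx ord0 i by exact: row_sum_delta.
have le_sum (f : 'I_d -> E) : enorm (\sum_i f i) <= \sum_i enorm (f i).
  elim/big_rec2 : _ => [|i a b _ ab]; first by rewrite enorm0.
  by rewrite (le_trans (enormD _ _))// lerD2l.
rewrite (le_trans (le_sum _))//; apply: ler_sum => i _.
rewrite -row_sum_delta enormZ ler_piMr//.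
rewrite /enorm (bigD1 i)//= mxE !eqxx expr1n big1 ?addr0 ?sqrtr1// => j ji.
by rewrite mxE (negbTE ji) andbF expr0n.
Qed.

Lemma enorm_lt_box x (e : R) : (forall i, `|x ord0 i| < e) -> 0 < e -> enorm x <= d%:R * e.
Proof.
move=> xe e0; rewrite (le_trans (enorm_le_sum x))//.
rewrite mulr_natl -[d in X in _ <= X]card_ord -sumr_const.
by apply: ler_sum => i _; exact: ltW.
Qed.

Lemma measurable_coord_proj i : measurable_fun setT (@coord_proj R d i).
Proof.
move=> _ A mA; rewrite setTI; apply: sub_sigma_algebra.
rewrite -bigcup_seq; exists i => /=; [by rewrite mem_index_enum|exists A => //].
by rewrite setTI.
Qed.

Lemma measurable_enormB : measurable_fun setT (fun u : E * E => enorm (u.1 - u.2)).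
Proof.
rewrite (_ : (fun _ => _) = Num.sqrt \o
  (fun u => \sum_i (coord_proj i u.1 - coord_proj i u.2) ^+ 2)); last first.
  by apply/funext => u; congr Num.sqrt; apply: eq_bigr => i _; rewrite !mxE.
apply: measurableT_comp.
  apply: continuous_measurable_fun => x; exact: sqrt_continuous.
apply: measurable_sum => i; apply: measurable_funX.
apply: measurable_funB; apply: measurableT_comp => //; exact: measurable_coord_proj.
Qed.

Lemma measurable_eball_graph (l : R) :
  measurable [set u : E * E | enorm (u.2 - u.1) < l].
Proof.
rewrite (_ : [set _ | _] = (fun u : E * E => enorm (u.1 - u.2)) @^-1` [set` `]-oo, l[]).
  by rewrite -[X in measurable X]setTI; exact: measurable_enormB.
by apply/funext => u /=; rewrite in_itv/= enormB.
Qed.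

Lemma measurable_eball (l : R) x : measurable (eball l x).
Proof.
rewrite (_ : eball l x = xsection [set u : E * E | enorm (u.2 - u.1) < l] x).
  by apply: measurable_xsection; exact: measurable_eball_graph.
by apply/funext => y; rewrite /xsection/eball/=; apply/propext; rewrite inE.
Qed.

End enorm.

(** * Measurability of membership, of adding a point and of the hard-core condition *)

Section config_maps.
Context (R : realType) (d : nat).
Local Notation E := 'rV[R]_d.
Local Notation C := {fset 'rV[R]_d}.
Implicit Types (X Y : C) (A : set E).

(** The section of the diagonal at [z.1] is a window reduced to this point; membership means that
    its count is nonzero. *)
Lemma measurable_in_config : measurable [set z : E * C | z.1 \in z.2].
Proof.
rewrite (_ : [set _ | _] = ~` [set z : E * C |
   #|` fset_restr z.2 (xsection [set u : E * E | u.1 = u.2] z.1)| = 0%N]).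
  by apply: measurableC; apply: measurable_joint_count; exact: measurable_diagonal.
apply/funext => -[p X]; apply/propext => /=; split.
  move=> pX /cardfs0_eq X0.
  suff : p \in fset_restr X (xsection [set u : E * E | u.1 = u.2] p) by rewrite X0 inE.
  by apply/fset_restrP; split => //; apply/mem_set.
move=> H; apply/negP => /negP pX; apply: H.
apply/eqP; rewrite cardfs_eq0; apply/eqP/fsetP => q; rewrite inE; apply/negbTE/negP.
by move=> /fset_restrP[qX /set_mem/= pq]; move: pX; rewrite pq qX.
Qed.

(** The count in [A] rises by one on the event [P] that the added point is new and lies in [A], and
    is unchanged off [P]. *)
Lemma measurable_fset1U : measurable_fun setT (fun z : E * C => (z.1 |` z.2)%fset).
Proof.
apply: measurable_fun_config => A k mA.
pose P := [set z : E * C | A z.1] `&` ~` [set z | z.1 \in z.2].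
have mP : measurable P.
  apply: measurableI; last by apply: measurableC; exact: measurable_in_config.
  by rewrite -[X in measurable X]setTI; exact: measurable_fst.
have mN j : measurable [set z : E * C | #|` fset_restr z.2 A| = j].
  rewrite -[X in measurable X]setTI.
  exact: (@measurable_snd _ _ E C measurableT _ (measurable_count j mA)).
have cP z : P z -> #|` fset_restr (z.1 |` z.2)%fset A| = #|` fset_restr z.2 A|.+1.
  move=> [Az /= /negP z12]; rewrite (_ : fset_restr _ A = z.1 |` fset_restr z.2 A)%fset.
    by rewrite cardfsU1 (_ : _ \notin _ = true)//; apply/negP => /fset_restrP[zz _];
      rewrite zz in z12.
  apply/fsetP => x; apply/fset_restrP/fset1UP.
    by move=> [/fset1UP[->|xz] Ax]; [left|right; apply/fset_restrP].
  move=> [->|/fset_restrP[xz Ax]]; split => //; apply/fset1UP; [left|right] => //.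
have cN z : ~ P z -> fset_restr (z.1 |` z.2)%fset A = fset_restr z.2 A.
  move=> nPz; apply/fsetP => x; apply/fset_restrP/fset_restrP.
    move=> [/fset1UP[->|xz] Ax]; split => //; apply: contrapT => z12; exact: nPz.
  by move=> [xz Ax]; split => //; apply/fset1UP; right.
case: k => [|k].
  rewrite (_ : mkset _ = [set z : E * C | #|` fset_restr z.2 A| = 0%N] `\` P).
    exact: measurableD.
  apply/funext => z; apply/propext; rewrite /=.
  have [Pz|Pz] := pselect (P z); last by rewrite cN//; tauto.
  by rewrite cP//; split => // -[].
rewrite (_ : mkset _ = ([set z : E * C | #|` fset_restr z.2 A| = k] `&` P) `|`
   ([set z : E * C | #|` fset_restr z.2 A| = k.+1] `\` P)).
  by apply: measurableU; [apply: measurableI|apply: measurableD].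
apply/funext => z; apply/propext; rewrite /=.
have [Pz|Pz] := pselect (P z); last by rewrite cN//; tauto.
by rewrite cP//; split => [[]|]; [left|move=> [[->]|[]]].
Qed.

Lemma measurable_hard_core (r : R) : measurable (@hard_core R d r).
Proof.
pose M := [set u : E * E | enorm (u.2 - u.1) < 2 * r] `&` ~` [set u | u.1 = u.2].
have mM : measurable M.
  apply: measurableI; first exact: measurable_eball_graph.
  by apply: measurableC; exact: measurable_diagonal.
(* The complement of [W] pairs a configuration with a location close to one of its
   points; a configuration is hard core iff none of its own points is such a location. *)
pose W := [set z : C * E | #|` fset_restr z.1 (xsection M z.2)| = 0%N].
have mW : measurable W.
  have ms : measurable_fun setT (fun z : C * E => (z.2, z.1)).
    by apply/measurable_fun_pair.
  by rewrite -[X in measurable X]setTI; exact: (ms measurableT _ (measurable_joint_count 0 mM)).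
have mC : measurable (~` W) by exact: measurableC.
have := measurable_joint_count 0 mC => m1.
have md : measurable_fun setT (fun X : C => (X, X)) by apply/measurable_fun_pair.
rewrite (_ : hard_core _ = (fun X : C => (X, X)) @^-1`
   [set z : C * C | #|` fset_restr z.2 (xsection (~` W) z.1)| = 0%N]).
  by rewrite -[X in measurable X]setTI; exact: md.
apply/funext => X; apply/propext; rewrite /hard_core /=; split.
  move=> H; apply/eqP; rewrite cardfs_eq0; apply/eqP/fsetP => x; rewrite inE.
  apply/negbTE/negP => /fset_restrP[xX /set_mem]; apply.
  rewrite /W /=; apply/eqP; rewrite cardfs_eq0; apply/eqP/fsetP => y; rewrite inE.
  apply/negbTE/negP => /fset_restrP[yX /set_mem[/= + /eqP xy]].
  by apply/negP; rewrite -leNgt enormB; exact: H.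
move=> /cardfs0_eq X0 x y xX yX xy; rewrite leNgt; apply/negP => xy2.
suff : x \in fset_restr X (xsection (~` W) X) by rewrite X0 inE.
apply/fset_restrP; split => //; apply/mem_set => /= /cardfs0_eq Y0.
suff : y \in fset_restr X (xsection M x) by rewrite Y0 inE.
apply/fset_restrP; split => //; apply/mem_set; split => /=; first by rewrite enormB.
exact/eqP.
Qed.

End config_maps.

(** * Sigma-additive functionals *)

Section functionals.
Context dT (T : measurableType dT) (R : realType).
Implicit Types (F G : T -> \bar R) (Phi : (T -> \bar R) -> \bar R).

Definition nnmeas F := measurable_fun setT F /\ forall x, (0 <= F x)%E.

Definition eindic (A : set T) : T -> \bar R := fun x => (\1_A x)%:E.

Lemma eindic_in (A : set T) x : A x -> eindic A x = 1%E.
Proof. by move=> Ax; rewrite /eindic indicE mem_set. Qed.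

Lemma eindic_notin (A : set T) x : ~ A x -> eindic A x = 0%E.
Proof. by move=> Ax; rewrite /eindic indicE memNset. Qed.

Lemma nnmeas_eindic (A : set T) : measurable A -> nnmeas (eindic A).
Proof.
move=> mA; split; last by move=> x; rewrite lee_fin.
exact/measurable_EFinP/measurable_indic.
Qed.

Lemma nnmeas_scale (c : R) F : 0 <= c -> nnmeas F -> nnmeas (fun x => c%:E * F x)%E.
Proof.
move=> c0 [mF F0]; split; last by move=> x; rewrite mule_ge0.
exact: measurable_funeM.
Qed.

Lemma nnmeas_add F G : nnmeas F -> nnmeas G -> nnmeas (fun x => F x + G x)%E.
Proof.
move=> [mF F0] [mG G0]; split; last by move=> x; rewrite adde_ge0.
exact: emeasurable_funD.
Qed.

Lemma nnmeas_mul F G : nnmeas F -> nnmeas G -> nnmeas (fun x => F x * G x)%E.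
Proof.
move=> [mF F0] [mG G0]; split; last by move=> x; rewrite mule_ge0.
exact: emeasurable_funM.
Qed.

Lemma nnmeas_cst (c : R) : 0 <= c -> nnmeas (fun=> c%:E).
Proof. by move=> c0; split. Qed.

Lemma nnmeas0 : nnmeas (fun=> 0%E).
Proof. by split. Qed.

Lemma nnmeas_nneseries (Fn : nat -> T -> \bar R) : (forall n, nnmeas (Fn n)) ->
  nnmeas (fun x => \sum_(n <oo) Fn n x)%E.
Proof.
move=> H; split; last by move=> x; apply: nneseries_ge0 => n _ _; exact: (H n).2.
by apply: ge0_emeasurable_sum => [n x _ _|n _]; [exact: (H n).2|exact: (H n).1].
Qed.

(* Laws and kernels are handled through the functionals [F |-> expectation of F]; by
   [sadd_integral] these are integrals. *)
Definition sadd Phi := [/\ forall F, nnmeas F -> (0 <= Phi F)%E,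
  forall (c : R) F, 0 <= c -> nnmeas F ->
    Phi (fun x => c%:E * F x)%E = (c%:E * Phi F)%E &
  forall Fn : nat -> T -> \bar R, (forall n, nnmeas (Fn n)) ->
    Phi (fun x => \sum_(n <oo) Fn n x)%E = (\sum_(n <oo) Phi (Fn n))%E].

Section sadd.
Variable Phi : (T -> \bar R) -> \bar R.
Hypothesis sP : sadd Phi.

Lemma sadd_ge0 F : nnmeas F -> (0 <= Phi F)%E.
Proof. by case: sP => + _ _; apply. Qed.

Lemma saddZ (c : R) F : 0 <= c -> nnmeas F -> Phi (fun x => c%:E * F x)%E = (c%:E * Phi F)%E.
Proof. by case: sP => _ + _; apply. Qed.

Lemma sadd_series (Fn : nat -> T -> \bar R) : (forall n, nnmeas (Fn n)) ->
    Phi (fun x => \sum_(n <oo) Fn n x)%E = (\sum_(n <oo) Phi (Fn n))%E.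
Proof. by case: sP => _ _; apply. Qed.

Lemma sadd0 : Phi (fun=> 0%E) = 0%E.
Proof.
transitivity (0%:E * Phi (fun=> 0))%E; last exact: mul0e.
rewrite -saddZ//.
by congr Phi; apply/funext => x; rewrite mule0.
Qed.

Lemma two_term_nneseries (a b : \bar R) : (0 <= a)%E -> (0 <= b)%E ->
  (\sum_(n <oo) (if n is n'.+1 then if n' is _.+1 then 0 else b else a))%E = (a + b)%E.
Proof.
move=> a0 b0; rewrite (nneseries_split 0%N 2%N); last by case=> [|[|]].
rewrite add0n big_nat_recr// big_nat1 /= eseries0 ?adde0// => -[|[|]]//.
Qed.

(** Finite additivity is countable additivity for a family padded with zeros. *)
Lemma saddD F G : nnmeas F -> nnmeas G -> Phi (fun x => F x + G x)%E = (Phi F + Phi G)%E.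
Proof.
move=> pF pG.
pose Fn (n : nat) : T -> \bar R := if n is n'.+1 then if n' is _.+1 then fun=> 0%E else G else F.
have pFn n : nnmeas (Fn n) by case: n => [|[|n]]//; exact: nnmeas0.
have -> : (fun x => F x + G x)%E = (fun x => \sum_(n <oo) Fn n x)%E.
  apply/funext => x; rewrite -two_term_nneseries ?pF.2 ?pG.2//.
  by apply: eq_eseriesr => -[|[|n]].
rewrite sadd_series// -two_term_nneseries ?sadd_ge0//.
by apply: eq_eseriesr => -[|[|n]] // _; rewrite sadd0.
Qed.

(** Finiteness of [F] allows [G] to be written as [F] plus a nonnegative measurable remainder. *)
Lemma sadd_le F G : nnmeas F -> nnmeas G -> (forall x, F x <= G x)%E ->
  (forall x, F x \is a fin_num) -> (Phi F <= Phi G)%E.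
Proof.
move=> pF pG FG fF.
have -> : G = (fun x => F x + (G x - F x))%E by apply/funext => x; rewrite addeC subeK.
have pGF : nnmeas (fun x => G x - F x)%E.
  split; last by move=> x; rewrite sube_ge0 ?fF.
  by apply: emeasurable_funB; [exact: pG.1|exact: pF.1].
by rewrite saddD// leeDl// sadd_ge0.
Qed.

Lemma sadd_sum I (s : seq I) (Fn : I -> T -> \bar R) : (forall n, nnmeas (Fn n)) ->
    Phi (fun x => \sum_(n <- s) Fn n x)%E = (\sum_(n <- s) Phi (Fn n))%E.
Proof.
move=> pF.
have ps r : nnmeas (fun x => \sum_(n <- r) Fn n x)%E.
  split; last by move=> x; apply: sume_ge0 => n _; exact: (pF n).2.
  by apply: emeasurable_sum => n; exact: (pF n).1.
elim: s => [|i s IH].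
  rewrite big_nil; transitivity (Phi (fun=> 0%E)); last exact: sadd0.
  by congr Phi; apply/funext => x; rewrite big_nil.
rewrite big_cons -IH -saddD//; congr Phi; apply/funext => x; exact: big_cons.
Qed.

Variable m : {measure set T -> \bar R}.
Hypothesis mP : forall A, measurable A -> m A = Phi (eindic A).

Lemma sadd_integral_simple (h : T -> R) : measurable_fun setT h -> (forall x, 0 <= h x) ->
  finite_set (range h) -> (\int[m]_x (h x)%:E)%E = Phi (EFin \o h).
Proof.
move=> mh h0 /finite_fsetP[s rs].
have mB y : measurable (h @^-1` [set y]) by rewrite -[X in measurable X]setTI; exact: mh.
(* The weight is the absolute value of [y] so that every summand is nonnegative whatever the index;
   on the range of [h] this changes nothing. *)
have hE : EFin \o h = (fun x => \sum_(y <- s) ((`|y|%:E) * eindic (h @^-1` [set y]) x))%E.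
  apply/funext => x /=.
  have hs : h x \in s by have : range h (h x) by [exists x]; rewrite rs.
  rewrite (big_fsetD1 (h x))//= eindic_in// mule1 ger0_norm// big_seq big1 ?adde0//.
  move=> y; rewrite !inE => /andP[yx _]; rewrite eindic_notin ?mule0//.
  by move=> /= yE; rewrite yE eqxx in yx.
have pB y : nnmeas (fun x => `|y|%:E * eindic (h @^-1` [set y]) x)%E.
  exact/nnmeas_scale/nnmeas_eindic.
rewrite [X in integral _ _ X](_ : _ = (EFin \o h))// hE sadd_sum//.
rewrite ge0_integral_sum//; last 2 first.
  by move=> y; exact: (pB y).1.
  by move=> y x _; exact: (pB y).2.
apply: eq_bigr => y _; rewrite saddZ//; last exact: nnmeas_eindic.
rewrite ge0_integralZl_EFin//; last 2 first.
  by move=> x _; exact: (nnmeas_eindic (mB y)).2.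
  exact: (nnmeas_eindic (mB y)).1.
by rewrite integral_indic// setIT mP.
Qed.

Import HBSimple HBNNSimple.

Lemma sadd_integral F : nnmeas F -> (\int[m]_x F x)%E = Phi F.
Proof.
move=> [mF F0].
pose g := nnsfun_approx measurableT mF.
(* [sadd] speaks of series only, so [F] is written as the sum of the increments of its simple
   approximations; [hs] is the same family typed as simple functions, which provides finite
   ranges. *)
pose h (n : nat) x : R := if n is k.+1 then g k.+1 x - g k x else g 0%N x.
pose hs (n : nat) : {sfun T >-> R} := if n is k.+1 then
  (g k.+1 : {sfun T >-> R}) - (g k : {sfun T >-> R}) else g 0%N.
have hE n : h n = hs n by apply/funext; case: n.
have h0 n x : 0 <= h n x.
  case: n => [|n]; first exact: fun_ge0.
  by rewrite /h subr_ge0; apply/lefP/nd_nnsfun_approx.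
have mh n : measurable_fun setT (h n) by rewrite hE; exact: measurable_funPT.
have ph n : nnmeas (fun x => (h n x)%:E).
  by split; [exact/measurable_EFinP/mh|move=> x; rewrite lee_fin].
have FE : F = (fun x => \sum_(n <oo) (h n x)%:E)%E.
  apply/funext => x; apply/esym/cvg_lim => //; rewrite -cvg_shiftS.
  rewrite (_ : [sequence _]_n = EFin \o (fun n => g n x)).
    exact: (cvg_nnsfun_approx measurableT mF (fun x _ => F0 x) Logic.I).
  apply/funext => n /=; elim: n => [|n IH]; first by rewrite big_nat1.
  by rewrite big_nat_recr//= IH -EFinD addrC subrK.
rewrite FE integral_nneseries//; last 2 first.
  by move=> n; exact: (ph n).1.
  by move=> n x _; exact: (ph n).2.
rewrite sadd_series//; apply: eq_eseriesr => n _.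
by apply: sadd_integral_simple => //; rewrite hE; exact: fimfunP.
Qed.

End sadd.
End functionals.

Section functional_probability.
Context dT (T : measurableType dT) (R : realType).
Variable Phi : (T -> \bar R) -> \bar R.
Hypothesis sP : sadd Phi.

(** Zero off the sigma-algebra: [sadd] does not control [Phi] on indicators of non-measurable sets,
    while a measure has to be nonnegative on every set. *)
Definition functional_measure (A : set T) : \bar R :=
  if pselect (measurable A) then Phi (eindic R A) else 0%E.

Lemma functional_measureE A : measurable A -> functional_measure A = Phi (eindic R A).
Proof. by rewrite /functional_measure; case: pselect. Qed.

Let functional_measure0 : functional_measure set0 = 0%E.
Proof.
rewrite functional_measureE// -[RHS](sadd0 sP).
by congr Phi; apply/funext => x; rewrite eindic_notin.
Qed.

Let functional_measure_ge0 A : (0 <= functional_measure A)%E.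
Proof.
rewrite /functional_measure; case: pselect => // mA.
exact/(sadd_ge0 sP)/nnmeas_eindic.
Qed.

Let functional_measure_sigma_additive : semi_sigma_additive functional_measure.
Proof.
move=> F mF tF mUF; rewrite functional_measureE//.
have -> : eindic R (\bigcup_n F n) = (fun x => \sum_(n <oo) eindic R (F n) x)%E.
  apply/funext => x; have [[n _ Fnx]|Fx] := pselect ((\bigcup_n F n) x).
    rewrite eindic_in; last by exists n.
    rewrite (@nneseriesD1 _ _ n)//; last by move=> k _; rewrite lee_fin.
    rewrite eindic_in// eseries0 ?adde0// => k _ /= kn.
    rewrite eindic_notin// => Fkx; move/eqP: kn; apply.
    exact: (tF k n Logic.I Logic.I (ex_intro _ x (conj Fkx Fnx))).
  rewrite eindic_notin// eseries0// => n _ _; rewrite eindic_notin// => Fnx.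
  by apply: Fx; exists n.
rewrite (sadd_series sP); last by move=> n; exact: nnmeas_eindic.
rewrite (_ : (fun n : nat => _) = (fun n => \sum_(0 <= k < n) Phi (eindic R (F k)))%E).
  apply: is_cvg_nneseries => n _ _; exact/(sadd_ge0 sP)/nnmeas_eindic.
by apply/funext => n; apply: eq_bigr => k _; rewrite functional_measureE.
Qed.

HB.instance Definition _ := isMeasure.Build _ _ _ functional_measure
  functional_measure0 functional_measure_ge0 functional_measure_sigma_additive.

Hypothesis P1 : Phi (fun=> 1%E) = 1%E.

Let functional_measureT : functional_measure setT = 1%E.
Proof.
rewrite functional_measureE// -[RHS]P1; congr Phi.
by apply/funext => x; rewrite eindic_in.
Qed.

HB.instance Definition _ := @Measure_isProbability.Build _ _ _ functional_measure
  functional_measureT.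

Lemma sadd_probability : exists P : probability T R,
  forall A, measurable A -> P A = Phi (eindic R A).
Proof. by exists functional_measure => A mA; rewrite -functional_measureE. Qed.

End functional_probability.

(** * The Poisson process as an operator *)

Section operators.
Context (R : realType) (d : nat).
Local Notation E := 'rV[R]_d.
Local Notation C := {fset 'rV[R]_d}.
Local Notation leb := (@lebesgue_row R d).
Implicit Types (X Y : C) (S : set E) (F G : C -> \bar R).

(** The [n]-th iterate integrates over ordered [n]-tuples of points of [S]. Facts about the Poisson
    process thus become algebra of these commuting operators. *)
Definition add_point S F X : \bar R := (\int[leb]_(p in S) F (p |` X)%fset)%E.

Lemma nnmeas_fset1U F X : nnmeas F -> nnmeas (fun p => F (p |` X)%fset).
Proof.
move=> [mF F0]; split; last by move=> p; exact: F0.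
apply: (@measurableT_comp _ _ _ _ _ _ F) => //.
apply: (@measurableT_comp _ _ _ _ _ _ (fun z : E * C => (z.1 |` z.2)%fset) _ (fun p => (p, X))).
  exact: measurable_fset1U.
by apply/measurable_fun_pair.
Qed.

Lemma sadd_add_point S X : measurable S -> sadd (add_point S ^~ X).
Proof.
move=> mS; split.
- by move=> F pF; apply: integral_ge0 => p _; exact: pF.2.
- move=> c F c0 pF; rewrite /add_point ge0_integralZl_EFin//.
  + by move=> p _; exact: pF.2.
  + by apply: measurable_funTS; exact: (nnmeas_fset1U X pF).1.
- move=> Fn pF; rewrite /add_point integral_nneseries//.
  + by move=> n; apply: measurable_funTS; exact: (nnmeas_fset1U X (pF n)).1.
  + by move=> n p _; exact: (pF n).2.
Qed.

Section param.
Context dT (T : measurableType dT) (M : set (T * E)).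
Hypothesis mM : measurable M.

(** The region is a section of [M] so that it may vary with the parameter, as does the updated ball
    with its random center; the operator is then a Tonelli integral over the graph of the
    regions. *)
Lemma nnmeas_add_point_param (F : T * C -> \bar R) : nnmeas F ->
  nnmeas (fun z : T * C => add_point (xsection M z.1) (fun X => F (z.1, X)) z.2).
Proof.
move=> [mF F0]; split; last by move=> z; apply: integral_ge0 => p _; exact: F0.
pose H (u : (T * C) * E) : \bar R :=
  (eindic R M (u.1.1, u.2) * F (u.1.1, u.2 |` u.1.2)%fset)%E.
rewrite (_ : (fun _ => _) = fubini_F leb H).
  apply: measurable_fun_fubini_tonelli_F; last first.
    by move=> u; rewrite mule_ge0// lee_fin.
  apply: emeasurable_funM.
    apply: (@measurableT_comp _ _ _ _ _ _ (eindic R M)); first exact: (nnmeas_eindic R mM).1.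
    apply/measurable_fun_pair => //; exact: (measurableT_comp measurable_fst measurable_fst).
  apply: (@measurableT_comp _ _ _ _ _ _ F) => //.
  apply/measurable_fun_pair; first exact: (measurableT_comp measurable_fst measurable_fst).
  apply: (@measurableT_comp _ _ _ _ _ _ (fun z : E * C => (z.1 |` z.2)%fset) _
    (fun u : (T * C) * E => (u.2, u.1.2))); first exact: measurable_fset1U.
  apply/measurable_fun_pair => //; exact: (measurableT_comp measurable_snd measurable_fst).
apply/funext => z; rewrite /add_point /fubini_F [LHS]integral_mkcond.
apply: eq_integral => p _; rewrite /H patchE /=.
case: ifPn => [/set_mem/set_mem Mp|Mp]; first by rewrite eindic_in// mul1e.
by rewrite eindic_notin ?mul0e// => Mp'; move/negP: Mp; apply; apply/mem_set/mem_set.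
Qed.

Lemma nnmeas_iter_add_point_param n (F : T * C -> \bar R) : nnmeas F ->
  nnmeas (fun z : T * C => iter n (add_point (xsection M z.1)) (fun X => F (z.1, X)) z.2).
Proof.
move=> pF; elim: n => [|n IH]; last exact: (nnmeas_add_point_param IH).
by rewrite (_ : (fun _ => _) = F)//; apply/funext => -[].
Qed.

End param.

Lemma nnmeas_iter_add_point S n F : measurable S -> nnmeas F -> nnmeas (iter n (add_point S) F).
Proof.
move=> mS pF.
have mM : measurable ([set: unit] `*` S) by exact: measurableX.
have pF' : nnmeas (fun z : unit * C => F z.2).
  split; last by move=> z; exact: pF.2.
  by apply: (@measurableT_comp _ _ _ _ _ _ F) => //; exact: pF.1.
have [m p] := nnmeas_iter_add_point_param mM n pF'.
have SE : xsection ([set: unit] `*` S) tt = S by rewrite in_xsectionX// inE.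
split; last by move=> X; have := p (tt, X); rewrite /= SE.
have := @measurableT_comp _ _ _ _ _ _ _ _ (fun X : C => (tt, X)) m.
by rewrite /comp /= SE; apply; apply/measurable_fun_pair.
Qed.

Lemma sadd_iter_add_point S n X : measurable S -> sadd (fun F => iter n (add_point S) F X).
Proof.
move=> mS; elim: n X => [|n IH] X /=.
  split=> //; first by move=> F [].
have sA := @sadd_add_point S X mS; split.
- by move=> F pF; apply: (sadd_ge0 sA); exact: nnmeas_iter_add_point.
- move=> c F c0 pF; rewrite -(saddZ sA c0); last exact: nnmeas_iter_add_point.
  by congr (add_point S _ X); apply/funext => Y; rewrite (saddZ (IH Y)).
- move=> Fn pF; rewrite -(sadd_series sA); last by move=> k; exact: nnmeas_iter_add_point.
  by congr (add_point S _ X); apply/funext => Y; rewrite (sadd_series (IH Y)).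
Qed.

Variable lam : R.
Hypothesis lam_ge0 : 0 <= lam.

Definition pois_coef n : R := lam ^+ n / n`!%:R.

Lemma pois_coef_ge0 n : 0 <= pois_coef n.
Proof. by rewrite divr_ge0// exprn_ge0. Qed.

(* [expR (- lam |S|)] times this is the expectation of [F] over the union of [X] and a
   Poisson process of intensity [lam] on [S]. *)
Definition pois S F X : \bar R :=
  (\sum_(n <oo) (pois_coef n)%:E * iter n (add_point S) F X)%E.

Lemma nnmeas_pois_param dT (T : measurableType dT) (M : set (T * E)) (F : T * C -> \bar R) :
  measurable M -> nnmeas F ->
  nnmeas (fun z : T * C => pois (xsection M z.1) (fun X => F (z.1, X)) z.2).
Proof.
move=> mM pF; apply: nnmeas_nneseries => n; apply: nnmeas_scale; first exact: pois_coef_ge0.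
exact: nnmeas_iter_add_point_param.
Qed.

Lemma nnmeas_pois S F : measurable S -> nnmeas F -> nnmeas (pois S F).
Proof.
move=> mS pF; apply: nnmeas_nneseries => n; apply: nnmeas_scale; first exact: pois_coef_ge0.
exact: nnmeas_iter_add_point.
Qed.

Lemma sadd_pois S X : measurable S -> sadd (fun F => pois S F X).
Proof.
move=> mS; have sI n := sadd_iter_add_point n X mS; split.
- move=> F pF; apply: nneseries_ge0 => n _ _; rewrite mule_ge0 ?lee_fin ?pois_coef_ge0//.
  exact: (sadd_ge0 (sI n)).
- move=> c F c0 pF; rewrite /pois -nneseriesZl//; last first.
    move=> n _; rewrite mule_ge0 ?lee_fin ?pois_coef_ge0//; exact: (sadd_ge0 (sI n)).
  by apply: eq_eseriesr => n _; rewrite (saddZ (sI n))// muleCA.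
- move=> Fn pF; have IF0 n k : (0 <= iter n (add_point S) (Fn k) X)%E by exact: (sadd_ge0 (sI n)).
  transitivity (\sum_(n <oo) \sum_(k <oo)
      ((pois_coef n)%:E * iter n (add_point S) (Fn k) X))%E.
    by apply: eq_eseriesr => n _; rewrite (sadd_series (sI n))// nneseriesZl.
  by rewrite nneseries_interchange// => i j; rewrite mule_ge0 ?lee_fin ?pois_coef_ge0.
Qed.

Lemma integral_eindic (S : set E) (g : E -> \bar R) :
  (\int[leb]_(p in S) g p = \int[leb]_p (eindic R S p * g p))%E.
Proof.
rewrite [LHS]integral_mkcond; apply: eq_integral => p _; rewrite patchE.
case: ifPn => [/set_mem Sp|Sp]; first by rewrite eindic_in// mul1e.
by rewrite eindic_notin ?mul0e// => Sp'; move/negP: Sp; apply; apply/mem_set.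
Qed.

(** Tonelli: the resulting set does not depend on the order in which the two points are inserted. *)
Lemma add_pointC S S' F X : measurable S -> measurable S' -> nnmeas F ->
  add_point S (add_point S' F) X = add_point S' (add_point S F) X.
Proof.
move=> mS mS' pF.
have mFpq : measurable_fun setT (fun u : E * E => F (u.2 |` (u.1 |` X))%fset).
  apply: (@measurableT_comp _ _ _ _ _ _ F); first exact: pF.1.
  apply: (@measurableT_comp _ _ _ _ _ _ (fun z : E * C => (z.1 |` z.2)%fset) _
    (fun u : E * E => (u.2, u.1 |` X)%fset)); first exact: measurable_fset1U.
  apply/measurable_fun_pair => //.
  apply: (@measurableT_comp _ _ _ _ _ _ (fun z : E * C => (z.1 |` z.2)%fset) _
    (fun u : E * E => (u.1, X)%fset)); first exact: measurable_fset1U.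
  by apply/measurable_fun_pair.
pose H (u : E * E) := (eindic R S u.1 * (eindic R S' u.2 * F (u.2 |` (u.1 |` X))%fset))%E.
have e0 (A : set E) p : (0 <= eindic R A p)%E by rewrite lee_fin.
have mH : measurable_fun setT H.
  have me (A : set E) (f : E * E -> E) : measurable A -> measurable_fun setT f ->
      measurable_fun setT (fun u => eindic R A (f u)).
    by move=> mA mf; apply: (@measurableT_comp _ _ _ _ _ _ (eindic R A)) => //;
      exact: (nnmeas_eindic R mA).1.
  apply: emeasurable_funM; first exact: me.
  by apply: emeasurable_funM => //; exact: me.
have H0 u : (0 <= H u)%E by rewrite !mule_ge0//; exact: pF.2.
have mX (A : set E) Y : measurable A -> measurable_fun setT
    (fun p => (eindic R A p * F (p |` Y)%fset)%E).
  move=> mA; apply: emeasurable_funM; first exact: (nnmeas_eindic R mA).1.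
  exact: (nnmeas_fset1U Y pF).1.
have Zl (A : set E) Y (c : R) : measurable A -> 0 <= c ->
    (c%:E * \int[leb]_p (eindic R A p * F (p |` Y)%fset) =
     \int[leb]_p (c%:E * (eindic R A p * F (p |` Y)%fset)))%E.
  move=> mA c0; apply/esym/ge0_integralZl_EFin => //; last exact: mX.
  by move=> p _; rewrite mule_ge0//; exact: pF.2.
have := @fubini_tonelli _ _ _ _ _ leb leb H mH H0.
rewrite /fubini_F /fubini_G /add_point => HE.
transitivity (\int[leb]_x \int[leb]_y H (x, y))%E.
  rewrite integral_eindic; apply: eq_integral => p _.
  by rewrite integral_eindic; exact: (Zl S' (p |` X)%fset (\1_S p)).
rewrite HE [RHS]integral_eindic; apply: eq_integral => q _.
rewrite (integral_eindic S).
transitivity (\int[leb]_p (eindic R S' q * (eindic R S p * F (p |` (q |` X))%fset)))%E.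
  by apply: eq_integral => p _; rewrite /H muleCA fsetUCA.
by apply/esym; exact: (Zl S (q |` X)%fset (\1_S' q)).
Qed.

Lemma add_pointU S S' F X : measurable S -> measurable S' -> [disjoint S & S'] -> nnmeas F ->
  add_point (S `|` S') F X = (add_point S F X + add_point S' F X)%E.
Proof.
move=> mS mS' SS' pF; rewrite /add_point ge0_integral_setU//.
- by apply: measurable_funTS; exact: (nnmeas_fset1U X pF).1.
- by move=> p _; exact: pF.2.
Qed.

(** The basic coupling: the same new points enter two configurations related by [I]. Leaving [I]
    free covers equality, agreement off a set and constraints on the support. *)
Lemma iter_add_point_le S (I : C -> C -> Prop) F F' n : measurable S -> nnmeas F -> nnmeas F' ->
  (forall p X X', S p -> I X X' -> I (p |` X)%fset (p |` X')%fset) ->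
  (forall X X', I X X' -> F X <= F' X')%E ->
  (forall X X', I X X' -> iter n (add_point S) F X <= iter n (add_point S) F' X')%E.
Proof.
move=> mS pF pF' IS IF; elim: n => [//|n IH] X X' IXX' /=.
apply: ge0_le_integral => //.
- by move=> p _; exact: (nnmeas_iter_add_point n mS pF).2.
- by apply: measurable_funTS; exact: (nnmeas_fset1U X (nnmeas_iter_add_point n mS pF)).1.
- by apply: measurable_funTS; exact: (nnmeas_fset1U X' (nnmeas_iter_add_point n mS pF')).1.
- by move=> p Sp; apply: IH; exact: IS.
Qed.

Lemma pois_le S (I : C -> C -> Prop) F F' : measurable S -> nnmeas F -> nnmeas F' ->
  (forall p X X', S p -> I X X' -> I (p |` X)%fset (p |` X')%fset) ->
  (forall X X', I X X' -> F X <= F' X')%E ->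
  (forall X X', I X X' -> pois S F X <= pois S F' X')%E.
Proof.
move=> mS pF pF' IS IF X X' IXX'; apply: lee_nneseries => n _.
  by rewrite mule_ge0 ?lee_fin ?pois_coef_ge0//; exact: (nnmeas_iter_add_point n mS pF).2.
by rewrite lee_wpmul2l ?lee_fin ?pois_coef_ge0//; exact: (iter_add_point_le n mS pF pF' IS IF).
Qed.

End operators.

Lemma nneseries_finite (R : realType) (u : nat -> \bar R) n :
  (forall k, (0 <= u k)%E) -> (forall k, (n <= k)%N -> u k = 0%E) ->
  (\sum_(k <oo) u k = \sum_(k < n) u k)%E.
Proof.
move=> u0 un; rewrite (nneseries_split 0%N n)//.
by rewrite add0n big_mkord eseries0 ?adde0// => k nk _; exact: un.
Qed.

Lemma nneseries_cauchy (R : realType) (b : nat -> nat -> \bar R) :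
  (forall k j, (0 <= b k j)%E) ->
  (\sum_(n <oo) \sum_(k < n.+1) b k (n - k)%N = \sum_(k <oo) \sum_(j <oo) b k j)%E.
Proof.
move=> b0.
(* Extension by zero turns the triangle into a full double series, whose sums can be exchanged. *)
pose g n k := if (k <= n)%N then b k (n - k)%N else 0%E.
have g0 n k : (0 <= g n k)%E by rewrite /g; case: ifP.
transitivity (\sum_(n <oo) \sum_(k <oo) g n k)%E.
  apply: eq_eseriesr => n _; rewrite (@nneseries_finite _ _ n.+1)//; last first.
    by move=> k nk; rewrite /g leqNgt nk.
  by apply: eq_bigr => k _; rewrite /g -ltnS ltn_ord.
rewrite nneseries_interchange//; apply: eq_eseriesr => k _.
rewrite (nneseries_split 0%N k)// add0n big_mkord big1 ?add0e; last first.
  by move=> i _; rewrite /g leqNgt ltn_ord.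
rewrite -(@nneseries_addn _ (g ^~ k))//.
by apply: eq_eseriesr => n _; rewrite /g leq_addl addnK.
Qed.

(** * Superposition: the Poisson process over disjoint regions *)

Section superposition.
Context (R : realType) (d : nat).
Local Notation E := 'rV[R]_d.
Local Notation C := {fset 'rV[R]_d}.
Implicit Types (X Y : C) (S : set E) (F G : C -> \bar R).
Variable lam : R.
Hypothesis lam_ge0 : 0 <= lam.
Local Notation pois := (pois lam).
Local Notation pois_coef := (pois_coef lam).

Lemma pois_coefS n : lam * pois_coef n = n.+1%:R * pois_coef n.+1.
Proof.
rewrite /pois_coef exprS factS natrM invfM [RHS]mulrCA mulVKf ?pnatr_eq0//.
by rewrite mulrA.
Qed.

Lemma pois_coef0 : pois_coef 0 = 1.
Proof. by rewrite /pois_coef expr0 fact0 divr1. Qed.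

Lemma iter_add_pointC S S' F n : measurable S -> measurable S' -> nnmeas F ->
  add_point S (iter n (add_point S') F) = iter n (add_point S') (add_point S F).
Proof.
move=> mS mS' pF; elim: n => //= n IH; rewrite -IH; apply/funext => X.
by rewrite add_pointC//; exact: nnmeas_iter_add_point.
Qed.

Section disjoint_union.
Variables S1 S2 : set E.
Hypotheses (mS1 : measurable S1) (mS2 : measurable S2) (S12 : [disjoint S1 & S2]).

Let a F k j := iter k (add_point S1) (iter j (add_point S2) F).

Let pa F k j : nnmeas F -> nnmeas (a F k j).
Proof. by move=> pF; do 2 apply: nnmeas_iter_add_point => //. Qed.

(** The binomial theorem for the commuting operators [add_point S1] and [add_point S2], the
    factorials being absorbed in [pois_coef]. *)
Lemma iter_add_pointU F n X : nnmeas F ->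
  ((pois_coef n)%:E * iter n (add_point (S1 `|` S2)) F X =
   \sum_(k < n.+1) (pois_coef k * pois_coef (n - k))%:E * a F k (n - k) X)%E.
Proof.
move=> pF; elim: n X => [|n IH] X.
  by rewrite big_ord1 /= subnn pois_coef0 mulr1.
have mU : measurable (S1 `|` S2) by exact: measurableU.
have c0 := pois_coef_ge0 lam_ge0.
have pn k : nnmeas (fun Y => (pois_coef k * pois_coef (n - k))%:E * a F k (n - k) Y)%E.
  by apply: nnmeas_scale; [rewrite mulr_ge0|exact: pa].
(* The claim for [n.+1] is proved after multiplication by [n.+1], the factor that [pois_coefS]
   produces; [K] cancels it. *)
have step : ((n.+1%:R * pois_coef n.+1)%:E * iter n.+1 (add_point (S1 `|` S2)) F X =
  \sum_(k < n.+1) ((lam * pois_coef k * pois_coef (n - k))%:E *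
     (a F k.+1 (n - k) X + a F k (n - k).+1 X)))%E.
  rewrite -pois_coefS EFinM -muleA /= -(saddZ (sadd_add_point X mU))//; last first.
    exact: nnmeas_iter_add_point.
  under [X in add_point _ X]funext do rewrite IH.
  rewrite add_pointU//; last first.
    split; last by move=> Y; apply: sume_ge0 => k _; exact: (pn k).2.
    by apply: emeasurable_sum => k; exact: (pn k).1.
  rewrite (sadd_sum (sadd_add_point X mS1))// (sadd_sum (sadd_add_point X mS2))//.
  rewrite -big_split ge0_sume_distrr /=; last first.
    move=> k _; rewrite adde_ge0//; [exact: (sadd_ge0 (sadd_add_point X mS1))|exact:
      (sadd_ge0 (sadd_add_point X mS2))].
  apply: eq_bigr => k _.
  rewrite (saddZ (sadd_add_point X mS1) (mulr_ge0 (c0 _) (c0 _)) (pa _ _ pF)).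
  rewrite (saddZ (sadd_add_point X mS2) (mulr_ge0 (c0 _) (c0 _)) (pa _ _ pF)).
  rewrite -ge0_muleDr; [|exact: (pa k.+1 (n - k) pF).2|].
    by rewrite muleA -EFinM mulrA {2}/a iter_add_pointC//; exact: nnmeas_iter_add_point.
  by apply: (sadd_ge0 (sadd_add_point X mS2)); exact: pa.
have K (N : R) x y : N != 0 -> (N%:E * x = N%:E * y)%E -> x = y.
  by move=> N0 /(congr1 (mule (N^-1)%:E)); rewrite !muleA -!EFinM mulVf// !mul1e.
apply: (K n.+1%:R); first by rewrite pnatr_eq0.
rewrite muleA -EFinM step.
pose t k : R := pois_coef k * pois_coef (n.+1 - k); pose u k := a F k (n.+1 - k) X.
have u0 k : (0 <= u k)%E by exact: (pa k (n.+1 - k) pF).2.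
have t0 k : 0 <= t k by rewrite mulr_ge0.
(* The weight [n.+1] is split as [k + (n.+1 - k)]: the first part accounts for a last point added in
   [S1], the second for one in [S2]. *)
transitivity (\sum_(k < n.+2) ((k%:R * t k)%:E * u k) +
              \sum_(k < n.+2) (((n.+1 - k)%:R * t k)%:E * u k))%E.
  rewrite [X in _ = (X + _)%E]big_ord_recl /= mul0r mul0e add0e [X in _ =
    (_ + X)%E]big_ord_recr /=.
  rewrite subnn mul0r mul0e adde0 -big_split /=; apply: eq_bigr => k _.
  have kn : (k <= n)%N by rewrite -ltnS.
  rewrite ge0_muleDr; [|exact: (pa k.+1 (n - k) pF).2|exact: (pa k (n - k).+1 pF).2].
  rewrite /bump /= add1n /t /u subSS subSn//; congr (_%:E * _ + _%:E * _)%E.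
    by rewrite mulrA -pois_coefS mulrA.
  by rewrite [RHS]mulrCA -pois_coefS [RHS]mulrCA [RHS]mulrA.
rewrite -big_split ge0_sume_distrr//=; last by move=> k _; apply: mule_ge0; [rewrite lee_fin;
  exact: t0|exact: u0].
apply: eq_bigr => k _; rewrite -ge0_muleDl ?lee_fin ?(mulr_ge0 (ler0n _ _) (t0 _))//.
rewrite -EFinD -mulrDl -natrD subnKC; last by rewrite -ltnS.
by rewrite EFinM muleA.
Qed.

(** The exponential of a sum of commuting operators is the product of their exponentials. *)
Lemma pois_setU F X : nnmeas F ->
  pois (S1 `|` S2) F X = pois S1 (pois S2 F) X.
Proof.
move=> pF; have c0 := pois_coef_ge0 lam_ge0.
rewrite /pois; under eq_eseriesr do rewrite iter_add_pointU//.
rewrite (@nneseries_cauchy _ (fun k j => (pois_coef k * pois_coef j)%:E * a F k j X)%E);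
  last first.
  by move=> k j; apply: mule_ge0; [rewrite lee_fin; exact: mulr_ge0|exact: (pa k j pF).2].
apply: eq_eseriesr => k _.
have sI := sadd_iter_add_point k X mS1.
have pi j : nnmeas (iter j (add_point S2) F) by exact: nnmeas_iter_add_point.
rewrite (sadd_series sI); last by move=> j; exact: nnmeas_scale.
rewrite -nneseriesZl; last by move=> j _; apply: (sadd_ge0 sI); exact: nnmeas_scale.
by apply: eq_eseriesr => j _; rewrite (saddZ sI)// muleA -EFinM.
Qed.

End disjoint_union.
End superposition.

(** * Agreement with the definition of the process by tuples *)

Section tuples.
Context (R : realType) (d : nat).
Local Notation E := 'rV[R]_d.
Local Notation C := {fset 'rV[R]_d}.
Local Notation leb := (@lebesgue_row R d).
Implicit Types (X Y : C) (S : set E) (F G : C -> \bar R).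

(** Induction needs an arbitrary [X], in which the points already inserted accumulate; the same
    generality later serves for resampling given other centers. *)
Lemma iter_add_point_tuple S (A : set C) n X :
  iter n (add_point S) (eindic R A) X = tuple_measure leb n
    [set t : n.-tuple E | (forall i, S (tnth t i)) /\ A (X `|` [fset x in val t])%fset].
Proof.
elim: n X => [|n IH] X.
  have X0 : (X `|` [fset x in val [tuple of [::] : seq E]])%fset = X.
    by apply/fsetP => x; rewrite !inE orbF.
  rewrite /= diracE; have [AX|AX] := pselect (A X).
    rewrite eindic_in//; rewrite mem_set//; split; first by case.
    by rewrite X0.
  by rewrite eindic_notin// memNset//= => -[_]; rewrite X0.
rewrite /= /add_point /cons_measure /pushforward /= /product_measure1 integral_mkcond.
apply: eq_integral => p _; rewrite patchE /=.
case: ifPn => [/set_mem Sp|/negP Sp].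
  rewrite IH; congr (tuple_measure leb n _); apply/funext => t; apply/propext.
  have tE : (X `|` [fset x in val (cons_pair (p, t))])%fset =
            ((p |` X) `|` [fset x in val t])%fset.
    by apply/fsetP => x; rewrite !inE orbA [(_ == _) || _]orbC.
  rewrite /xsection /=; split.
    move=> [St At]; apply/mem_set; rewrite /= tE; split => // i.
    by case: (unliftP ord0 i) => [j ->|->]; rewrite ?tnthS ?tnth0.
  move=> /set_mem; rewrite /= tE => -[St At]; split => // i.
  by have := St (lift ord0 i); rewrite tnthS.
transitivity (tuple_measure leb n set0); first by rewrite measure0.
congr (tuple_measure leb n _); apply/seteqP; split => // t /set_mem /= [St _].
by apply: Sp; apply/mem_set; have := St ord0; rewrite tnth0.
Qed.

End tuples.
Lemma measurable_inv (R : realType) : measurable_fun setT (fun x : R => x^-1).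
Proof.
rewrite -(setvU [set 0 : R]); apply/measurable_funU => //; first exact: measurableC.
split; last exact: measurable_fun_set1.
apply: open_continuous_measurable_fun.
  by apply/closed_openC/closed_eq.
by move=> x /set_mem /= /eqP x0; exact: inv_continuous.
Qed.

(** * The hard sphere model *)

Section conditioned.
Context (R : realType) (d : nat).
Local Notation E := 'rV[R]_d.
Local Notation C := {fset 'rV[R]_d}.
Local Notation leb := (@lebesgue_row R d).
Implicit Types (X Y : C) (S B : set E) (F G : C -> \bar R).
Variables (r lam : R).
Hypothesis lam_ge0 : 0 <= lam.
Local Notation pois := (pois lam).
Local Notation pois_coef := (pois_coef lam).
Local Notation H := (@hard_core R d r).

Let mH : measurable H := @measurable_hard_core R d r.

Lemma iter_add_point1 S n X : measurable S -> (leb S < +oo)%E ->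
  iter n (add_point S) (fun=> 1%E) X = ((fine (leb S)) ^+ n)%:E.
Proof.
move=> mS Soo; elim: n X => [//|n IH] X /=; rewrite /add_point.
under eq_integral do rewrite IH.
rewrite integral_cst// exprSr EFinM fineK// ge0_fin_numE//.
Qed.

Lemma pois1 S X : measurable S -> (leb S < +oo)%E ->
  pois S (fun=> 1%E) X = (expR (lam * fine (leb S)))%:E.
Proof.
move=> mS Soo; rewrite /pois /expR -EFin_lim; last exact: is_cvg_series_exp_coeff.
congr (limn _); apply/funext => n; rewrite /= /series /= -sumEFin.
apply: eq_bigr => k _; rewrite iter_add_point1// -EFinM /pois_coef /exp_coeff /=.
by rewrite exprMn mulrAC.
Qed.

Definition hc F Y := (eindic R H Y * F Y)%E.

Lemma hcT F Y : H Y -> hc F Y = F Y.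
Proof. by move=> HY; rewrite /hc eindic_in// mul1e. Qed.

Lemma hcF F Y : ~ H Y -> hc F Y = 0%E.
Proof. by move=> HY; rewrite /hc eindic_notin// mul0e. Qed.

Lemma nnmeas_hc F : nnmeas F -> nnmeas (hc F).
Proof. by move=> pF; apply: nnmeas_mul => //; exact: nnmeas_eindic. Qed.

Lemma nnmeas1 : nnmeas (fun=> 1%E : \bar R) (T := C).
Proof. by split. Qed.

Definition partition_function S X := pois S (hc (fun=> 1%E)) X.

(* The expectation of [F] over the union of [X] and a Poisson process on [S], conditioned
   on this union being hard core; it is [0] when [X] itself is not hard core. *)
Definition cond_pois S F X :=
  (pois S (hc F) X * ((fine (partition_function S X))^-1)%:E)%E.

Lemma pois_ge0 S F X : measurable S -> nnmeas F -> (0 <= pois S F X)%E.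
Proof. by move=> mS pF; exact: (nnmeas_pois lam_ge0 mS pF).2. Qed.

Lemma pois_eq S (I : C -> Prop) F F' : measurable S -> nnmeas F -> nnmeas F' ->
  (forall p X, S p -> I X -> I (p |` X)%fset) ->
  (forall X, I X -> F X = F' X) -> forall X, I X -> pois S F X = pois S F' X.
Proof.
move=> mS pF pF' IS IF X IX; apply/eqP; rewrite eq_le; apply/andP; split.
  apply: (pois_le lam_ge0 (I := fun X Y => X = Y /\ I X)) => // [p Y _ Sp [<- IY]|Y _ [<- IY]].
    by split => //; exact: IS.
  by rewrite IF.
apply: (pois_le lam_ge0 (I := fun X Y => X = Y /\ I X)) => // [p Y _ Sp [<- IY]|Y _ [<- IY]].
  by split => //; exact: IS.
by rewrite IF.
Qed.

Lemma partition_function_ge0 S X : measurable S -> (0 <= partition_function S X)%E.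
Proof. by move=> mS; apply: pois_ge0 => //; apply: nnmeas_hc; exact: nnmeas1. Qed.

Lemma partition_function_fin S X : measurable S -> (leb S < +oo)%E ->
  partition_function S X \is a fin_num.
Proof.
move=> mS Soo; rewrite ge0_fin_numE ?partition_function_ge0//.
apply: (@le_lt_trans _ _ (pois S (fun=> 1%E) X)); last by rewrite pois1// ltry.
apply: (pois_le lam_ge0 (I := eq)) => //.
- by apply: nnmeas_hc; exact: nnmeas1.
- by move=> p Y _ _ <-.
- move=> Y Y' _; rewrite /hc mule1.
  by rewrite /eindic lee_fin indicE lern1; case: (_ \in _).
Qed.

(** The term without new points already contributes [1]. The normalisation in [cond_pois] is
    therefore a genuine division whenever [X] is hard core. *)
Lemma partition_function_ge1 S X : measurable S -> H X -> (1 <= partition_function S X)%E.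
Proof.
move=> mS HX; have pH := nnmeas_hc nnmeas1.
rewrite /partition_function /pois (@nneseriesD1 _ _ 0%N)//; last first.
  move=> k _; apply: mule_ge0; first by rewrite lee_fin pois_coef_ge0.
  exact: (nnmeas_iter_add_point k mS pH).2.
rewrite /= hcT// pois_coef0 mul1e leeDl//; apply: nneseries_ge0 => k _ _.
apply: mule_ge0; first by rewrite lee_fin pois_coef_ge0.
exact: (nnmeas_iter_add_point k mS pH).2.
Qed.

Lemma pois_eindic S (A : set C) X :
  pois S (eindic R A) X = (\sum_(n <oo) ((lam ^+ n / n`!%:R)%:E *
   tuple_measure leb n [set t : n.-tuple E |
     (forall i, S (tnth t i)) /\ A (X `|` [fset x in val t])%fset]))%E.
Proof. by apply: eq_eseriesr => n _; rewrite iter_add_point_tuple. Qed.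

Lemma hc_eindic (A : set C) : hc (eindic R A) = eindic R (A `&` H).
Proof.
apply/funext => Y; have [HY|HY] := pselect (H Y); last by rewrite hcF// eindic_notin// => -[].
rewrite hcT//; have [AY|AY] := pselect (A Y); first by rewrite !eindic_in.
by rewrite !eindic_notin// => -[].
Qed.

(** The exponential prefactor of the process occurs in numerator and denominator and cancels.
    Keeping [glue] as a variable covers both the hard sphere model, where it is the identity, and
    resampling. *)
Lemma cond_law_poisson S (A : set C) (glue : C -> C) X : measurable S -> (leb S < +oo)%E ->
  glue = (fun Y => X `|` Y)%fset ->
  cond_law (poisson_process lam S) (glue @^-1` H) (glue @^-1` A) =
  cond_pois S (eindic R A) X.
Proof.
move=> mS Soo ->.
have PE (B : set C) : poisson_process lam S ((fun Y => X `|` Y)%fset @^-1` B) =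
    ((expR (- (lam * fine (leb S))))%:E * pois S (eindic R B) X)%E.
  by rewrite pois_eindic.
rewrite /cond_law -preimage_setI !PE /cond_pois hc_eindic.
have -> : eindic R H = hc (fun=> 1%E) by apply/funext => Y; rewrite /hc mule1.
rewrite -/(partition_function S X) fineM ?partition_function_fin// invfM EFinM /=.
rewrite -muleA [X in (_ * X)%E]muleCA muleA -EFinM mulfV ?mul1e//.
by rewrite expR_eq0.
Qed.

End conditioned.

Lemma nnmeas_comp d1 d2 (T1 : measurableType d1) (T2 : measurableType d2) (R : realType)
    (f : T1 -> T2) (G : T2 -> \bar R) :
  measurable_fun setT f -> nnmeas G -> nnmeas (fun x => G (f x)).
Proof.
move=> mf [mG G0]; split; last by move=> x; exact: G0.
exact: (measurableT_comp mG mf).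
Qed.

Lemma sadd_scaler d1 (T1 : measurableType d1) (R : realType)
    (Phi : (T1 -> \bar R) -> \bar R) (c : R) : 0 <= c -> sadd Phi ->
  sadd (fun F => Phi F * c%:E)%E.
Proof.
move=> c0 sP; split.
- by move=> F pF; apply: mule_ge0; [exact: (sadd_ge0 sP)|rewrite lee_fin].
- by move=> a F a0 pF; rewrite (saddZ sP)// muleA.
- move=> Fn pF; rewrite (sadd_series sP)// muleC -nneseriesZl; last first.
    by move=> n _; exact: (sadd_ge0 sP).
  by apply: eq_eseriesr => n _; rewrite muleC.
Qed.

Lemma measurable_einv d1 (T1 : measurableType d1) (R : realType) (f : T1 -> \bar R) :
  measurable_fun setT f -> measurable_fun setT (fun x => ((fine (f x))^-1)%:E).
Proof.
move=> mf; apply/measurable_EFinP.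
apply: (@measurableT_comp _ _ _ _ _ _ (fun x : R => x^-1)); first exact: measurable_inv.
exact: measurableT_comp.
Qed.

(** * Heat-bath dynamics *)

Section heat_bath.
Context (R : realType) (d : nat).
Local Notation E := 'rV[R]_d.
Local Notation C := {fset 'rV[R]_d}.
Local Notation leb := (@lebesgue_row R d).
Implicit Types (X Y : C) (S B : set E) (F G : C -> \bar R).
Variables (r lam L : R).
Hypothesis lam_ge0 : 0 <= lam.
Local Notation pois := (pois lam).
Local Notation H := (@hard_core R d r).
Local Notation hc := (@hc R d r).
Local Notation partition_function := (partition_function r lam).
Local Notation cond_pois := (cond_pois r lam).

Lemma sadd_pois_hc S X : measurable S -> sadd (fun F => pois S (hc F) X).
Proof.
move=> mS; have sP := sadd_pois lam_ge0 X mS; split.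
- by move=> F pF; apply: (sadd_ge0 sP); exact: nnmeas_hc.
- move=> c F c0 pF; rewrite -(saddZ sP)//; last exact: nnmeas_hc.
  by congr (pois S _ X); apply/funext => Y; rewrite /hc muleCA.
- move=> Fn pF; rewrite -(sadd_series sP); last by move=> n; exact: nnmeas_hc.
  congr (pois S _ X); apply/funext => Y; rewrite /hc nneseriesZl// => n _.
  exact: (pF n).2.
Qed.

Lemma partition_inv_ge0 S X : measurable S -> 0 <= (fine (partition_function S X))^-1.
Proof. by move=> mS; rewrite invr_ge0 fine_ge0// partition_function_ge0. Qed.

Lemma sadd_cond_pois S X : measurable S -> sadd (fun F => cond_pois S F X).
Proof.
by move=> mS; apply: sadd_scaler; [exact: partition_inv_ge0|exact: sadd_pois_hc].
Qed.

Lemma cond_pois1 S X : measurable S -> (leb S < +oo)%E -> H X ->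
  cond_pois S (fun=> 1%E) X = 1%E.
Proof.
move=> mS Soo HX; rewrite /cond_pois -/(partition_function S X).
have fZ := partition_function_fin r lam_ge0 X mS Soo.
have := partition_function_ge1 lam_ge0 mS HX.
rewrite -[partition_function S X]fineK// lee_fin -EFinM => Z1.
by rewrite divff// gt_eqF// (lt_le_trans ltr01).
Qed.

Lemma hc_ext F F' : (forall Y, H Y -> F Y = F' Y) -> hc F = hc F'.
Proof.
move=> FF'; apply/funext => Y; have [HY|HY] := pselect (H Y); last by rewrite !hcF.
by rewrite !hcT// FF'.
Qed.

Lemma pois_hc_le_partition S F X : measurable S -> nnmeas F -> (forall Y, F Y <= 1)%E ->
  (pois S (hc F) X <= partition_function S X)%E.
Proof.
move=> mS pF F1; apply: (pois_le lam_ge0 (I := eq)) => //.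
- exact: nnmeas_hc.
- by apply: nnmeas_hc; exact: nnmeas1.
- by move=> p Y _ _ <-.
- move=> Y _ <-; have [HY|HY] := pselect (H Y); last by rewrite !hcF.
  by rewrite !hcT.
Qed.

Definition resamp S x F X := cond_pois (S `&` eball L x) F (fset_restr X (~` eball L x)).

Lemma measurable_setI_eball S x : measurable S -> measurable (S `&` eball L x).
Proof. by move=> mS; apply: measurableI => //; exact: measurable_eball. Qed.

Lemma leb_setI_eball S x : measurable S -> (leb S < +oo)%E -> (leb (S `&` eball L x) < +oo)%E.
Proof.
move=> mS; apply: le_lt_trans; apply: le_measure; rewrite ?inE//.
exact: measurable_setI_eball.
Qed.

Lemma sadd_resamp S x X : measurable S -> sadd (fun F => resamp S x F X).
Proof. by move=> mS; apply: sadd_cond_pois; exact: measurable_setI_eball. Qed.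

Lemma hard_core_restr X (A : set E) : H X -> H (fset_restr X A).
Proof.
by move=> HX x y /fset_restrP[xX _] /fset_restrP[yX _]; exact: HX.
Qed.

Lemma resamp1 S x X : measurable S -> (leb S < +oo)%E -> H X -> resamp S x (fun=> 1%E) X = 1%E.
Proof.
move=> mS Soo HX; apply: cond_pois1; first exact: measurable_setI_eball.
  exact: leb_setI_eball.
exact: hard_core_restr.
Qed.

Lemma resamp_ext S x F F' : (forall Y, H Y -> F Y = F' Y) -> resamp S x F = resamp S x F'.
Proof. by move=> FF'; apply/funext => X; rewrite /resamp /cond_pois (hc_ext FF'). Qed.

Lemma nnmeas_resamp_joint S F : measurable S -> nnmeas F ->
  nnmeas (fun z : E * C => resamp S z.1 F z.2).
Proof.
move=> mS pF.
(* The graph of the balls: its section at [x] is [eball L x], so the moving ball becomes a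
   parametrised region. *)
pose M := [set u : E * E | enorm (u.2 - u.1) < L].
have mM : measurable M := @measurable_eball_graph R d L.
have mM2 : measurable ((setT `*` S) `&` M) by apply: measurableI => //; exact: measurableX.
have E1 x : xsection ((setT `*` S) `&` M) x = S `&` eball L x.
  apply/funext => p; apply/propext; rewrite /xsection /=; split.
    by move=> /set_mem[[_ Sp] Mp]; split.
  by move=> [Sp Mp]; apply/mem_set; split.
have E2 x : xsection (~` M) x = ~` eball L x.
  apply/funext => p; apply/propext; rewrite /xsection /=; split.
    by move=> /set_mem.
  by move=> Mp; apply/mem_set.
have mr : measurable_fun setT (fun z : E * C => (z.1, fset_restr z.2 (~` eball L z.1))).
  apply/measurable_fun_pair => //.
  under eq_fun do rewrite -E2.
  by apply: measurable_fset_restr; exact: measurableC.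
have P1 G : nnmeas G ->
    nnmeas (fun z : E * C => pois (S `&` eball L z.1) (hc G) (fset_restr z.2 (~` eball L z.1))).
  move=> pG.
  have pG' : nnmeas (fun z : E * C => hc G z.2).
    by apply: (nnmeas_comp (f := snd)) => //; exact: nnmeas_hc.
  have := nnmeas_comp mr (nnmeas_pois_param lam_ge0 mM2 pG').
  by under eq_fun do rewrite /= E1.
apply: nnmeas_mul; first exact: P1.
split; last by move=> z; rewrite lee_fin partition_inv_ge0//; exact: measurable_setI_eball.
by apply: measurable_einv; exact: (P1 _ (@nnmeas1 R d)).1.
Qed.

Section update.
Variables (S U : set E).
Hypotheses (mS : measurable S) (Soo : (leb S < +oo)%E).
Hypotheses (mU : measurable U) (U0 : (0 < leb U)%E) (Uoo : (leb U < +oo)%E).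

Definition heat F X :=
  (((fine (leb U))^-1)%:E * \int[leb]_(x in U) resamp S x F X)%E.

Let uI0 : 0 <= (fine (leb U))^-1.
Proof. by rewrite invr_ge0 fine_ge0. Qed.

Lemma measurable_resamp F X : nnmeas F -> measurable_fun U (fun x => resamp S x F X).
Proof.
move=> pF; apply: measurable_funTS.
have mp : measurable_fun setT (fun x : E => (x, X)) by apply/measurable_fun_pair.
exact: (nnmeas_comp mp (nnmeas_resamp_joint mS pF)).1.
Qed.

Lemma resamp_ge0 x F X : nnmeas F -> (0 <= resamp S x F X)%E.
Proof. by move=> pF; apply: (sadd_ge0 (sadd_resamp x X mS)). Qed.

Lemma nnmeas_int_resamp F : nnmeas F -> nnmeas (fun X => \int[leb]_(x in U) resamp S x F X)%E.
Proof.
move=> pF; split; last first.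
  by move=> X; apply: integral_ge0 => x _; exact: resamp_ge0.
pose K (z : C * E) : \bar R := (eindic R U z.2 * resamp S z.2 F z.1)%E.
have pK : nnmeas K.
  apply: nnmeas_mul; first by apply: (nnmeas_comp (f := snd)) => //; exact: nnmeas_eindic.
  apply: (@nnmeas_comp _ _ _ _ _ (fun z : C * E => (z.2, z.1)) _ _ (nnmeas_resamp_joint mS pF)).
  by apply/measurable_fun_pair.
rewrite (_ : (fun _ => _) = fubini_F leb K).
  by apply: measurable_fun_fubini_tonelli_F; [exact: pK.1|exact: pK.2].
by apply/funext => X; rewrite (integral_eindic U).
Qed.

Lemma nnmeas_heat F : nnmeas F -> nnmeas (heat F).
Proof. by move=> pF; apply: nnmeas_scale => //; exact: nnmeas_int_resamp. Qed.

Lemma sadd_heat X : sadd (fun F => heat F X).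
Proof.
have sR x := sadd_resamp x X mS.
suff : sadd (fun F => \int[leb]_(x in U) resamp S x F X * ((fine (leb U))^-1)%:E)%E.
  by rewrite (_ : (fun _ => _) = (fun F => heat F X))//; apply/funext => F; rewrite /heat muleC.
apply: sadd_scaler => //; split.
- by move=> F pF; apply: integral_ge0 => x _; exact: resamp_ge0.
- move=> c F c0 pF; rewrite -ge0_integralZl_EFin//.
  + by apply: eq_integral => x _; rewrite (saddZ (sR x)).
  + by move=> x _; exact: resamp_ge0.
  + exact: measurable_resamp.
- move=> Fn pF; rewrite -integral_nneseries//.
  + by apply: eq_integral => x _; rewrite (sadd_series (sR x)).
  + by move=> n; exact: measurable_resamp.
  + by move=> n x _; exact: resamp_ge0.
Qed.

(** Values off the hard-core set are invisible to [heat]. This allows [heat1], which is available at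
    hard-core configurations only, to be iterated. *)
Lemma heat_ext F F' : (forall Y, H Y -> F Y = F' Y) -> heat F = heat F'.
Proof.
move=> FF'; apply/funext => X; congr (_ * _)%E; apply: eq_integral => x _.
by rewrite (resamp_ext _ _ FF').
Qed.

Lemma heat1 X : H X -> heat (fun=> 1%E) X = 1%E.
Proof.
move=> HX; rewrite /heat.
under eq_integral do rewrite resamp1//.
rewrite integral_cst// mul1e -[X in (_ * X)%E]fineK ?ge0_fin_numE// -EFinM mulVf//.
by rewrite gt_eqF// fine_gt0// U0.
Qed.

Lemma nnmeas_iter_heat t F : nnmeas F -> nnmeas (iter t heat F).
Proof. by move=> pF; elim: t => //= t IH; exact: nnmeas_heat. Qed.

Lemma sadd_iter_heat t X : sadd (fun F => iter t heat F X).
Proof.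
elim: t X => [|t IH] X /=; first by split=> //; move=> F [].
have sA := sadd_heat X; split.
- by move=> F pF; apply: (sadd_ge0 sA); exact: nnmeas_iter_heat.
- move=> c F c0 pF; rewrite -(saddZ sA c0); last exact: nnmeas_iter_heat.
  by congr (heat _ X); apply/funext => Y; rewrite (saddZ (IH Y)).
- move=> Fn pF; rewrite -(sadd_series sA); last by move=> k; exact: nnmeas_iter_heat.
  by congr (heat _ X); apply/funext => Y; rewrite (sadd_series (IH Y)).
Qed.

Lemma iter_heat1 t X : H X -> iter t heat (fun=> 1%E) X = 1%E.
Proof.
elim: t X => //= t IH X HX; rewrite -[RHS](heat1 HX).
by rewrite (heat_ext IH).
Qed.

Lemma iter_heat_le1 t X F : H X -> nnmeas F -> (forall Y, F Y <= 1)%E -> (iter t heat F X <= 1)%E.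
Proof.
move=> HX pF F1; rewrite -(iter_heat1 t HX); apply: (sadd_le (sadd_iter_heat t X)) => //.
by move=> Y; rewrite ge0_fin_numE ?(le_lt_trans (F1 Y)) ?ltry//; exact: pF.2.
Qed.

(* Superposition splits the process into its parts outside and inside the updated ball,
   and resampling ignores the latter. *)
Lemma cond_pois_resamp x F : nnmeas F -> (forall Y, F Y <= 1)%E ->
  cond_pois S (resamp S x F) fset0 = cond_pois S F fset0.
Proof.
move=> pF F1; congr (_ * _)%E.
set B := eball L x; have mB : measurable B := @measurable_eball R d L x.
have mSB : measurable (S `&` B) by exact: measurableI.
have mSD : measurable (S `\` B) by exact: measurableD.
have dj : [disjoint S `\` B & S `&` B].
  by apply/disj_setPS => y [[_ nBy] [_ By]].
have pR : nnmeas (resamp S x F).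
  have mp : measurable_fun setT (fun X : C => (x, X)) by apply/measurable_fun_pair.
  exact: (nnmeas_comp mp (nnmeas_resamp_joint mS pF)).
have pHR := nnmeas_hc r pR; have pHF := nnmeas_hc r pF.
have SE : S = (S `\` B) `|` (S `&` B) by apply/seteqP; split => y;
    [have [By|By] := pselect (B y); [right|left]|move=> [[]|[]]].
have PU G : nnmeas G -> pois S G fset0 = pois (S `\` B) (pois (S `&` B) G) fset0.
  by move=> pG; rewrite -(pois_setU lam_ge0 mSD mSB dj fset0 pG) -SE.
rewrite (PU _ pHR) (PU _ pHF).
(* It suffices to compare the inner expectations for a fixed part [X] outside the ball. *)
apply: (pois_eq lam_ge0 (I := fun X => [set` X] `<=` S `\` B)) => //.
- exact: nnmeas_pois.
- exact: nnmeas_pois.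
- by move=> p X Sp XS y /= /fset1UP[->//|]; exact: XS.
move=> X XS.
have XB : fset_restr X (~` B) = X.
  apply/fsetP => y; apply/fset_restrP/idP => [[]//|yX]; split => //.
  by have [] := XS _ yX.
set c := cond_pois (S `&` B) F X.
have c0 : (0 <= c)%E by apply: (sadd_ge0 (sadd_cond_pois X mSB)).
have fZ : partition_function (S `&` B) X \is a fin_num.
  by apply: partition_function_fin => //; exact: leb_setI_eball.
have pZ : (pois (S `&` B) (hc F) X <= partition_function
  (S `&` B) X)%E by exact: pois_hc_le_partition.
have p0 : (0 <= pois (S `&` B) (hc F) X)%E by exact: pois_ge0.
have fP : pois (S `&` B) (hc F) X \is a fin_num.
  by rewrite ge0_fin_numE// (le_lt_trans pZ)// -ge0_fin_numE// partition_function_ge0.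
have cfin : c \is a fin_num by rewrite /c /cond_pois fin_numM.
(* [resamp] reads only the part outside the ball, so it equals the constant [c] at every [Y] whose
   outer part is [X]. *)
rewrite (pois_eq lam_ge0 (I := fun Y => fset_restr Y (~` B) = X)
    (F' := fun Y => ((fine c)%:E * hc (fun=> 1) Y)%E))//.
- rewrite (saddZ (sadd_pois lam_ge0 X mSB)) ?fine_ge0//; last first.
    by apply: nnmeas_hc; exact: nnmeas1.
  rewrite -/(partition_function _ X) fineK// /c /cond_pois.
  (* [X] is not assumed hard core, so the normalisation can vanish; both sides are then zero. *)
  have [Z0|Z0] := eqVneq (fine (partition_function (S `&` B) X)) 0.
    have ZE : partition_function (S `&` B) X = 0%E by rewrite -[LHS]fineK// Z0.
    rewrite ZE mule0; apply/esym/eqP; rewrite eq_le p0 andbT.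
    by rewrite ZE in pZ.
  by rewrite -muleA -[X in (_ * (_ * X))%E]fineK// -EFinM mulVf// mule1.
- by apply: nnmeas_scale; [rewrite fine_ge0|apply: nnmeas_hc; exact: nnmeas1].
- move=> p Y [_ Bp] YX; rewrite -YX; apply/fsetP => y; apply/fset_restrP/fset_restrP.
    by move=> [/fset1UP[->//|yY] nBy].
  by move=> [yY nBy]; split => //; apply/fset1UP; right.
- move=> Y YX; have [HY|HY] := pselect (H Y); last by rewrite !hcF// mule0.
  by rewrite !hcT// mule1 fineK// /resamp YX.
Qed.

(** Invariance under each single resampling is averaged over the center. [cond_pois] is first
    represented by a probability [P], so that Tonelli exchanges it with the integral over
    centers. *)
Lemma cond_pois_heat F : nnmeas F -> (forall Y, F Y <= 1)%E ->
  cond_pois S (heat F) fset0 = cond_pois S F fset0.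
Proof.
move=> pF F1.
have sC := sadd_cond_pois fset0 mS.
have H0 : H fset0 by move=> x y; rewrite inE.
have [P PE] := sadd_probability sC (cond_pois1 mS Soo H0).
rewrite -[LHS](sadd_integral sC PE (nnmeas_heat pF)).
have pr := nnmeas_resamp_joint mS pF.
have pK : nnmeas (fun z : C * E => (eindic R U z.2 * resamp S z.2 F z.1)%E).
  apply: nnmeas_mul; first by apply: (nnmeas_comp (f := snd)) => //; exact: nnmeas_eindic.
  apply: (@nnmeas_comp _ _ _ _ _ (fun z : C * E => (z.2, z.1)) _ _ pr).
  by apply/measurable_fun_pair.
have pX x : nnmeas (resamp S x F).
  have mp : measurable_fun setT (fun X : C => (x, X)) by apply/measurable_fun_pair.
  exact: (nnmeas_comp mp pr).
have FT := @fubini_tonelli _ _ _ _ _ P leb _ pK.1 pK.2.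
rewrite /heat ge0_integralZl_EFin//; last 2 first.
- by move=> X _; apply: integral_ge0 => x _; exact: resamp_ge0.
- exact: (nnmeas_int_resamp pF).1.
transitivity (((fine (leb U))^-1)%:E * \int[leb]_(x in U) cond_pois S F fset0)%E.
  congr (_ * _)%E.
  transitivity (\int[P]_X fubini_F leb (fun z : C * E =>
    (eindic R U z.2 * resamp S z.2 F z.1)%E) X)%E.
    by apply: eq_integral => X _; rewrite (integral_eindic U).
  rewrite FT (integral_eindic U); apply: eq_integral => x _.
  rewrite /fubini_G /= -(cond_pois_resamp x pF F1) -(sadd_integral sC PE (pX x)).
  rewrite ge0_integralZl_EFin//; last exact: (pX x).1.
  by move=> X _; exact: (pX x).2.
rewrite integral_cst// muleCA -[X in (_ * (_ * X))%E]fineK ?ge0_fin_numE// -EFinM mulVf ?mule1//.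
by rewrite gt_eqF// fine_gt0// U0.
Qed.

End update.
End heat_bath.

(** * The stationary chain and the chain started from the empty configuration *)

Section laws.
Context (R : realType) (d : nat).
Local Notation E := 'rV[R]_d.
Local Notation C := {fset 'rV[R]_d}.
Local Notation leb := (@lebesgue_row R d).
Variables (r lam L : R).
Hypothesis lam_ge0 : 0 <= lam.
Local Notation H := (@hard_core R d r).
Local Notation cond_pois := (cond_pois r lam).

Lemma hard_core0 : H fset0.
Proof. by move=> x y; rewrite inE. Qed.

Lemma measurable_configs_in (S : set E) : measurable S -> measurable (configs_in r S).
Proof.
move=> mS.
rewrite (_ : configs_in r S = H `&` [set X | #|` fset_restr X (~` S)| = 0%N]).
  apply: measurableI; first exact: measurable_hard_core.
  by apply: measurable_count; exact: measurableC.
apply/funext => X; apply/propext; split => /= -[HX XS]; split => //.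
  apply/eqP; rewrite cardfs_eq0; apply/eqP/fsetP => x; rewrite inE.
  by apply/negbTE/negP => /fset_restrP[xX]; apply; exact: XS.
move=> x xX; apply: contrapT => nSx; move/cardfs0_eq: XS => X0.
suff : x \in fset_restr X (~` S) by rewrite X0 inE.
exact/fset_restrP.
Qed.

Section region.
Variables (Lam tau : set E).
Let S := inner_set r Lam `\` tau.
Let U := thickening L (inner_set r Lam).
Hypotheses (mS : measurable S) (Soo : (leb S < +oo)%E).
Hypotheses (mU : measurable U) (U0 : (0 < leb U)%E) (Uoo : (leb U < +oo)%E).
Local Notation heat := (heat r lam L S U).

Lemma hard_sphereE A : hard_sphere r lam Lam tau A = cond_pois S (eindic R A) fset0.
Proof.
by apply: (@cond_law_poisson _ _ _ _ _ _ _ id) => //; apply/funext => Y; rewrite fset0U.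
Qed.

Lemma heat_bath_kernelE X A : heat_bath_kernel r lam L Lam tau X A = heat (eindic R A) X.
Proof.
congr (_ * _)%E; apply: eq_integral => x _.
apply: cond_law_poisson => //; first exact: measurable_setI_eball.
exact: leb_setI_eball.
Qed.

Lemma stationary_laws : exists nu : nat -> probability C R,
  heat_bath_laws r lam L Lam tau nu /\
  forall t A, measurable A -> nu t A = cond_pois S (eindic R A) fset0.
Proof.
have sC := sadd_cond_pois r lam_ge0 fset0 mS.
have C1 := cond_pois1 lam_ge0 mS Soo hard_core0.
have [P PE] := sadd_probability sC C1.
exists (fun=> P); split; last by move=> t; exact: PE.
split.
  have mc := measurable_configs_in mS.
  rewrite PE// -[RHS]C1; congr (_ * _)%E.
  apply: (pois_eq lam_ge0 (I := fun X => [set` X] `<=` S)) => //.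
  - exact/nnmeas_hc/nnmeas_eindic.
  - by apply: nnmeas_hc; exact: nnmeas1.
  - by move=> p X Sp XS y /= /fset1UP[->//|]; exact: XS.
  move=> X XS; have [HX|HX] := pselect (H X); last by rewrite !hcF.
  by rewrite !hcT// eindic_in.
move=> t A mA; rewrite PE//.
have eA1 Y : (eindic R A Y <= 1)%E by rewrite lee_fin indicE lern1; case: (_ \in _).
have pA := nnmeas_eindic R mA.
rewrite -(cond_pois_heat r L lam_ge0 mS Soo mU U0 Uoo pA eA1).
rewrite -(sadd_integral sC PE (nnmeas_heat r L lam_ge0 mS mU pA)).
by apply: eq_integral => X _; rewrite heat_bath_kernelE.
Qed.

Lemma empty_start_laws : exists nu : nat -> probability C R,
  heat_bath_laws r lam L Lam tau nu /\
  forall t A, measurable A -> nu t A = iter t heat (eindic R A) fset0.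
Proof.
have sI t := sadd_iter_heat r L lam_ge0 mS mU t fset0.
have I1 t := iter_heat1 L lam_ge0 mS Soo mU U0 Uoo t hard_core0.
have [nu nuE] := choice (fun t => sadd_probability (sI t) (I1 t)).
exists nu; split => //; split.
  rewrite nuE/=; last exact: measurable_configs_in.
  by rewrite eindic_in//; split => //; exact: hard_core0.
(* Operators act on observables, so the last update of the chain is the first one applied to the
   indicator. *)
move=> t A mA; rewrite nuE// iterSr.
have pA := nnmeas_eindic R mA.
rewrite -(sadd_integral (sI t) (nuE t) (nnmeas_heat r L lam_ge0 mS mU pA)).
by apply: eq_integral => X _; rewrite heat_bath_kernelE.
Qed.

Lemma mixing_cond_pois b c :
  (forall s : R, 0 < s -> forall mu nu, heat_bath_laws r lam L Lam tau mu ->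
     heat_bath_laws r lam L Lam tau nu -> let n := fine (leb Lam) in
    (tv_dist (mu (Num.truncn (s * n))) (nu (Num.truncn (s * n))) <=
     (b * n * expR (- (c * s)))%:E)%E) ->
  forall s A, 0 < s -> measurable A ->
  (`|cond_pois S (eindic R A) fset0 -
     iter (Num.truncn (s * fine (leb Lam))) heat (eindic R A) fset0| <=
     (b * fine (leb Lam) * expR (- (c * s)))%:E)%E.
Proof.
move=> mix s A s0 mA.
have [mu [lmu muE]] := stationary_laws; have [nu [lnu nuE]] := empty_start_laws.
apply: le_trans (mix s s0 mu nu lmu lnu).
by apply: ereal_sup_ubound; exists A => //; rewrite muE// nuE.
Qed.

End region.
End laws.

(** * Spread of disagreement *)

Section neighbourhood.
Context (R : realType) (d : nat).
Local Notation E := 'rV[R]_d.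
Implicit Types (Z : set E).

Definition nbhd (l : R) Z : set E := [set y | exists2 z, Z z & enorm (y - z) < l].

(** No regularity of [Z] is required: the neighbourhood is the union of the countably many rational
    boxes that it contains. *)
Lemma measurable_nbhd l Z : measurable (nbhd l Z).
Proof.
pose box (u : {ffun 'I_d -> rat} * nat) : set E :=
  \bigcap_(i in [set: 'I_d]) ((@coord_proj R d i) @^-1` [set` `]ratr
    (u.1 i) - u.2.+1%:R^-1, ratr (u.1 i) + u.2.+1%:R^-1[]).
have mbox u : measurable (box u).
  apply: fin_bigcap_measurable; first exact: finite_finset.
  by move=> i _; rewrite -[X in measurable X]setTI; exact: measurable_coord_proj.
pose g (n : nat) : option ({ffun 'I_d -> rat} * nat) := @choice.unpickle _ n.
rewrite (_ : nbhd l Z = \bigcup_n (if g n is Some u then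
    (if pselect (box u `<=` nbhd l Z) then box u else set0) else set0)).
  apply: bigcupT_measurable => n; case: (g n) => // u.
  by case: pselect => ?; [exact: mbox|exact: measurable0].
apply/seteqP; split => [y [z Zz yz]|y [n _]]; last first.
  by case: (g n) => // u; case: pselect => // sub /sub.
(* A box of half-width below [e] around a rational point that contains [y] stays within [2 * e] of
   [y] in each coordinate, hence within [d * (2 * e)] in norm; the margin is [d.+1 * (2 * e)]. *)
pose e := (l - enorm (y - z)) / (2 * d.+1%:R).
have e0 : 0 < e by rewrite divr_gt0 ?subr_gt0// mulr_gt0.
pose k := Num.truncn e^-1.
have ke : k.+1%:R^-1 < e by rewrite invf_plt ?posrE// truncnS_gt.
have q_ex (i : 'I_d) : exists q : rat, ratr q \in `]y ord0 i - k.+1%:R^-1, y ord0 i + k.+1%:R^-1[.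
  apply: rat_in_itvoo; rewrite ltrD2l.
  by rewrite (@lt_trans _ _ 0)// ?oppr_lt0 invr_gt0.
have [q qP] := choice q_ex.
exists (choice.pickle (finfun q, k)) => //; rewrite /g choice.pickleK;
  case: pselect => [_ i _|nsub].
  move: (qP i); rewrite /preimage /= ffunE !in_itv/= /coord_proj.
  move: (ratr (q i)) (k.+1%:R^-1) => a b /andP[h1 h2].
  by apply/andP; split; lra.
case: nsub => w wbox; exists z => //.
rewrite (le_lt_trans (enorm_triangle y _ _))// -ltrBrDr.
have wy i : `|(w - y) ord0 i| < 2 * e.
  have := wbox i Logic.I; move: (qP i); rewrite /preimage /= ffunE !in_itv/= /coord_proj !mxE ltr_norml.
  move: ke; move: (ratr (q i)) (k.+1%:R^-1) => a b ke /andP[h1 h2] /andP[h3 h4].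
  by apply/andP; split; lra.
have e20 : 0 < 2 * e by rewrite mulr_gt0.
rewrite (le_lt_trans (enorm_lt_box wy e20))//.
have <- : d.+1%:R * (2 * e) = l - enorm (y - z).
  have <- : e * (2 * d.+1%:R) = l - enorm (y - z).
    by rewrite divfK// mulf_neq0 ?pnatr_eq0.
  by rewrite mulrCA [RHS]mulrC -mulrA.
by rewrite ltr_pM2r// ltr_nat.
Qed.

End neighbourhood.

(** * Comparison of two chains over one update *)

Section comparison.
Context (R : realType) (d : nat).
Local Notation E := 'rV[R]_d.
Local Notation C := {fset 'rV[R]_d}.
Local Notation leb := (@lebesgue_row R d).
Implicit Types (X Y : C) (S Z : set E) (F G : C -> \bar R).
Variables (r lam L : R).
Hypothesis lam_ge0 : 0 <= lam.
Local Notation pois := (pois lam).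
Local Notation H := (@hard_core R d r).
Local Notation hc := (@hc R d r).
Local Notation partition_function := (partition_function r lam).
Local Notation cond_pois := (cond_pois r lam).

(** As [I] relates hard-core configurations to hard-core ones only, the two normalisations agree and
    it remains to compare numerators. *)
Lemma cond_pois_le_rel S (I : C -> C -> Prop) F F' X X' : measurable S ->
  nnmeas F -> nnmeas F' ->
  (forall p Y Y', S p -> I Y Y' -> I (p |` Y)%fset (p |` Y')%fset) ->
  (forall Y Y', I Y Y' -> H Y <-> H Y') ->
  (forall Y Y', I Y Y' -> H Y -> F Y <= F' Y')%E ->
  I X X' -> (cond_pois S F X <= cond_pois S F' X')%E.
Proof.
move=> mS pF pF' IS IH IF IXX'.
have hcle G G' : nnmeas G -> nnmeas G' -> (forall Y Y', I Y Y' -> H Y -> G Y <= G' Y')%E ->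
    (pois S (hc G) X <= pois S (hc G') X')%E.
  move=> pG pG' GG'; apply: (pois_le lam_ge0 (I := I)) => //; try exact: nnmeas_hc.
  move=> Y Y' IY; have [HY|HY] := pselect (H Y).
    by rewrite !hcT//; [exact: GG'|exact/(IH _ _ IY)].
  by rewrite hcF// hcF// => /(IH _ _ IY).
have p1 := @nnmeas1 R d.
rewrite /cond_pois.
have -> : partition_function S X = partition_function S X' :> \bar R.
  apply/eqP; rewrite eq_le hcle//=.
  apply: (pois_le lam_ge0 (I := fun Y Y' => I Y' Y)) => //; try exact: nnmeas_hc.
    by move=> p Y Y' Sp IY; exact: IS.
  move=> Y Y' IY; have [HY|HY] := pselect (H Y).
    by rewrite !hcT//; exact/(IH _ _ IY).
  by rewrite hcF// hcF// => /(IH _ _ IY).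
rewrite lee_wpmul2r//; last exact: hcle.
by rewrite lee_fin partition_inv_ge0.
Qed.

Lemma cond_pois_le S (I : C -> Prop) F F' X : measurable S ->
  nnmeas F -> nnmeas F' ->
  (forall p Y, S p -> I Y -> I (p |` Y)%fset) ->
  (forall Y, I Y -> H Y -> F Y <= F' Y)%E ->
  I X -> (cond_pois S F X <= cond_pois S F' X)%E.
Proof.
move=> mS pF pF' IS IF IX.
apply: (cond_pois_le_rel (I := fun Y Y' => Y = Y' /\ I Y)) => //.
- by move=> p Y _ Sp [<- IY]; split => //; exact: IS.
- by move=> Y _ [<-].
- by move=> Y _ [<- IY]; exact: IF.
Qed.

Lemma cond_pois_cst S X (a : R) : measurable S -> (leb S < +oo)%E -> H X -> 0 <= a ->
  cond_pois S (fun=> a%:E) X = a%:E.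
Proof.
move=> mS Soo HX a0; have p1 := @nnmeas1 R d.
rewrite -[RHS]mule1 -(cond_pois1 lam_ge0 mS Soo HX) -(saddZ (sadd_cond_pois r lam_ge0 X mS))//.
by congr (cond_pois S _ X); apply/funext => Y; rewrite mule1.
Qed.

Lemma cond_poisD_cst S F X (a : R) : measurable S -> (leb S < +oo)%E -> H X -> 0 <= a ->
  nnmeas F -> cond_pois S (fun Y => F Y + a%:E)%E X = (cond_pois S F X + a%:E)%E.
Proof.
move=> mS Soo HX a0 pF; rewrite -[in RHS](cond_pois_cst mS Soo HX a0).
by rewrite (saddD (sadd_cond_pois r lam_ge0 X mS))//; exact: nnmeas_cst.
Qed.

Section step.
Variables (S S' Z : set E) (x : E) (g g' : C -> \bar R) (c : R) (X X' : C).
Hypotheses (mS : measurable S) (Soo : (leb S < +oo)%E).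
Hypotheses (mS' : measurable S') (S'oo : (leb S' < +oo)%E).
Hypotheses (pg : nnmeas g) (pg' : nnmeas g') (c0 : 0 <= c).
Hypotheses (HX : H X) (HX' : H X').
Hypothesis XZ : forall y, ~ Z y -> (y \in X) = (y \in X').
Hypothesis SZ : forall y, ~ Z y -> S y <-> S' y.

(* No disagreement is within [rho] of [x], so both updates draw the new centers from the
   same law and the disagreement set does not grow. *)
Lemma resamp_le_far rho : L + 2 * r <= rho -> ~ nbhd rho Z x ->
  0 <= r ->
  (forall Y Y', H Y -> H Y' -> (forall y, ~ Z y -> (y \in Y) = (y \in Y')) ->
     g Y <= g' Y' + c%:E)%E ->
  (resamp r lam L S x g X <= resamp r lam L S' x g' X' + c%:E)%E.
Proof.
move=> Lr xZ r0 gg'.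
have far y : enorm (y - x) < rho -> ~ Z y.
  by move=> yx Zy; apply: xZ; exists y => //; rewrite enormB.
set B := eball L x.
have BZ y : B y -> ~ Z y.
  by rewrite /B /eball /= => yx; apply: far; lra.
have SB : S `&` B = S' `&` B.
  by apply/funext => y; apply/propext; split => -[Sy By]; split => //; apply/(SZ (BZ _ By)).
rewrite /resamp -/B SB.
have mT : measurable (S' `&` B) by exact: measurable_setI_eball.
have Too : (leb (S' `&` B) < +oo)%E by exact: leb_setI_eball.
rewrite -cond_poisD_cst//; last exact: hard_core_restr.
(* The coupled outcomes agree inside the ball and keep their respective old centers outside. *)
pose J (X0 X0' Y Y' : C) := forall y, [/\ B y -> (y \in Y) = (y \in Y'),
   ~ B y -> (y \in Y) = (y \in X0) & ~ B y -> (y \in Y') = (y \in X0')].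
have JH X0 X0' Y Y' : H X0' -> (forall y, ~ Z y -> (y \in X0) = (y \in X0')) ->
    J X0 X0' Y Y' -> H Y -> H Y'.
  move=> HX0' X0Z JY HY u v uY vY uv.
  (* Here [w] is a new center and [z] an old one. If [z] is not in [Z], it also belongs to [Y]; if
     it is, it lies at distance at least [L + 2 * r] from [x], so more than [2 * r] from [w]. *)
  have case_out w z : w \in Y' -> z \in Y' -> w != z -> B w -> ~ B z -> 2 * r <= enorm (w - z).
    move=> wY zY wz Bw Bz; have [J1 _ _] := JY w; have [_ J2 J3] := JY z.
    have zX0' : z \in X0' by rewrite -J3.
    have [Zz|Zz] := pselect (Z z); last first.
      by apply: HY => //; [rewrite J1|rewrite J2// X0Z].
    have : rho <= enorm (z - x) by rewrite leNgt; apply/negP => /far.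
    have := enorm_triangle w z x; move: Bw; rewrite /B /eball /= [enorm (z - w)]enormB.
    lra.
  have [J1u J2u J3u] := JY u; have [J1v J2v J3v] := JY v.
  have [Bu|Bu] := pselect (B u); have [Bv|Bv] := pselect (B v).
  - by apply: HY => //; [rewrite J1u|rewrite J1v].
  - exact: case_out.
  - by rewrite enormB; apply: case_out => //; rewrite eq_sym.
  - by apply: HX0' => //; [rewrite -J3u|rewrite -J3v].
have Jsym X0 X0' Y Y' : J X0 X0' Y Y' -> J X0' X0 Y' Y.
  by move=> JY y; have [J1 J2 J3] := JY y; split => // By; rewrite J1.
apply: (cond_pois_le_rel (I := J X X')) => //.
- split; last by move=> Y; rewrite adde_ge0// pg'.2.
  by apply: emeasurable_funD => //; exact: pg'.1.
- move=> p Y Y' [_ Bp] JY y; have [J1 J2 J3] := JY y; split => By; rewrite !in_fset1U.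
  + by rewrite J1.
  + by rewrite J2//; case: eqP => // yp; rewrite yp in By.
  + by rewrite J3//; case: eqP => // yp; rewrite yp in By.
- move=> Y Y' JY; split; first exact: (JH _ _ _ _ HX' XZ JY).
  by apply: (JH _ _ _ _ HX _ (Jsym _ _ _ _ JY)) => y Zy; rewrite XZ.
- move=> Y Y' JY HY; apply: gg' => //; first exact: (JH _ _ _ _ HX' XZ JY).
  move=> y Zy; have [J1 J2 J3] := JY y.
  by have [By|By] := pselect (B y); [exact: J1|rewrite J2// J3// XZ].
- have rB (W : C) y : ~ B y -> (y \in fset_restr W (~` B)) = (y \in W).
    by move=> By; apply/fset_restrP/idP => [[]|].
  move=> y; split => By; [|exact: rB|exact: rB].
  by apply/fset_restrP/fset_restrP => -[_]; move/(_ By).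
Qed.

(* The new centers may differ, but only inside the updated ball. *)
Lemma resamp_le_near :
  (forall Y, H Y -> g Y <= 1)%E ->
  (forall Y, H Y -> g' Y <= 1)%E ->
  (forall Y Y', H Y -> H Y' ->
     (forall y, ~ (Z `|` eball L x) y -> (y \in Y) = (y \in Y')) ->
     g Y <= g' Y' + c%:E)%E ->
  (resamp r lam L S x g X <= resamp r lam L S' x g' X' + c%:E)%E.
Proof.
move=> g1 g'1 gg'; rewrite /resamp; set B := eball L x.
have mT : measurable (S `&` B) by exact: measurable_setI_eball.
have Too : (leb (S `&` B) < +oo)%E by exact: leb_setI_eball.
have mT' : measurable (S' `&` B) by exact: measurable_setI_eball.
have T'oo : (leb (S' `&` B) < +oo)%E by exact: leb_setI_eball.
have HR : H (fset_restr X (~` B)) by exact: hard_core_restr.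
have HR' : H (fset_restr X' (~` B)) by exact: hard_core_restr.
pose J (X0 Y : C) := forall y, ~ B y -> (y \in Y) = (y \in X0).
have JS (T : set E) X0 p Y : (T `&` B) p -> J X0 Y -> J X0 (p |` Y)%fset.
  move=> [_ Bp] JY y By; rewrite in_fset1U JY//.
  by case: eqP => // yp; rewrite yp in By.
have JR X0 : J X0 (fset_restr X0 (~` B)).
  by move=> y By; apply/fset_restrP/idP => [[]|].
(* The two new samples are treated as independent: [g Y <= g' Y' + c] is averaged over [Y] for fixed
   [Y'], and the result over [Y']. *)
set a := cond_pois _ g _.
have a0 : (0 <= a)%E by exact: (sadd_ge0 (sadd_cond_pois r lam_ge0 _ mT)).
have afin : a \is a fin_num.
  rewrite ge0_fin_numE// (@le_lt_trans _ _ 1%E) ?ltry//.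
  rewrite -(cond_pois1 lam_ge0 mT Too HR); apply: (cond_pois_le (I := J X)) => //.
    by move=> p Y Sp; exact: JS Sp.
  by move=> Y _; exact: g1.
rewrite -cond_poisD_cst// -[a]fineK//.
rewrite -(cond_pois_cst mT' T'oo HR' (fine_ge0 a0)).
apply: (cond_pois_le (I := J X')) => //.
- by apply: nnmeas_cst; rewrite fine_ge0.
- split; last by move=> Y; rewrite adde_ge0// pg'.2.
  by apply: emeasurable_funD => //; exact: pg'.1.
- by move=> p Y Sp; exact: JS Sp.
move=> Y' JY' HY'; rewrite fineK//.
have fg' : g' Y' \is a fin_num.
  by rewrite ge0_fin_numE ?pg'.2// (le_lt_trans (g'1 _ HY')) ?ltry.
have ga0 : 0 <= fine (g' Y') + c by rewrite addr_ge0// fine_ge0// pg'.2.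
rewrite -[g' Y']fineK// -EFinD -(cond_pois_cst mT Too HR ga0).
apply: (cond_pois_le (I := J X)) => //.
- by move=> p Y Sp; exact: JS Sp.
move=> Y JY HY; rewrite EFinD fineK//; apply: gg' => // y.
move=> /not_orP[Zy By]; rewrite JY// JY'//; exact: XZ.
Qed.

End step.
End comparison.

(** * Growth of the disagreement over many updates *)

Section iterated_comparison.
Context (R : realType) (d : nat).
Local Notation E := 'rV[R]_d.
Local Notation C := {fset 'rV[R]_d}.
Local Notation leb := (@lebesgue_row R d).
Implicit Types (X Y : C) (S Z : set E) (F G : C -> \bar R).
Variables (r lam L rho K0 c0 : R) (psi : E -> \bar R).
Hypotheses (lam_ge0 : 0 <= lam) (r0 : 0 <= r) (Lrho : L + 2 * r <= rho).
Hypotheses (K00 : 0 <= K0) (c00 : 0 < c0) (ppsi : nnmeas psi).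
Hypothesis fpsi : forall x, psi x \is a fin_num.
Local Notation H := (@hard_core R d r).

(** The neighbourhood of radius [rho] consists of the centers whose update can enlarge the
    disagreement, so integrating the weight there measures what one step may add. *)
Definition spread Z := (\int[leb]_(y in nbhd rho Z) psi y)%E.

Lemma spread_ge0 Z : (0 <= spread Z)%E.
Proof. by apply: integral_ge0 => y _; exact: ppsi.2. Qed.

Lemma spread_le Z Z' : Z `<=` Z' -> (spread Z <= spread Z')%E.
Proof.
move=> ZZ'; apply: ge0_subset_integral => //; try exact: measurable_nbhd.
- by apply: measurable_funTS; exact: ppsi.1.
- by move=> y _; exact: ppsi.2.
- by move=> y [z Zz yz]; exists z => //; exact: ZZ'.
Qed.

Lemma spreadU Z Z' : (spread (Z `|` Z') <= spread Z + spread Z')%E.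
Proof.
have mn (Y : set E) := measurable_nbhd rho Y.
have pe (Y : set E) : nnmeas (fun y => eindic R (nbhd rho Y) y * psi y)%E.
  by apply: nnmeas_mul => //; exact: nnmeas_eindic.
rewrite /spread !(integral_eindic (nbhd _ _)) -ge0_integralD//; last 4 first.
- by move=> y _; exact: (pe Z).2.
- exact: (pe Z).1.
- by move=> y _; exact: (pe Z').2.
- exact: (pe Z').1.
apply: ge0_le_integral => //.
- by move=> y _; exact: (pe (Z `|` Z')).2.
- exact: (pe (Z `|` Z')).1.
- by apply: emeasurable_funD; [exact: (pe Z).1|exact: (pe Z').1].
move=> y _; have [[z [Zz|Zz] yz]|ny] := pselect (nbhd rho (Z `|` Z') y).
- have n1 : nbhd rho (Z `|` Z') y by exists z => //; left.
  have n2 : nbhd rho Z y by exists z.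
  by rewrite (eindic_in _ n1) (eindic_in _ n2) leeDl//; exact: (pe Z').2.
- have n1 : nbhd rho (Z `|` Z') y by exists z => //; right.
  have n2 : nbhd rho Z' y by exists z.
  by rewrite (eindic_in _ n1) (eindic_in _ n2) leeDr//; exact: (pe Z).2.
- by rewrite eindic_notin// mul0e adde_ge0//; [exact: (pe Z).2|exact: (pe Z').2].
Qed.

Variable A : set E.
Hypothesis spread_target : forall a, A a -> (c0%:E <= spread [set a])%E.
Hypothesis spread_ball : forall x, (spread (eball L x) <= K0%:E * psi x)%E.

Variable E0 : set C.
Hypothesis mE0 : measurable E0.
Hypothesis E0_local : forall Y Y', (forall y, A y -> (y \in Y) = (y \in Y')) -> E0 Y -> E0 Y'.

Variables (S S' U : set E).
Hypotheses (mS : measurable S) (Soo : (leb S < +oo)%E).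
Hypotheses (mS' : measurable S') (S'oo : (leb S' < +oo)%E).
Hypotheses (mU : measurable U) (U0 : (0 < leb U)%E) (Uoo : (leb U < +oo)%E).

Local Notation rate := (1 + K0 / fine (leb U)).

(* [Z] contains all disagreements, of the configurations and of the allowed regions. *)
Lemma iter_heat_compare t Z X X' : H X -> H X' ->
  (forall y, ~ Z y -> (y \in X) = (y \in X')) ->
  (forall y, ~ Z y -> S y <-> S' y) ->
  (iter t (heat r lam L S U) (eindic R E0) X <=
   iter t (heat r lam L S' U) (eindic R E0) X' + (rate ^+ t / c0)%:E * spread Z)%E.
Proof.
have u0 : 0 < fine (leb U) by rewrite fine_gt0// U0.
have rate0 : 0 < rate by rewrite ltr_pwDl// divr_ge0// ltW.
have pE := nnmeas_eindic R mE0.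
have eE1 Y : (eindic R E0 Y <= 1)%E by rewrite lee_fin indicE lern1; case: (_ \in _).
elim: t Z X X' => [|t IH] Z X X' HX HX' XZ SZ.
  rewrite /= expr0 mul1r.
  have s0 : (0 <= (c0^-1)%:E * spread Z)%E by rewrite mule_ge0 ?spread_ge0// lee_fin invr_ge0 ltW.
  have [EX'|EX'] := pselect (E0 X').
    by rewrite (eindic_in _ EX') (le_trans (eE1 X))// leeDl.
  have [EX|EX] := pselect (E0 X); last by rewrite eindic_notin// adde_ge0// (pE.2 X').
  (* When [E0] separates [X] from [X'], the set [Z] meets [A], and the error term is at least
     [1]. *)
  have [a Aa Za] : exists2 a, A a & Z a.
    apply: contrapT => nAZ; apply: EX'; apply: E0_local EX => y Ay; apply: XZ => Zy.
    by apply: nAZ; exists y.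
  rewrite eindic_in// eindic_notin// add0e.
  rewrite -(@mulVf _ c0) ?gt_eqF// EFinM lee_wpmul2l ?lee_fin ?invr_ge0 ?(ltW c00)//.
  by apply: (le_trans (spread_target Aa)); apply: spread_le => y /= ->.
set g := iter t (heat r lam L S U) (eindic R E0).
set g' := iter t (heat r lam L S' U) (eindic R E0).
have pg : nnmeas g by exact: nnmeas_iter_heat.
have pg' : nnmeas g' by exact: nnmeas_iter_heat.
(* An infinite spread makes the bound trivial. *)
have [Zoo|Zoo] := eqVneq (spread Z) +oo%E.
  rewrite Zoo gt0_muley; last by rewrite lte_fin divr_gt0// exprn_gt0.
  by rewrite addey ?leey// gt_eqF// (lt_le_trans ltNy0)//;
    exact: (nnmeas_iter_heat r L lam_ge0 mS' mU t.+1 pE).2.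
have fZ : spread Z \is a fin_num by rewrite ge0_fin_numE ?spread_ge0// ltey.
set q := rate ^+ t / c0.
have q0 : 0 <= q by rewrite divr_ge0// ?exprn_ge0// ltW.
pose w := fine (spread Z); have w0 : 0 <= w by rewrite fine_ge0// spread_ge0.
have sE : spread Z = w%:E by rewrite /w fineK.
have IHc Z1 X1 X1' (c : R) : (q%:E * spread Z1 <= c%:E)%E -> H X1 -> H X1' ->
    (forall y, ~ Z1 y -> (y \in X1) = (y \in X1')) -> (forall y, ~ Z1 y -> S y <-> S' y) ->
    (g X1 <= g' X1' + c%:E)%E.
  by move=> qc HX1 HX1' XZ1 SZ1; apply: (le_trans (IH Z1 X1 X1' HX1 HX1' XZ1 SZ1));
    rewrite leeD2l.
(* [q * w] is the error for the old set [Z]. The second term is paid only by centers near [Z], where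
   the updated ball joins the set at the price [K0 * psi x]. *)
have point x : (resamp r lam L S x g X <= resamp r lam L S' x g' X' +
    ((q * w)%:E + (q * K0)%:E * (eindic R (nbhd rho Z) x * psi x)))%E.
  have [xZ|xZ] := pselect (nbhd rho Z x); last first.
    rewrite (eindic_notin _ xZ) mul0e mule0 adde0.
    apply: (resamp_le_far lam_ge0 mS' S'oo pg pg' _ HX HX' XZ SZ Lrho xZ r0) => //.
      by rewrite mulr_ge0.
    by move=> Y Y' HY HY' YZ; apply: (IHc Z) => //; rewrite [X in (_ <= X)%E]EFinM /w fineK.
  rewrite (eindic_in _ xZ) mul1e.
  have fp := fpsi x.
  pose p := fine (psi x); have p0 : 0 <= p by rewrite fine_ge0// ppsi.2.
  have pxE : psi x = p%:E by rewrite /p fineK.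
  rewrite pxE -EFinM -EFinD.
  apply: (resamp_le_near lam_ge0 mS Soo mS' S'oo pg pg' _ HX HX' XZ) => //.
  - by rewrite addr_ge0// mulr_ge0// mulr_ge0.
  - by move=> Y HY; exact: iter_heat_le1.
  - by move=> Y HY; exact: iter_heat_le1.
  move=> Y Y' HY HY' YZ; apply: (IHc (Z `|` eball L x)) => //.
    apply: (@le_trans _ _ (q%:E * (spread Z + K0%:E * psi x)))%E.
      rewrite lee_wpmul2l ?lee_fin//; apply: (le_trans (spreadU _ _)); rewrite leeD2l//.
    by rewrite sE pxE -[(K0%:E * p%:E)%E]EFinM -EFinD -EFinM lee_fin mulrDr mulrA.
  by move=> y /not_orP[Zy _]; exact: SZ.
have mpsi : nnmeas (fun x => eindic R (nbhd rho Z) x * psi x)%E.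
  by apply: nnmeas_mul => //; apply: nnmeas_eindic; exact: measurable_nbhd.
have pR' x : (0 <= resamp r lam L S' x g' X')%E by exact: resamp_ge0.
have pe : nnmeas (fun x => ((q * w)%:E + (q * K0)%:E * (eindic R (nbhd rho Z) x * psi x))%E).
  apply: nnmeas_add; first by apply: nnmeas_cst; rewrite mulr_ge0.
  by apply: nnmeas_scale => //; rewrite mulr_ge0.
have uI : 0 <= (fine (leb U))^-1 by rewrite invr_ge0 ltW.
change (((fine (leb U))^-1)%:E * \int[leb]_(x in U) resamp r lam L S x g X <=
  ((fine (leb U))^-1)%:E * \int[leb]_(x in U) resamp r lam L S' x g' X' +
  (rate ^+ t.+1 / c0)%:E * spread Z)%E.
apply: (@le_trans _ _ (((fine (leb U))^-1)%:E * \int[leb]_(x in U) (resamp r lam L S' x g' X' +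
    ((q * w)%:E + (q * K0)%:E * (eindic R (nbhd rho Z) x * psi x)))))%E.
  rewrite lee_wpmul2l ?lee_fin//; apply: ge0_le_integral => //.
  - by move=> x _; exact: resamp_ge0.
  - exact: measurable_resamp.
  - apply: emeasurable_funD; first exact: measurable_resamp.
    by apply: measurable_funTS; exact: pe.1.
rewrite ge0_integralD//; last 3 first.
- exact: measurable_resamp.
- by move=> x _; exact: pe.2.
- by apply: measurable_funTS; exact: pe.1.
rewrite ge0_muleDr; last 2 first.
- by apply: integral_ge0 => x _.
- by apply: integral_ge0 => x _; exact: pe.2.
rewrite leeD2l// ge0_integralD//; last 3 first.
- by move=> x _; rewrite lee_fin mulr_ge0.
- by move=> x _; rewrite mule_ge0 ?mpsi.2// lee_fin mulr_ge0.
- by apply: measurable_funTS; apply: measurable_funeM; exact: mpsi.1.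
rewrite integral_cst// ge0_integralZl_EFin//; last 3 first.
- by move=> x _; exact: mpsi.2.
- by apply: measurable_funTS; exact: mpsi.1.
- by rewrite mulr_ge0.
(* Integrated over [U], the price is at most a multiple of [spread Z] itself, whence one more factor
   [1 + K0 / |U|]. *)
have IUle : (\int[leb]_(x in U) (eindic R (nbhd rho Z) x * psi x) <= spread Z)%E.
  rewrite /spread (integral_eindic (nbhd _ _)).
  apply: ge0_subset_integral => //; first exact: mpsi.1.
  by move=> y _; exact: mpsi.2.
apply: (@le_trans _ _ (((fine (leb U))^-1)%:E * ((q * w)%:E * leb U + (q * K0)%:E * spread Z)))%E.
  apply: lee_wpmul2l; first by rewrite lee_fin.
  apply: leeD => //; apply: lee_wpmul2l => //.
  by rewrite lee_fin mulr_ge0.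
rewrite sE -[X in (_ * X + _)%E]fineK ?ge0_fin_numE//.
rewrite -[((q * w)%:E * _)%E]EFinM -[((q * K0)%:E * _)%E]EFinM -EFinD -!EFinM lee_fin.
have -> : rate ^+ t.+1 / c0 = q + q * K0 / fine (leb U).
  by rewrite exprSr mulrAC -/q mulrDr mulr1 mulrA.
rewrite mulrDr mulrDl le_eqVlt; apply/orP; left; apply/eqP; congr (_ + _).
  by rewrite mulrC mulfK// gt_eqF.
by rewrite mulrC mulrAC.
Qed.

End iterated_comparison.

(** * Localization *)

Section localization.
Context (R : realType) (d : nat).
Local Notation E := 'rV[R]_d.
Local Notation C := {fset 'rV[R]_d}.
Local Notation leb := (@lebesgue_row R d).
Implicit Types (X Y : C) (F G : C -> \bar R).
Variables (r lam : R).
Hypotheses (lam_ge0 : 0 <= lam).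
Local Notation pois := (pois lam).
Local Notation H := (@hard_core R d r).
Local Notation hc := (@hc R d r).
Local Notation partition_function := (partition_function r lam).
Local Notation cond_pois := (cond_pois r lam).

(** If inserting a single point of [N] annihilates [F], only the term of the series without points
    survives. *)
Lemma pois_vanish (N : set E) F X : measurable N -> nnmeas F ->
  (forall Y p, [set` X] `<=` [set` Y] -> N p -> F (p |` Y)%fset = 0%E) ->
  pois N F X = F X.
Proof.
move=> mN pF F0.
have A0 Y : [set` X] `<=` [set` Y] -> add_point N F Y = 0%E.
  by move=> XY; rewrite /add_point integral0_eq// => p Np; exact: F0.
have it0 n : iter n.+1 (add_point N) F X = 0%E.
  rewrite iterSr; apply/eqP; rewrite eq_le (nnmeas_iter_add_point n mN
    (nnmeas_iter_add_point 1 mN pF)).2 andbT.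
  rewrite -(sadd0 (sadd_iter_add_point n X mN)).
  apply: (iter_add_point_le (I := fun Y Y' => [set` X] `<=` [set` Y])) => //.
  - exact: (nnmeas_iter_add_point 1 mN pF).
  - by move=> p Y _ _ XY y /XY /= yY; rewrite in_fset1U yY orbT.
  - by move=> Y _ /A0 ->.
rewrite /pois (@nneseriesD1 _ _ 0%N)//; last first.
  move=> k _; apply: mule_ge0; first by rewrite lee_fin pois_coef_ge0.
  exact: (nnmeas_iter_add_point k mN pF).2.
rewrite /= pois_coef0 mul1e eseries0 ?adde0// => -[|n] _// _.
by rewrite it0 mule0.
Qed.

Variables (A W : set E) (E0 : set C).
Hypotheses (mW : measurable W) (AW : A `<=` W) (mE0 : measurable E0).
Hypothesis E0_local : forall Y Y', (forall y, A y -> (y \in Y) = (y \in Y')) -> E0 Y -> E0 Y'.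

Section outside.
Variables (S : set E).
Hypotheses (mS : measurable S) (Soo : (leb S < +oo)%E).

(* Given the centers [X] outside [W], those in [W] form a hard sphere model on this
   region. *)
Definition allowed X := (S `&` W) `\` nbhd (2 * r) [set` X].

Lemma measurable_allowed X : measurable (allowed X).
Proof. by apply: measurableD; [exact: measurableI|exact: measurable_nbhd]. Qed.

Lemma leb_allowed X : (leb (allowed X) < +oo)%E.
Proof.
apply: le_lt_trans Soo; apply: le_measure; rewrite ?inE//; first exact: measurable_allowed.
by move=> y [[]].
Qed.

(** Superposition separates [allowed X] from the sites [N] blocked by [X]. A point in [N] violates
    the hard-core condition, so [N] stays empty; points in [allowed X] never conflict with [X],
    which can then be dropped. *)
Let pois_outside (F F' : C -> \bar R) X : nnmeas F -> nnmeas F' -> H X -> [set` X] `<=` ~` W ->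
  (forall Y Y', [set` Y'] `<=` W -> (forall y, (y \in Y) = (y \in X) || (y \in Y')) ->
     F Y = F' Y') ->
  pois (S `&` W) (hc F) X = pois (allowed X) (hc F') fset0.
Proof.
move=> pF pF' HX XW FF'.
have mT := measurable_allowed X.
have mSW : measurable (S `&` W) by exact: measurableI.
pose N := (S `&` W) `&` nbhd (2 * r) [set` X].
have mN : measurable N by apply: measurableI => //; exact: measurable_nbhd.
have SE : S `&` W = allowed X `|` N.
  apply/seteqP; split => y; last by move=> [[]|[]].
  by move=> yS; have [yN|yN] := pselect (nbhd (2 * r) [set` X] y); [right|left].
have dj : [disjoint allowed X & N].
  by apply/disj_setPS => y [[_ ny] [_ yn]].
have pH := nnmeas_hc r pF; have pH' := nnmeas_hc r pF'.
rewrite SE (pois_setU lam_ge0 mT mN dj X pH).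
rewrite (pois_eq lam_ge0 (I := fun Y => [set` X] `<=` [set` Y]) (F' := hc F))//; first last.
- move=> Y XY; apply: pois_vanish => // Y1 p YY1 [[_ Wp] [q Xq pq]].
  rewrite hcF// => /(_ p q); rewrite !in_fset1U eqxx /= (YY1 _ (XY _ Xq)) orbT.
  move=> /(_ isT isT); have [pqE|pq_neq] := eqVneq p q.
    by have := XW q Xq; rewrite -pqE.
  by move=> /(_ isT); rewrite leNgt pq.
- by move=> p Y _ XY y /XY /= yY; rewrite in_fset1U yY orbT.
- exact: nnmeas_pois.
pose J (Y Y' : C) := [set` Y'] `<=` allowed X /\ (forall y, (y \in Y) = (y \in X) || (y \in Y')).
have JH Y Y' : J Y Y' -> H Y <-> H Y'.
  move=> [YT YE]; split => HY u v uY vY uv.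
    by apply: HY => //; rewrite YE ?uY ?vY orbT.
  move: uY vY; rewrite !YE => /orP[uX|uY] /orP[vX|vY].
  - exact: HX.
  - by have [_ nv] := YT _ vY; rewrite leNgt enormB; apply/negP => vu; apply: nv; exists u.
  - by have [_ nu] := YT _ uY; rewrite leNgt; apply/negP => vu; apply: nu; exists v.
  - exact: HY.
have JF Y Y' : J Y Y' -> hc F Y = hc F' Y'.
  move=> JY; have [YT YE] := JY; have [HY|HY] := pselect (H Y).
    rewrite !hcT ?(FF' Y Y')//; last exact/(JH _ _ JY).
    by move=> y /YT [[]].
  by rewrite !hcF// => /(JH _ _ JY).
have Jadd p Y Y' : allowed X p -> J Y Y' -> J (p |` Y)%fset (p |` Y')%fset.
  move=> Tp [YT YE]; split => [y /=|y]; rewrite !in_fset1U.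
    by move=> /orP[/eqP->|/YT].
  by rewrite YE orbCA.
have J0 : J X fset0 by split => [y|y] /=; rewrite inE// orbF.
apply/eqP; rewrite eq_le; apply/andP; split.
  apply: (pois_le lam_ge0 (I := J)) => //.
  by move=> Y Y' /JF ->.
apply: (pois_le lam_ge0 (I := fun Y Y' => J Y' Y)) => //.
- by move=> p Y Y' Tp JY; exact: Jadd.
- by move=> Y Y' /JF ->.
Qed.

Let pE := nnmeas_eindic R mE0.

(** The product form lets a bound on the first factor that is uniform in [X] be integrated over the
    process outside [W]. *)
Lemma pois_outsideE X : H X -> [set` X] `<=` ~` W ->
  pois (S `&` W) (hc (eindic R E0)) X =
  (cond_pois (allowed X) (eindic R E0) fset0 * partition_function (S `&` W) X)%E.
Proof.
move=> HX XW; have p1 := @nnmeas1 R d; have mT := measurable_allowed X.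
rewrite /partition_function (pois_outside p1 p1)//.
rewrite (pois_outside (F' := eindic R E0))//; last first.
  move=> Y Y' YW YE; have loc y : A y -> (y \in Y) = (y \in Y').
    by move=> Ay; rewrite YE; case: (boolP (y \in X)) => //= /XW /(_ (AW Ay)).
  have [EY|EY] := pselect (E0 Y); first by rewrite !eindic_in//; exact: E0_local EY.
  rewrite !eindic_notin// => EY'; apply: EY; apply: E0_local EY' => y Ay.
  by rewrite loc.
rewrite /cond_pois -/(partition_function _ _).
have fZ := partition_function_fin r lam_ge0 fset0 mT (leb_allowed X).
have Z1 := partition_function_ge1 lam_ge0 mT (@hard_core0 R d r).
rewrite -muleA -[X in (_ * (_ * X))%E]fineK// -EFinM mulVf ?mule1//.
rewrite gt_eqF// -lte_fin fineK// (lt_le_trans _ Z1)//.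
Qed.

Let mSW : measurable (S `&` W). Proof. exact: measurableI. Qed.
Let mSD : measurable (S `\` W). Proof. exact: measurableD. Qed.

Let pois_split F : nnmeas F ->
  pois S (hc F) fset0 = pois (S `\` W) (pois (S `&` W) (hc F)) fset0.
Proof.
move=> pF.
have dj : [disjoint S `\` W & S `&` W] by apply/disj_setPS => y [[_ nW] [_ yW]].
have SE : S = (S `\` W) `|` (S `&` W).
  apply/seteqP; split => y; last by move=> [[]|[]].
  by have [By|By] := pselect (W y); [right|left].
by rewrite -(pois_setU lam_ge0 mSD mSW dj fset0 (nnmeas_hc r pF)) -SE.
Qed.

Let pois_not_hc (T : set E) F X : measurable T -> nnmeas F -> ~ H X -> pois T (hc F) X = 0%E.
Proof.
move=> mT pF HX; rewrite -(sadd0 (sadd_pois lam_ge0 X mT)).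
apply: (pois_eq lam_ge0 (I := fun Y => ~ H Y)) => //; first exact: nnmeas_hc.
- move=> p Y _ HY HpY; apply: HY => u v uY vY uv.
  by apply: HpY => //; rewrite in_fset1U ?uY ?vY orbT.
- by move=> Y HY; rewrite hcF.
Qed.

Lemma cond_pois_le_outside (c : R) : 0 <= c ->
  (forall X, H X -> [set` X] `<=` S `\` W ->
     cond_pois (allowed X) (eindic R E0) fset0 <= c%:E)%E ->
  (cond_pois S (eindic R E0) fset0 <= c%:E)%E.
Proof.
move=> c0 ac; have H0 := @hard_core0 R d r; have p1 := @nnmeas1 R d.
rewrite -(cond_pois_cst lam_ge0 mS Soo H0 c0).
rewrite /cond_pois lee_wpmul2r//; first by rewrite lee_fin partition_inv_ge0.
have pc : nnmeas (fun _ : C => c%:E) by exact: nnmeas_cst.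
rewrite !pois_split//.
apply: (pois_le lam_ge0 (I := fun Y Y' => Y = Y' /\ [set` Y] `<=` S `\` W)) => //.
- by apply: nnmeas_pois => //; exact: nnmeas_hc.
- by apply: nnmeas_pois => //; exact: nnmeas_hc.
- by move=> p Y _ Sp [<- YS]; split=> // y /=; rewrite in_fset1U => /orP[/eqP->//|/YS].
- move=> Y _ [<- YS]; have [HY|HY] := pselect (H Y); last by rewrite !pois_not_hc.
  rewrite pois_outsideE//; last by move=> y /YS[].
  apply: (@le_trans _ _ (c%:E * partition_function (S `&` W) Y))%E.
    by rewrite lee_wpmul2r ?ac// partition_function_ge0.
  rewrite -(saddZ (sadd_pois_hc r lam_ge0 Y mSW))//.
  by rewrite le_eqVlt; apply/orP; left; apply/eqP; congr (pois _ (hc _) _);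
    apply/funext => X; rewrite mule1.
Qed.

Lemma cond_pois_ge_outside (c : R) : 0 <= c ->
  (forall X, H X -> [set` X] `<=` S `\` W ->
     c%:E <= cond_pois (allowed X) (eindic R E0) fset0)%E ->
  (c%:E <= cond_pois S (eindic R E0) fset0)%E.
Proof.
move=> c0 ac; have H0 := @hard_core0 R d r; have p1 := @nnmeas1 R d.
rewrite -(cond_pois_cst lam_ge0 mS Soo H0 c0).
rewrite /cond_pois lee_wpmul2r//; first by rewrite lee_fin partition_inv_ge0.
have pc : nnmeas (fun _ : C => c%:E) by exact: nnmeas_cst.
rewrite !pois_split//.
apply: (pois_le lam_ge0 (I := fun Y Y' => Y = Y' /\ [set` Y] `<=` S `\` W)) => //.
- by apply: nnmeas_pois => //; exact: nnmeas_hc.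
- by apply: nnmeas_pois => //; exact: nnmeas_hc.
- by move=> p Y _ Sp [<- YS]; split=> // y /=; rewrite in_fset1U => /orP[/eqP->//|/YS].
- move=> Y _ [<- YS]; have [HY|HY] := pselect (H Y); last by rewrite !pois_not_hc.
  rewrite pois_outsideE//; last by move=> y /YS[].
  apply: (@le_trans _ _ (c%:E * partition_function (S `&` W) Y))%E; last first.
    by rewrite lee_wpmul2r ?ac// partition_function_ge0.
  rewrite -(saddZ (sadd_pois_hc r lam_ge0 Y mSW))//.
  by rewrite le_eqVlt; apply/orP; left; apply/eqP; congr (pois _ (hc _) _);
    apply/funext => X; rewrite mule1.
Qed.

End outside.

Lemma cond_pois_eindic_bounds S X : measurable S -> (leb S < +oo)%E -> H X ->
  (0 <= cond_pois S (eindic R E0) X <= 1)%E.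
Proof.
move=> mS Soo HX; have pE := nnmeas_eindic R mE0.
rewrite (sadd_ge0 (sadd_cond_pois r lam_ge0 X mS))//=.
rewrite -(cond_pois1 lam_ge0 mS Soo HX); apply: (cond_pois_le lam_ge0 (I := xpredT)) => //.
by move=> Y _ _; rewrite lee_fin indicE lern1; case: (_ \in _).
Qed.

(** The centers outside [W] are not coupled: each side is an average over them, and the hypothesis
    for all pairs compares the largest value for [S] with the smallest one for [S']. *)
Lemma cond_pois_localize S S' (c : R) : 0 <= c ->
  measurable S -> (leb S < +oo)%E -> measurable S' -> (leb S' < +oo)%E ->
  (forall X X', H X -> H X' -> [set` X] `<=` S `\` W -> [set` X'] `<=` S' `\` W ->
    cond_pois (allowed S X) (eindic R E0) fset0 <=
    cond_pois (allowed S' X') (eindic R E0) fset0 + c%:E)%E ->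
  (cond_pois S (eindic R E0) fset0 <= cond_pois S' (eindic R E0) fset0 + c%:E)%E.
Proof.
move=> c0 mS Soo mS' S'oo XX'.
have H0 := @hard_core0 R d r.
have fin T : measurable T -> (leb T < +oo)%E -> cond_pois T (eindic R E0) fset0 \is a fin_num.
  move=> mT Too; have /andP[a b] := cond_pois_eindic_bounds mT Too H0.
  by rewrite ge0_fin_numE// (le_lt_trans b)// ltry.
set a := cond_pois S _ _; have fa : a \is a fin_num by exact: fin.
rewrite -leeBlDr// -[a]fineK// -EFinB.
(* [cond_pois_ge_outside] takes a nonnegative constant; in the other case the claim is immediate. *)
have [ca|ca] := leP (fine a - c) 0.
  apply: (@le_trans _ _ 0%E); first by rewrite lee_fin.
  by have /andP[] := cond_pois_eindic_bounds mS' S'oo H0.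
apply: cond_pois_ge_outside => //; first exact: ltW.
move=> X' HX' X'S; have mT' := measurable_allowed mS' X'; have T'oo := leb_allowed mS' S'oo X'.
set a' := cond_pois _ _ _; have fa' : a' \is a fin_num by exact: fin.
rewrite -(fineK fa') lee_fin lerBlDr -lee_fin (fineK fa).
have /andP[a'0 _] := cond_pois_eindic_bounds mT' T'oo H0.
apply: cond_pois_le_outside => //; first by rewrite addr_ge0// fine_ge0.
by move=> X HX XS; rewrite EFinD (fineK fa'); exact: XX'.
Qed.

End localization.

(** * Volumes, packing and distances *)

Section volumes.
Context (R : realType).

Lemma tuple_measure_box n (I : nat -> set (measurableTypeR R)) (v : R) :
  (forall i, measurable (I i)) -> (forall i, lebesgue_measure (I i) = v%:E) ->
  tuple_measure (@lebesgue_measure R) n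
    [set t : n.-tuple (measurableTypeR R) | forall i : 'I_n, I i (tnth t i)] = (v ^+ n)%:E.
Proof.
elim: n I => [|n IH] I mI Iv.
  rewrite /= [LHS]diracE mem_set//; case => //.
rewrite /= /cons_measure /pushforward /= /product_measure1.
transitivity (\int[@lebesgue_measure R]_(x in I 0%N) (v ^+ n)%:E)%E.
  rewrite [RHS]integral_mkcond; apply: eq_integral => x _; rewrite patchE /=.
  case: ifPn => [/set_mem Ix|/negP Ix].
    rewrite -(IH (fun i => I i.+1))//; congr (tuple_measure _ n _).
    apply/funext => t; apply/propext; rewrite /xsection /=; split.
      move=> /set_mem /= Ht i; have := Ht (lift ord0 i).
      by rewrite tnthS.
    move=> Ht; apply/mem_set => /= i.
    by case: (unliftP ord0 i) => [j ->|->]; rewrite ?tnthS ?tnth0//; exact: Ht.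
  transitivity (tuple_measure (@lebesgue_measure R) n set0); last by rewrite measure0.
  congr (tuple_measure _ n _); apply/seteqP; split => // t /set_mem /= Ht.
  by apply: Ix; apply/mem_set; have := Ht ord0; rewrite tnth0.
rewrite integral_cst//; transitivity ((v ^+ n)%:E * v%:E)%E; last by rewrite -EFinM exprSr.
by congr (_ * _)%E; exact: Iv.
Qed.

Context (d : nat).
Local Notation E := 'rV[R]_d.
Local Notation leb := (@lebesgue_row R d).
Implicit Types (M Z : set E) (x y z : E).

Definition box (x : E) (e : R) : set E := [set y | forall i, `|y ord0 i - x ord0 i| < e].

Lemma measurable_box x e : measurable (box x e).
Proof.
rewrite (_ : box x e = \bigcap_(i in [set: 'I_d]) ((@coord_proj R d i) @^-1` (ball
  (x ord0 i) e : set R))).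
  apply: fin_bigcap_measurable; first exact: finite_finset.
  by move=> i _; rewrite -[X in measurable X]setTI; apply: measurable_coord_proj => //;
    exact: measurable_ball.
apply/seteqP; split => y H i //; first by move=> _; rewrite /= /ball/= distrC; exact: H.
by have := H i Logic.I; rewrite /= /ball/= distrC.
Qed.

Lemma leb_box x e : 0 < e -> leb (box x e) = ((2 * e) ^+ d)%:E.
Proof.
move=> e0; pose I (k : nat) : set (measurableTypeR R) :=
  if insub k is Some i then ball (x ord0 i) e else ball (0 : R) e.
rewrite -(@tuple_measure_box d I).
- rewrite /lebesgue_row /pushforward; congr (tuple_measure _ d _).
  apply/funext => t; apply/propext; rewrite /box /I /=; split=> H i; have := H i.
    by rewrite valK /ball /= mxE distrC.
  by rewrite valK /ball /= mxE distrC.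
- by move=> k; rewrite /I; case: insub => [i|]; exact: measurable_ball.
- move=> k; rewrite /I; case: insub => [i|]; rewrite lebesgue_measure_ball ?ltW// mulr_natl//.
Qed.

Lemma leb_eball_le x l : 0 < l -> (leb (eball l x) <= ((2 * l) ^+ d)%:E)%E.
Proof.
move=> l0; rewrite -(leb_box x l0); apply: le_measure; rewrite ?inE.
- exact: measurable_eball.
- exact: measurable_box.
move=> y yl i; have := le_lt_trans (coord_le_enorm (y - x) i) yl.
by rewrite !mxE.
Qed.

(** The open ball contains a cube of half-side [l / d.+1]; taking [d.+1] instead of [d] keeps the
    norm strictly below [l]. *)
Lemma leb_eball_ge x l : 0 < l -> (((2 * (l / d.+1%:R)) ^+ d)%:E <= leb (eball l x))%E.
Proof.
move=> l0; have e0 : 0 < l / d.+1%:R by rewrite divr_gt0.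
rewrite -(leb_box x e0); apply: le_measure; rewrite ?inE.
- exact: measurable_box.
- exact: measurable_eball.
move=> y yb; rewrite /eball /=.
have yb' i : `|(y - x) ord0 i| < l / d.+1%:R by rewrite !mxE; exact: yb.
rewrite (le_lt_trans (enorm_lt_box yb' e0))//.
by rewrite mulrCA gtr_pMr// ltr_pdivrMr// mul1r ltr_nat.
Qed.

Lemma nbhd_set1 l x : nbhd l [set x] = eball l x.
Proof.
apply/seteqP; split => [y [_ -> //]|y yx]; by exists x.
Qed.

Lemma le_leb (A B : set E) : measurable A -> measurable B -> A `<=` B -> (leb A <= leb B)%E.
Proof. by move=> mA mB AB; apply: le_measure; rewrite ?inE. Qed.

Lemma nbhd_subset l l' M M' : l <= l' -> M `<=` M' -> nbhd l M `<=` nbhd l' M'.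
Proof. by move=> ll' MM' y [z Mz yz]; exists z; [exact: MM'|exact: lt_le_trans ll']. Qed.

Lemma nbhd_nbhd l l' M : nbhd l (nbhd l' M) `<=` nbhd (l + l') M.
Proof.
move=> y [z [w Mw zw] yz]; exists w => //.
by rewrite (le_lt_trans (enorm_triangle z _ _))// ltrD.
Qed.

Lemma leb_bounded M l x : measurable M -> M `<=` eball l x -> (leb M < +oo)%E.
Proof.
move=> mM Ml; have l1 : 0 < `|l| + 1 by rewrite ltr_wpDl.
apply: le_lt_trans (ltry ((2 * (`|l| + 1)) ^+ d)).
apply: le_trans (leb_eball_le x l1); apply: le_leb => //; first exact: measurable_eball.
move=> y /Ml; rewrite /eball /= => /lt_le_trans; apply.
by rewrite (le_trans (ler_norm l))// lerDl.
Qed.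

(* Compare both neighbourhoods with the balls around a maximal separated subset of [M]. *)
Section packing.
Variables (M : set E) (l0 : R) (x0 : E) (rho : R).
Hypotheses (Mb : M `<=` eball l0 x0) (rho0 : 0 < rho).

Let small : R := (2 * (rho / d.+1%:R)) ^+ d.

Let small0 : 0 < small.
Proof. by rewrite exprn_gt0// mulr_gt0// divr_gt0. Qed.

Let separated (s : seq E) := uniq s /\
  (forall x y, x \in s -> y \in s -> x != y -> 2 * rho <= enorm (x - y)).

Let packing_lower (s : seq E) : separated s ->
  (((size s)%:R * small)%:E <= leb (nbhd rho [set` s]))%E.
Proof.
elim: s => [|p s IH] [us ss]; first by rewrite mul0r.
have [ps us'] := andP us.
have ss' : separated s.
  by split => // x y xs ys; apply: ss; rewrite inE ?xs ?ys orbT.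
have -> : nbhd rho [set` p :: s] = eball rho p `|` nbhd rho [set` s].
  apply/seteqP; split => y.
    move=> [z /=]; rewrite inE => /orP[/eqP->|zs] yz; [by left|by right; exists z].
  by move=> [yp|[z /= zs yz]]; [exists p; rewrite //= inE eqxx|exists z; rewrite //= inE zs orbT].
rewrite measureU; [|exact: measurable_eball|exact: measurable_nbhd|].
  rewrite /= -natr1 mulrDl mul1r EFinD addeC leeD//; first exact: leb_eball_ge.
  exact: IH.
apply/seteqP; split => // y [yp [z /= zs yz]].
have : 2 * rho <= enorm (p - z).
  by apply: ss; rewrite ?inE ?eqxx ?zs ?orbT//; apply: contraNneq ps => ->.
have := enorm_triangle y p z; rewrite enormB in yp *; move: yp yz; rewrite /eball /=.
by rewrite [enorm (y - p)]enormB; lra.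
Qed.

Let packing_upper (s : seq E) l : 0 < l ->
  (leb (nbhd l [set` s]) <= ((size s)%:R * (2 * l) ^+ d)%:E)%E.
Proof.
move=> lp; elim: s => [|p s IH].
  by rewrite mul0r (_ : nbhd _ _ = set0) ?measure0//; apply/seteqP; split => // y [z].
have -> : nbhd l [set` p :: s] = eball l p `|` nbhd l [set` s].
  apply/seteqP; split => y.
    move=> [z /=]; rewrite inE => /orP[/eqP->|zs] yz; [by left|by right; exists z].
  by move=> [yp|[z /= zs yz]]; [exists p; rewrite //= inE eqxx|exists z; rewrite //= inE zs orbT].
apply: (le_trans (measureU2 _ _ _)); [exact: measurable_eball|exact: measurable_nbhd|].
by rewrite /= -natr1 mulrDl mul1r EFinD addeC leeD//; exact: leb_eball_le.
Qed.

Lemma packing R1 : 0 <= R1 ->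
  (leb (nbhd R1 M) <= ((2 * (R1 + 2 * rho)) ^+ d / small)%:E * leb (nbhd rho M))%E.
Proof.
move=> R10.
have Moo : (leb (nbhd rho M) < +oo)%E.
  apply: (@leb_bounded _ (rho + l0) x0); first exact: measurable_nbhd.
  rewrite -nbhd_set1; apply: subset_trans (@nbhd_nbhd _ _ _).
  by rewrite nbhd_set1; exact: nbhd_subset.
pose P (n : nat) := `[< exists s, [/\ size s = n, separated s & [set` s] `<=` M] >].
have P0 : exists n, P n by exists 0%N; apply/asboolP; exists [::]; split => //; split.
(* Disjoint balls around separated points lie in a set of finite volume, so cardinalities are
   bounded and a largest separated subset exists. *)
have Pub n : P n -> (n <= Num.truncn (fine (leb (nbhd rho M)) / small))%N.
  move=> /asboolP[s [<- ss sM]].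
  have q0 : 0 <= fine (leb (nbhd rho M)) / small by rewrite divr_ge0 ?fine_ge0// ltW.
  rewrite truncn_ge_nat//.
  rewrite ler_pdivlMr// -lee_fin fineK ?ge0_fin_numE//.
  apply: (le_trans (packing_lower ss)); apply: le_leb; try exact: measurable_nbhd.
  exact: nbhd_subset.
case: (ex_maxnP P0 Pub) => n /asboolP[s [sn ss sM]] nmax.
(* A point of [M] not covered could be added to the maximal subset. *)
have cover : M `<=` nbhd (2 * rho) [set` s].
  move=> m Mm; apply: contrapT => nm.
  suff : P n.+1 by move/nmax; rewrite ltnn.
  apply/asboolP; exists (m :: s); split => /=; first by rewrite sn.
    have ms z : z \in s -> 2 * rho <= enorm (m - z).
      by move=> zs; rewrite leNgt; apply/negP => mz; apply: nm; exists z.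
    have [us ss2] := ss; split => /=.
      rewrite us andbT; apply/negP => /ms; rewrite subrr enorm0 leNgt.
      by rewrite mulr_gt0.
    move=> x y; rewrite !inE => /orP[/eqP->|xs] /orP[/eqP->|ys] xy.
    - by rewrite eqxx in xy.
    - exact: ms.
    - by rewrite enormB; exact: ms.
    - exact: ss2.
  by move=> z /=; rewrite inE => /orP[/eqP->|/sM].
have Rp : 0 < R1 + 2 * rho by rewrite ltr_wpDl// mulr_gt0.
apply: (@le_trans _ _ (leb (nbhd (R1 + 2 * rho) [set` s]))).
  apply: le_leb; try exact: measurable_nbhd.
  by apply: subset_trans (@nbhd_nbhd _ _ _); exact: nbhd_subset.
apply: (le_trans (packing_upper s Rp)).
have size_le : (size s)%:R * small <= fine (leb (nbhd rho M)).
  rewrite -lee_fin fineK ?ge0_fin_numE//.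
  apply: (le_trans (packing_lower ss)); apply: le_leb; try exact: measurable_nbhd.
  exact: nbhd_subset.
rewrite -[X in (_ <= _ * X)%E]fineK ?ge0_fin_numE// -EFinM lee_fin mulrAC ler_pdivlMr//.
rewrite mulrAC [X in _ <= X]mulrC ler_wpM2r// exprn_ge0// mulr_ge0// ltW//.
Qed.

End packing.
End volumes.

(** * Distances, thickenings and inner sets *)

Section distances.
Context (R : realType) (d : nat).
Local Notation E := 'rV[R]_d.
Implicit Types (A B Z : set E) (x y z : E).

Lemma set_dist_ltP A B (l : R) :
  (set_dist A B < l%:E)%E <-> exists a b, [/\ A a, B b & enorm (a - b) < l].
Proof.
split.
  move=> /ereal_inf_lt[_ [[a b] /= [Aa Bb] <-]]; rewrite lte_fin => ab.
  by exists a, b.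
move=> [a [b [Aa Bb ab]]]; apply: (@le_lt_trans _ _ (enorm (a - b))%:E); last by rewrite lte_fin.
by apply: ereal_inf_lbound; exists (a, b).
Qed.

Lemma set_dist1_ltP A x (l : R) : (set_dist [set x] A < l%:E)%E <-> nbhd l A x.
Proof.
rewrite set_dist_ltP; split => [[_ [b [-> Ab xb]]]|[b Ab xb]]; first by exists b.
by exists x, b.
Qed.

Lemma set_dist_geP A B (l : R) :
  (l%:E <= set_dist A B)%E <-> forall a b, A a -> B b -> l <= enorm (a - b).
Proof.
split => [lAB a b Aa Bb|lAB].
  rewrite -lee_fin; apply: (le_trans lAB); apply: ereal_inf_lbound.
  by exists (a, b).
rewrite leNgt; apply/negP => /set_dist_ltP[a [b [Aa Bb]]].
by apply/negP; rewrite -leNgt; exact: lAB.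
Qed.

Lemma inner_setE (r : R) A : inner_set r A = A `&` ~` nbhd r (~` A).
Proof.
apply/seteqP; split => x [Ax rx]; split => //.
  by move/set_dist1_ltP; apply/negP; rewrite -leNgt.
by rewrite leNgt; apply/negP => /set_dist1_ltP.
Qed.

Lemma measurable_inner_set (r : R) A : measurable A -> measurable (inner_set r A).
Proof.
move=> mA; rewrite inner_setE; apply: measurableI => //.
by apply: measurableC; exact: measurable_nbhd.
Qed.

(** Used for volumes: the [r]-neighbourhood of the possible centers is no larger than the domain. *)
Lemma nbhd_inner_set (r : R) A : nbhd r (inner_set r A) `<=` A.
Proof.
move=> y [x]; rewrite inner_setE => -[Ax nx] yx; apply: contrapT => nAy.
by apply: nx; exists y => //; rewrite enormB.
Qed.

Lemma nbhd_thickening (l : R) A : nbhd l A `<=` thickening l A.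
Proof. by move=> x /set_dist1_ltP/ltW. Qed.

Lemma thickening_nbhd (l e : R) A : 0 < e -> thickening l A `<=` nbhd (l + e) A.
Proof. by move=> e0 x xA; apply/set_dist1_ltP; rewrite (le_lt_trans xA)// lte_fin ltrDl. Qed.

Lemma thickeningE (l : R) A : thickening l A = \bigcap_n nbhd (l + n.+1%:R^-1) A.
Proof.
apply/seteqP; split => [x xA n _|x H].
  by apply: thickening_nbhd xA; rewrite invr_gt0.
apply/lee_addgt0Pr => e e0; have := H (Num.truncn e^-1) Logic.I.
move=> /set_dist1_ltP/ltW/le_trans; apply; rewrite -EFinD lee_fin lerD2l.
by rewrite invf_ple ?posrE// ltW// truncnS_gt.
Qed.

Lemma measurable_thickening (l : R) A : measurable (thickening l A).
Proof.
rewrite thickeningE; apply: bigcapT_measurable => n; exact: measurable_nbhd.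
Qed.

Lemma closed_thickening (l : R) A : closed (thickening l A).
Proof.
rewrite -[X in closed X]setCK; apply: open_closedC.
rewrite openE => x nx; have lx : (l%:E < set_dist [set x] A)%E by rewrite ltNge; apply/negP.
have [e e0 ex] : exists2 e : R, 0 < e & forall a, A a -> l + e <= enorm (x - a).
  have [/eqP doo|dfin] := eqVneq (set_dist [set x] A) +oo%E.
    exists 1 => // a Aa; move/eqP: doo => doo.
    have : ((l + 1)%:E <= set_dist [set x] A)%E by rewrite doo leey.
    by move/set_dist_geP; apply.
  have fd : set_dist [set x] A \is a fin_num.
    by rewrite fin_numE dfin andbT gt_eqF// (lt_trans _ lx)// ltNyr.
  exists (fine (set_dist [set x] A) - l).
    by rewrite subr_gt0 -lte_fin fineK.
  move=> a Aa; rewrite addrC subrK.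
  have : ((fine (set_dist [set x] A))%:E <= set_dist [set x] A)%E by rewrite fineK.
  by move/set_dist_geP; apply.
(* The topology is that of the sup norm; sup-distance below [e / d.+1] forces Euclidean distance
   below [e]. *)
have e1 : 0 < e / d.+1%:R by rewrite divr_gt0.
apply/nbhs_ballP; exists (e / d.+1%:R) => //= y [_ xy] ly.
have yx i : `|(x - y) ord0 i| < e / d.+1%:R by rewrite !mxE; exact: xy.
have xy_e : enorm (x - y) < e.
  rewrite (le_lt_trans (enorm_lt_box yx e1))// mulrCA gtr_pMr//.
  by rewrite ltr_pdivrMr// mul1r ltr_nat.
have : nbhd (l + (e - enorm (x - y))) A y by apply: thickening_nbhd ly; rewrite subr_gt0.
move=> [a Aa ya]; have := ex a Aa; have := enorm_triangle y x a; lra.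
Qed.

Lemma bounded_closed_row (A : set E) (M : R) : closed A -> A `<=` eball M 0 -> compact A.
Proof.
move=> cA AM.
have cB := @rV_compact R d (fun=> `[- M, M]%classic) (fun i => @segment_compact R (- M) M).
apply: (subclosed_compact cA cB).
move=> x /AM; rewrite /eball /= subr0 => xM i; rewrite /= in_itv /= -ler_norml.
exact: (le_trans (coord_le_enorm x i) (ltW xM)).
Qed.

Lemma compact_row_bounded (A : set E) : compact A -> exists M, A `<=` eball M 0.
Proof.
move=> cA.
have cb (i : 'I_d) : exists M : R, forall x, A x -> `|x ord0 i| <= M.
  have : compact ((fun x : E => x ord0 i) @` A).
    by apply: continuous_compact => //; apply: continuous_subspaceT; exact: coord_continuous.
  move=> /compact_bounded[M [Mr HM]]; exists (M + 1) => x Ax.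
  by apply: (HM (M + 1)); [rewrite ltrDl|exists x].
have [M HM] := choice cb; exists (\sum_i M i + 1) => x Ax.
rewrite /eball /= subr0 (le_lt_trans (enorm_le_sum x))// ltr_pwDr//.
by apply: ler_sum => i _; exact: HM.
Qed.

Section dist_to.
Variables (A : set E) (a0 : E).
Hypothesis Aa0 : A a0.

Definition dist_to (y : E) : R := fine (set_dist [set y] A).

Lemma set_dist1_ge0 y : (0 <= set_dist [set y] A)%E.
Proof. by apply/set_dist_geP => ? ? _ _; exact: enorm_ge0. Qed.

Lemma set_dist1_fin y : set_dist [set y] A \is a fin_num.
Proof.
rewrite ge0_fin_numE ?set_dist1_ge0//.
apply: (@lt_trans _ _ (enorm (y - a0) + 1)%:E); last exact: ltry.
by apply/set_dist1_ltP; exists a0 => //; rewrite ltrDl.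
Qed.

Lemma dist_to_ltP y l : dist_to y < l <-> nbhd l A y.
Proof. by rewrite -set_dist1_ltP -lte_fin /dist_to fineK ?set_dist1_fin. Qed.

Lemma dist_to_lipschitz x y : dist_to y <= dist_to x + enorm (y - x).
Proof.
apply/ler_addgt0Pr => e e0; rewrite -addrA.
have : dist_to x < dist_to x + e by rewrite ltrDl.
move=> /dist_to_ltP[a Aa xa]; apply/ltW/dist_to_ltP; exists a => //.
by rewrite (le_lt_trans (enorm_triangle x _ _))//; lra.
Qed.

Lemma measurable_dist_to : measurable_fun setT dist_to.
Proof.
apply: (measurability _ (RGenInftyO.measurableE R)) => //.
move=> _ [_ [l ->] <-]; rewrite setTI.
rewrite (_ : _ @^-1` _ = nbhd l A); first exact: measurable_nbhd.
by apply/seteqP; split => y; rewrite /= in_itv /= => /dist_to_ltP.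
Qed.

End dist_to.
End distances.

(** * Decay of the influence of the boundary condition *)

Section fine_lemmas.
Context (R : realType).
Implicit Types (x y : \bar R) (z : R).

Lemma fine_dist_le x y z : x \is a fin_num -> y \is a fin_num ->
  (`|x - y| <= z%:E)%E -> `|fine x - fine y| <= z.
Proof. by case: x => [x| |] // ; case: y. Qed.

Lemma fine_leD x y z : x \is a fin_num -> y \is a fin_num ->
  (x <= y + z%:E)%E -> fine x <= fine y + z.
Proof. by case: x => [x| |] // ; case: y. Qed.

Lemma leD_fine x y z : x \is a fin_num -> y \is a fin_num ->
  fine x <= fine y + z -> (x <= y + z%:E)%E.
Proof. by case: x => [x| |] // ; case: y. Qed.

Lemma le_via_close (u1 u2 i1 i2 e B : R) : `|u1 - i1| <= e -> `|u2 - i2| <= e ->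
  i1 <= i2 + B -> u1 <= u2 + (2 * e + B).
Proof. by rewrite !ler_norml => /andP[? ?] /andP[? ?] ?; lra. Qed.

End fine_lemmas.

Section local_bound.
Context (R : realType) (d : nat).
Local Notation E := 'rV[R]_d.
Local Notation C := {fset 'rV[R]_d}.
Local Notation leb := (@lebesgue_row R d).
Variables (r lam L b c : R).
Hypotheses (r0 : 0 < r) (lam0 : 0 < lam) (L0 : 0 < L) (b0 : 0 < b) (c0 : 0 < c).
Local Notation cond_pois := (cond_pois r lam).
Hypothesis mixing : forall Lam : set E, compact Lam -> measurable Lam -> inner_set r Lam !=set0 ->
    forall tau, boundary_condition r Lam tau ->
    forall s : R, 0 < s ->
    forall mu nu, heat_bath_laws r lam L Lam tau mu -> heat_bath_laws r lam L Lam tau nu ->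
    let n := fine (lebesgue_row Lam) in
    (tv_dist (mu (Num.truncn (s * n))) (nu (Num.truncn (s * n))) <=
     (b * n * expR (- (c * s)))%:E)%E.

(** With [ball_lb], the volumes of a circumscribed and of an inscribed cube, which bracket that of a
    ball. *)
Definition ball_ub (l : R) : R := (2 * l) ^+ d.
Definition ball_lb (l : R) : R := (2 * (l / d.+1%:R)) ^+ d.
(** The outcome of an update depends on centers up to this distance: the radius of the ball plus the
    range of the interaction. *)
Definition reach := L + 2 * r.
(** Bounds the spread of a ball of radius [L] relative to [psi] at its center: a volume factor for
    radius [reach + L], times the variation of [psi] over that distance. *)
Definition infl := ball_ub (reach + L) * expR (reach + L).
(** [psi] is at least [expR (- reach)] throughout the ball of radius [reach] about a point of
    [A]. *)
Definition target_lb := expR (- reach) * ball_lb reach.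
(** The constant of [packing] for radii [r + 2] and [L]. *)
Definition pack := ball_ub (r + 2 + 2 * L) / ball_lb L.
(** The constant of [packing] with inner radius [r]. The outer radius [l + r + 1 + reach] covers
    both [Big] and the [reach]-neighbourhood of the mismatch. *)
Definition growth (l : R) := ball_ub (l + r + 1 + reach + 2 * r) / ball_lb r.

Lemma ball_ub_gt0 l : 0 < l -> 0 < ball_ub l.
Proof. by move=> l0; rewrite exprn_gt0// mulr_gt0. Qed.

Lemma ball_lb_gt0 l : 0 < l -> 0 < ball_lb l.
Proof. by move=> l0; rewrite exprn_gt0// mulr_gt0// divr_gt0. Qed.

Lemma reach_gt0 : 0 < reach.
Proof. by rewrite addr_gt0// mulr_gt0. Qed.

Lemma infl_gt0 : 0 < infl.
Proof. by rewrite mulr_gt0 ?expR_gt0// ball_ub_gt0// addr_gt0// reach_gt0. Qed.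

Lemma target_lb_gt0 : 0 < target_lb.
Proof. by rewrite mulr_gt0 ?expR_gt0// ball_lb_gt0// reach_gt0. Qed.

Lemma pack_gt0 : 0 < pack.
Proof.
apply: divr_gt0; last exact: ball_lb_gt0.
by apply: ball_ub_gt0; have := r0; have := L0; lra.
Qed.

Lemma growth_ge0 l : 0 <= l -> 0 <= growth l.
Proof.
move=> l0; rewrite divr_ge0// ltW ?ball_lb_gt0// ball_ub_gt0//.
have := reach_gt0; have := r0; lra.
Qed.

Variables (Lam' : set E) (a0 : E).
Hypotheses (cLam' : compact Lam') (mLam' : measurable Lam').
Local Notation A := (inner_set r Lam').
Hypothesis Aa0 : A a0.
Variable l : R.
Hypothesis l0 : 0 <= l.

(** The extra [r] makes the inner set [I] contain the [l]-neighbourhood of [A]; the thickening is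
    closed because temporal mixing is stated for compact domains. *)
Local Notation Big := (thickening (l + r) A).
Local Notation I := (inner_set r Big).
Local Notation U := (thickening L I).
Local Notation v' := (fine (leb Lam')).

Let mBig : measurable Big := measurable_thickening (l + r) A.
Let mI : measurable I := measurable_inner_set r mBig.
Let mU : measurable U := measurable_thickening L I.

Lemma nbhd_sub_inner : nbhd l A `<=` I.
Proof.
move=> y [a Aa ya]; rewrite inner_setE; split.
  by apply: nbhd_thickening; exists a => //; rewrite (lt_le_trans ya)// lerDl ltW.
move=> [z nz yz]; apply: nz; apply: nbhd_thickening; exists a => //.
by rewrite (le_lt_trans (enorm_triangle y _ _))// addrC ltrD// enormB.
Qed.

Lemma inner_sub_inner : A `<=` I.
Proof.
move=> a Aa; rewrite inner_setE; split.
  by apply: nbhd_thickening; exists a => //; rewrite subrr enorm0 ltr_wpDl.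
move=> [z nz yz]; apply: nz; apply: nbhd_thickening; exists a => //.
by rewrite enormB ltr_wpDl.
Qed.

Let A_bounded : exists M, A `<=` eball M 0.
Proof.
have [M HM] := compact_row_bounded cLam'; exists M => x [Lx _]; exact: HM.
Qed.

Let nbhd_bounded k Z M : Z `<=` eball M 0 -> nbhd k Z `<=` eball (k + M) (0 : E).
Proof.
move=> ZM; rewrite -nbhd_set1; apply: subset_trans (@nbhd_nbhd _ _ _ _ _).
by rewrite nbhd_set1; exact: nbhd_subset.
Qed.

Let Big_bounded : exists M, Big `<=` eball M 0.
Proof.
have [M HM] := A_bounded; exists (l + r + 1 + M).
by apply: subset_trans (nbhd_bounded HM); exact: thickening_nbhd.
Qed.

Let U_bounded : exists M, U `<=` eball M 0.
Proof.
have [M HM] := Big_bounded; exists (L + 1 + M).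
apply: subset_trans (@nbhd_bounded (L + 1) I M _); first exact: thickening_nbhd.
by move=> x [Bx _]; exact: HM.
Qed.

Lemma compact_Big : compact Big.
Proof.
by have [M HM] := Big_bounded; apply: bounded_closed_row HM; exact: closed_thickening.
Qed.

Let Bigoo : (leb Big < +oo)%E.
Proof. by have [M HM] := Big_bounded; exact: leb_bounded HM. Qed.

Let Uoo : (leb U < +oo)%E.
Proof. by have [M HM] := U_bounded; exact: leb_bounded HM. Qed.

Let U0 : (0 < leb U)%E.
Proof.
apply: (@lt_le_trans _ _ (ball_lb L)%:E); first by rewrite lte_fin ball_lb_gt0.
apply: (le_trans (leb_eball_ge a0 L0)); apply: le_leb => //; first exact: measurable_eball.
move=> y ya; apply: nbhd_thickening; exists a0 => //; exact: inner_sub_inner.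
Qed.

Let Lam'oo : (leb Lam' < +oo)%E.
Proof. by have [M HM] := compact_row_bounded cLam'; exact: leb_bounded HM. Qed.

Lemma leb_nbhd_le : (leb (nbhd (l + r + 1 + reach) A) <= (growth l * v')%:E)%E.
Proof.
have [M HM] := A_bounded.
have k0 : 0 <= l + r + 1 + reach by have := reach_gt0; have := r0; have := l0; lra.
apply: (le_trans (packing HM r0 k0)); rewrite [X in (_ <= X)%E]EFinM fineK ?ge0_fin_numE//.
apply: lee_wpmul2l; first by rewrite lee_fin growth_ge0.
by apply: le_leb => //; [exact: measurable_nbhd|exact: nbhd_inner_set].
Qed.

Lemma leb_Big_le : fine (leb Big) <= growth l * v'.
Proof.
rewrite -lee_fin fineK ?ge0_fin_numE//; apply: le_trans leb_nbhd_le; apply: le_leb => //.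
  exact: measurable_nbhd.
apply: (@subset_trans _ (nbhd (l + r + 1) A)); first exact: thickening_nbhd.
by apply: nbhd_subset => //; rewrite lerDl ltW// reach_gt0.
Qed.

(** The chain makes about [s * |Big|] updates, each inflating the disagreement by [1 + infl / |U|];
    the total is controlled once the ratio of the volumes is bounded independently of [l] and
    [Lam']. *)
Lemma leb_Big_le_U : fine (leb Big) <= pack * fine (leb U).
Proof.
have [M HM] := Big_bounded.
have IM : I `<=` eball M 0 by move=> x [Bx _]; exact: HM.
have r20 : 0 <= r + 2 by rewrite addr_ge0// ltW.
rewrite -lee_fin EFinM !fineK ?ge0_fin_numE//.
apply: (@le_trans _ _ (leb (nbhd (r + 2) I))).
  apply: le_leb => //; first exact: measurable_nbhd.
  move=> x /(thickening_nbhd ltr01)[a Aa xa].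
  have m0 : 0 < l + r + 1 by have := r0; have := l0; lra.
  (* Going the fraction [t] of the way from [a] to [x] covers less than [l], so it ends in [I] (at
     [a] itself if [l = 0]); the rest is at most [(1 - t) * (l + r + 1) = r + 1]. *)
  pose t := l / (l + r + 1).
  have t0 : 0 <= t by rewrite divr_ge0// ltW.
  have t1 : t * (l + r + 1) = l by rewrite divfK// gt_eqF.
  have xa0 := enorm_ge0 (x - a).
  have t2 : t <= 1 by rewrite ler_pdivrMr// mul1r; have := r0; lra.
  exists (a + t *: (x - a)).
    have [l00|lp] := eqVneq l 0.
      have t00 : t = 0 by rewrite /t l00 mul0r.
      by rewrite t00 scale0r addr0; exact: inner_sub_inner.
    apply: nbhd_sub_inner; exists a => //; rewrite addrAC subrr add0r enormZ ger0_norm//.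
    have tp : 0 < t by rewrite divr_gt0// lt_neqAle eq_sym lp.
    by rewrite -[ltRHS]t1 ltr_pM2l.
  rewrite (_ : x - (a + t *: (x - a)) = (1 - t) *: (x - a)); last first.
    by rewrite scalerBl scale1r opprD addrA.
  rewrite enormZ ger0_norm ?subr_ge0//.
  apply: (@le_lt_trans _ _ ((1 - t) * (l + r + 1))).
    by rewrite ler_wpM2l ?subr_ge0// ltW.
  by rewrite mulrBl mul1r t1; lra.
apply: (le_trans (packing IM L0 r20)).
apply: lee_wpmul2l; first by rewrite lee_fin ltW// pack_gt0.
by apply: le_leb => //; [exact: measurable_nbhd|exact: nbhd_thickening].
Qed.

Definition psi (y : E) : \bar R := (expR (- dist_to A y))%:E.

Lemma nnmeas_psi : nnmeas psi.
Proof.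
split; last by move=> y; rewrite lee_fin expR_ge0.
apply/measurable_EFinP; apply: measurableT_comp => //.
by apply: measurableT_comp => //; exact: (measurable_dist_to Aa0).
Qed.

Lemma psi_le k x y : enorm (y - x) <= k -> (psi y <= (expR k)%:E * psi x)%E.
Proof.
move=> yx; rewrite /psi -EFinM lee_fin -expRD ler_expR.
have := dist_to_lipschitz Aa0 y x; rewrite enormB; lra.
Qed.

Lemma int_psi_le (Z : set E) (k : R) : measurable Z -> 0 <= k ->
  (forall y, Z y -> (psi y <= k%:E)%E) -> (\int[leb]_(y in Z) psi y <= k%:E * leb Z)%E.
Proof.
move=> mZ k0 Zk; rewrite -integral_cst//; apply: ge0_le_integral => //.
- by move=> y _; exact: nnmeas_psi.2.
- by apply: measurable_funTS; exact: nnmeas_psi.1.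
Qed.

Lemma spread_psi_ball x : (spread reach psi (eball L x) <= infl%:E * psi x)%E.
Proof.
have rL : 0 < reach + L by rewrite addr_gt0// reach_gt0.
have px0 := nnmeas_psi.2 x.
apply: (@le_trans _ _ (\int[leb]_(y in eball (reach + L) x) psi y)%E).
  apply: ge0_subset_integral => //.
  - exact: measurable_nbhd.
  - exact: measurable_eball.
  - by apply: measurable_funTS; exact: nnmeas_psi.1.
  - by move=> y _; exact: nnmeas_psi.2.
  - by rewrite -!nbhd_set1; exact: nbhd_nbhd.
have k0 : 0 <= expR (reach + L) * expR (- dist_to A x) by rewrite mulr_ge0 ?expR_ge0.
apply: (@le_trans _ _ ((expR (reach + L) * expR (- dist_to A x))%:E * leb (eball
  (reach + L) x))%E).
  apply: int_psi_le => //; first exact: measurable_eball.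
  by move=> y /ltW/psi_le; rewrite /psi -EFinM.
apply: (@le_trans _ _ ((expR (reach + L) * expR (- dist_to A x))%:E * (ball_ub
  (reach + L))%:E)%E).
  by apply: lee_wpmul2l; [rewrite lee_fin|exact: leb_eball_le].
by rewrite /psi -!EFinM lee_fin mulrC mulrA.
Qed.

Lemma spread_psi_target a : A a -> (target_lb%:E <= spread reach psi [set a])%E.
Proof.
move=> Aa; rewrite /spread nbhd_set1 /target_lb EFinM.
apply: (@le_trans _ _ ((expR (- reach))%:E * leb (eball reach a))%E).
  by apply: lee_wpmul2l; [rewrite lee_fin expR_ge0|exact/leb_eball_ge/reach_gt0].
rewrite -integral_cst; last exact: measurable_eball.
apply: ge0_le_integral => //.
- exact: measurable_eball.
- by move=> y _; rewrite lee_fin expR_ge0.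
- by apply: measurable_funTS; exact: nnmeas_psi.1.
move=> y ya; rewrite lee_fin ler_expR lerN2 ltW//.
by apply/(dist_to_ltP Aa0); exists a.
Qed.

(** Centers outside the [l]-neighbourhood of [A] block sites only within [2 * r] of themselves, so
    the allowed regions can differ nowhere else. *)
Definition mismatch : set E := I `&` ~` nbhd (l - 2 * r) A.

Lemma spread_psi_mismatch :
  (spread reach psi mismatch <= (expR (- (l - 2 * r - reach)) * (growth l * v'))%:E)%E.
Proof.
rewrite EFinM.
apply: (@le_trans _ _ ((expR (- (l - 2 * r - reach)))%:E * leb (nbhd reach mismatch))%E).
  apply: int_psi_le; [exact: measurable_nbhd|exact: expR_ge0|].
  move=> y [z [_ nz] yz]; rewrite lee_fin ler_expR lerN2 leNgt; apply/negP => dy.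
  apply: nz; apply/(dist_to_ltP Aa0).
  have := dist_to_lipschitz Aa0 y z; rewrite enormB; lra.
apply: lee_wpmul2l; first by rewrite lee_fin expR_ge0.
apply: le_trans leb_nbhd_le; apply: le_leb; try exact: measurable_nbhd.
rewrite [l + r + 1 + reach]addrC; apply: subset_trans (@nbhd_nbhd _ _ _ _ _).
apply: nbhd_subset => // y [[By _] _]; exact: thickening_nbhd By.
Qed.

Section compare.
Variables (T T' : set E) (E0 : set C) (s : R).
Hypotheses (mT : measurable T) (mT' : measurable T') (TI : T `<=` I) (T'I : T' `<=` I).
Hypothesis TT' : forall y, ~ mismatch y -> T y <-> T' y.
Hypothesis mE0 : measurable E0.
Hypothesis E0_local : forall Y Y', (forall y, A y -> (y \in Y) = (y \in Y')) -> E0 Y -> E0 Y'.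
Hypothesis s0 : 0 < s.

Local Notation N := (Num.truncn (s * fine (leb Big))).

Let mixed (T0 : set E) : measurable T0 -> T0 `<=` I ->
  (`|cond_pois T0 (eindic R E0) fset0 -
    iter N (heat r lam L T0 U) (eindic R E0) fset0| <= (b * fine (leb Big) * expR (-
      (c * s)))%:E)%E.
Proof.
move=> mT0 T0I.
(* Any region inside [I] is realised by a boundary condition, its complement in [I]. *)
have TE : I `\` (I `\` T0) = T0 by rewrite setDD setIidr.
have bc : boundary_condition r Big (I `\` T0).
  by split; [exact: measurableD|move=> y []].
have ne : I !=set0 by exists a0; exact: inner_sub_inner.
have T0oo : (leb T0 < +oo)%E.
  by apply: le_lt_trans Bigoo; apply: le_leb => // y /T0I [].
have := @mixing_cond_pois R d r lam L (ltW lam0) Big (I `\` T0).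
rewrite TE => /(_ mT0 T0oo mU U0 Uoo b c); apply => //.
move=> s1 s10 mu nu h1 h2; apply: (mixing compact_Big mBig ne bc s10 h1 h2).
Qed.

(** The first error term is the distance to equilibrium, once for each chain; the second is the
    disagreement that has spread from [mismatch]. *)
Lemma cond_pois_local :
  (cond_pois T (eindic R E0) fset0 <= cond_pois T' (eindic R E0) fset0 +
   (2 * (b * (growth l * v') * expR (- (c * s))) +
    expR (s * pack * infl) / target_lb * (expR (- (l - 2 * r - reach)) * (growth l * v')))%:E)%E.
Proof.
have Too T0 : measurable T0 -> T0 `<=` I -> (leb T0 < +oo)%E.
  by move=> mT0 T0I; apply: le_lt_trans Bigoo; apply: le_leb => // y /T0I [].
have H0 := @hard_core0 R d r.
have lam0' := ltW lam0.
have fC T0 : measurable T0 -> T0 `<=` I -> cond_pois T0 (eindic R E0) fset0 \is a fin_num.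
  move=> mT0 T0I; have /andP[x y] := cond_pois_eindic_bounds lam0' mE0 mT0 (Too _ mT0 T0I) H0.
  by rewrite ge0_fin_numE// (le_lt_trans y)// ltry.
have fI T0 : measurable T0 -> T0 `<=` I -> iter N (heat r lam L T0 U)
  (eindic R E0) fset0 \is a fin_num.
  move=> mT0 T0I; have pE := nnmeas_eindic R mE0.
  rewrite ge0_fin_numE; last exact: (nnmeas_iter_heat r L lam0' mT0 mU N pE).2.
  apply: le_lt_trans (ltry 1); apply: (iter_heat_le1 L lam0' mT0
    (Too _ mT0 T0I) mU U0 Uoo N H0 pE).
  by move=> Y; rewrite lee_fin indicE lern1; case: (_ \in _).
have Mb : b * fine (leb Big) * expR (- (c * s)) <= b * (growth l * v') * expR (- (c * s)).
  by rewrite ler_wpM2r ?expR_ge0// ler_wpM2l ?(ltW b0)// leb_Big_le.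
have m1 := fine_dist_le (fC _ mT TI) (fI _ mT TI) (mixed mT TI).
have m2 := fine_dist_le (fC _ mT' T'I) (fI _ mT' T'I) (mixed mT' T'I).
have := iter_heat_compare lam0' (ltW r0) (lexx reach) (ltW infl_gt0) target_lb_gt0 nnmeas_psi
  (fun y => erefl) spread_psi_target spread_psi_ball mE0 E0_local mT (Too _ mT TI) mT'
    (Too _ mT' T'I) mU U0 Uoo N
  H0 H0 (fun y _ => erefl) TT'.
set rate := 1 + _.
have u0 : 0 < fine (leb U) by rewrite fine_gt0// U0.
(* [1 + u <= expR u] with [u = infl / |U|], and [N <= s * |Big| <= s * pack * |U|], so that [|U|]
   cancels. *)
have rN : rate ^+ N <= expR (s * pack * infl).
  apply: (@le_trans _ _ (expR (infl / fine (leb U)) ^+ N)).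
    by rewrite lerXn2r ?nnegrE ?expR_ge0 ?addr_ge0 ?divr_ge0 ?(ltW infl_gt0) ?(ltW u0)// expR_ge1Dx.
  rewrite -expRM_natl ler_expR.
  have nle : N%:R <= s * pack * fine (leb U).
    apply: (@le_trans _ _ (s * fine (leb Big))).
      by rewrite truncn_le mulr_ge0 ?fine_ge0// ltW.
    by rewrite -mulrA ler_wpM2l ?(ltW s0)// leb_Big_le_U.
  apply: (@le_trans _ _ (s * pack * fine (leb U) * (infl / fine (leb U)))).
    by rewrite ler_wpM2r// divr_ge0 ?(ltW infl_gt0) ?(ltW u0).
  by rewrite -mulrA [fine _ * _]mulrC divfK// gt_eqF.
have bound : ((rate ^+ N / target_lb)%:E * spread reach psi mismatch <=
   (expR (s * pack * infl) / target_lb * (expR (- (l - 2 * r - reach)) * (growth l * v')))%:E)%E.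
  rewrite [X in (_ <= X)%E]EFinM; apply: lee_pmul.
  - by rewrite lee_fin divr_ge0 ?exprn_ge0 ?addr_ge0 ?divr_ge0 ?(ltW infl_gt0) ?(ltW u0) ?(ltW target_lb_gt0).
  - exact: (spread_ge0 _ nnmeas_psi).
  - by rewrite lee_fin ler_wpM2r// invr_ge0 ltW// target_lb_gt0.
  - exact: spread_psi_mismatch.
move=> cmp.
have {cmp bound} := fine_leD (fI _ mT TI) (fI _ mT' T'I) (le_trans cmp (leeD2l _ bound)).
move=> cmp; apply: (leD_fine (fC _ mT TI) (fC _ mT' T'I)).
exact: (le_via_close (le_trans m1 Mb) (le_trans m2 Mb) cmp).
Qed.

End compare.
End local_bound.

Lemma expr_le_expR (R : realType) n (x : R) : 0 <= x -> x ^+ n <= n`!%:R * expR x.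
Proof.
move=> x0; case: n => [|n]; first by rewrite expr0 fact0 mul1r -(expR0 R) ler_expR.
rewrite mulrC -ler_pdivrMr ?ltr0n ?fact_gt0//; apply: le_trans (expR_ge1Dxn n x0).
by rewrite lerDr.
Qed.

(** * Choice of the running time and of the decay rate *)

Section decay.
Context (R : realType) (d : nat).
Variables (r L b c : R).
Hypotheses (r0 : 0 < r) (L0 : 0 < L) (b0 : 0 < b) (c0 : 0 < c).
Local Notation reach := (reach r L).
Local Notation infl := (infl d r L).
Local Notation target_lb := (target_lb d r L).
Local Notation pack := (pack d r L).
Local Notation growth := (growth d r L).
Local Notation ball_lb := (@ball_lb R d).

(** At time [time_scale * (l + 1)] the inflation factor is [expR ((l + 1) / 2)], which uses up half
    of the decay in [l] of the initial spread; [l + 1] keeps the time positive at [l = 0]. *)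
Definition time_scale : R := (2 * (pack * infl))^-1.

Let pi0 : 0 < pack * infl := mulr_gt0 (pack_gt0 d r0 L0) (infl_gt0 d r0 L0).

Lemma time_scale_gt0 : 0 < time_scale.
Proof. by rewrite invr_gt0; apply: mulr_gt0. Qed.

(** The minimum is the slower of the two rates, [c * time_scale] for mixing and [1 / 2] for the
    disagreement; half of it is given up to absorb [growth]. *)
Definition decay_rate : R := Num.min (c * time_scale) (1 / 2) / 2.

Lemma decay_rate_gt0 : 0 < decay_rate.
Proof. by rewrite divr_gt0// lt_min mulr_gt0 ?time_scale_gt0//= divr_gt0. Qed.

Lemma decay_rate_le : 2 * decay_rate <= c * time_scale /\ 2 * decay_rate <= 1 / 2.
Proof.
rewrite /decay_rate mulrC divfK//; split; first by rewrite ge_min lexx.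
by rewrite ge_min lexx orbT.
Qed.

(** A power is at most a factorial times an exponential; the factor [2 / a] rescales the base so
    that the exponent becomes [a * (l + k)]. *)
Lemma growth_le (a : R) : 0 < a -> exists2 G : R, 0 < G & forall l, 0 <= l ->
  growth l <= G * expR (a * l).
Proof.
move=> a0; have re0 := reach_gt0 r0 L0.
have lb0 := ball_lb_gt0 d r0.
pose k : R := r + 1 + reach + 2 * r.
have k0 : 0 < k by rewrite /k; have := r0; have := re0; lra.
exists ((2 / a) ^+ d * d`!%:R * expR (a * k) / ball_lb r).
  apply: divr_gt0 => //; apply: mulr_gt0; last exact: expR_gt0.
  by apply: mulr_gt0; [rewrite exprn_gt0// divr_gt0|rewrite ltr0n fact_gt0].
move=> l l0; rewrite /growth /ball_ub.
have -> : l + r + 1 + reach + 2 * r = l + k by rewrite /k; lra.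
have lk : 0 <= a * (l + k).
  by apply: mulr_ge0; [exact: ltW|apply: addr_ge0 => //; exact: ltW].
have -> : 2 * (l + k) = 2 / a * (a * (l + k)).
  by rewrite mulrA divfK// gt_eqF.
rewrite exprMn [leRHS]mulrAC ler_pM2r ?invr_gt0// -[leRHS]mulrA -[leRHS]mulrA.
rewrite ler_wpM2l ?exprn_ge0 ?divr_ge0 ?(ltW a0)// -expRD -mulrDr [k + l]addrC.
exact: expr_le_expR.
Qed.

Lemma local_bound_decay : exists2 beta : R, 0 < beta & forall l v, 0 <= l -> 0 <= v ->
  2 * (b * (growth l * v) * expR (- (c * (time_scale * (l + 1))))) +
  expR (time_scale * (l + 1) * pack * infl) / target_lb *
    (expR (- (l - 2 * r - reach)) * (growth l * v)) <= beta * v * expR (- (decay_rate * l)).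
Proof.
have [G G0 GP] := growth_le decay_rate_gt0.
have a0 := decay_rate_gt0; have [a1 a2] := decay_rate_le.
have t0 := time_scale_gt0; have tl0 := target_lb_gt0 d r0 L0.
pose G1 := expR (1 / 2 + 2 * r + reach) / target_lb.
have G10 : 0 < G1 by rewrite divr_gt0 ?expR_gt0.
exists (G * (2 * b + G1)).
  by rewrite mulr_gt0// addr_gt0// mulr_gt0.
move=> l v l0 v0.
have gv0 : 0 <= growth l * v by rewrite mulr_ge0 ?growth_ge0.
have e1 : expR (- (c * (time_scale * (l + 1)))) <= expR (- (2 * decay_rate * l)).
  rewrite ler_expR lerN2 mulrA.
  apply: (@le_trans _ _ (c * time_scale * l)); first by rewrite ler_wpM2r.
  by rewrite ler_wpM2l ?lerDl// ltW// mulr_gt0.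
have tE : time_scale * (l + 1) * pack * infl = (l + 1) / 2.
  have tp : time_scale * (pack * infl) = 2^-1.
    by rewrite /time_scale invfM -mulrA mulVf ?mulr1// gt_eqF.
  by rewrite -mulrA mulrAC tp mulrC.
have e2 : expR (time_scale * (l + 1) * pack * infl) / target_lb * expR (- (l - 2 * r - reach)) <=
    G1 * expR (- (2 * decay_rate * l)).
  rewrite tE /G1 mulrAC [leRHS]mulrAC ler_pM2r ?invr_gt0// -!expRD ler_expR.
  have : 2 * decay_rate * l <= 1 / 2 * l by rewrite ler_wpM2r.
  lra.
apply: (@le_trans _ _ ((2 * b + G1) * expR (- (2 * decay_rate * l)) * (growth l * v))).
  have -> (e gv : R) : (2 * b + G1) * e * gv = 2 * (b * gv * e) + G1 * e * gv.
    by rewrite [(2 * b + G1) * e]mulrDl mulrDl; congr (_ + _); rewrite -!mulrA [e * gv]mulrC.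
  apply: lerD; last by rewrite mulrA ler_wpM2r.
  by do 2 apply: ler_wpM2l => //; exact: (mulr_ge0 (ltW b0)).
apply: (@le_trans _ _ ((2 * b + G1) * expR (- (2 * decay_rate * l)) * (G * expR
  (decay_rate * l) * v))).
  apply: ler_wpM2l; last by rewrite ler_wpM2r ?GP.
  apply: mulr_ge0; last exact: expR_ge0.
  by apply: addr_ge0; [apply: mulr_ge0 => //|]; exact: ltW.
have -> : expR (- (decay_rate * l)) = expR (- (2 * decay_rate * l)) * expR (decay_rate * l).
  by rewrite -expRD; congr expR; lra.
move: (2 * b + G1) (expR (decay_rate * l)) (expR (- (2 * decay_rate * l))) => x z y.
rewrite -[G * z * v]mulrA mulrACA [x * G]mulrC -[leRHS]mulrA.
by rewrite [v * _]mulrC [y * (z * v)]mulrA.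
Qed.

End decay.

(** * From the local bound to strong spatial mixing *)

Section main.
Context (R : realType) (d : nat).
Local Notation E := 'rV[R]_d.
Local Notation C := {fset 'rV[R]_d}.
Local Notation leb := (@lebesgue_row R d).
Variables (r lam L : R).
Hypotheses (r0 : 0 < r) (lam0 : 0 < lam) (L0 : 0 < L).

Lemma measurable_proj_config (Lam' : set E) : measurable Lam' ->
  measurable_fun setT (proj_config r Lam' : C -> C).
Proof.
move=> mLam'; apply: measurable_fun_config => B k mB.
rewrite (_ : [set _ | _] = [set X : C | #|` fset_restr X (inner_set r Lam' `&` B)| = k]).
  by apply: measurable_count; apply: measurableI => //; exact: measurable_inner_set.
suff E1 (X : C) : fset_restr (proj_config r Lam' X) B = fset_restr X (inner_set r Lam' `&` B).
  by apply/funext => X; rewrite /= E1.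
apply/fsetP => x; apply/fset_restrP/fset_restrP.
  by move=> [/fset_restrP[xX Ax] Bx].
by move=> [xX [Ax Bx]]; split => //; apply/fset_restrP.
Qed.

Lemma abse_sub_le (x y : \bar R) (B : R) : x \is a fin_num -> y \is a fin_num ->
  (x <= y + B%:E)%E -> (y <= x + B%:E)%E -> (`|x - y| <= B%:E)%E.
Proof.
case: x => [x| |] //; case: y => [y| |] // _ _.
rewrite -!EFinD !lee_fin => h1 h2.
change (`|x - y|%:E <= B%:E)%E.
by rewrite lee_fin ler_norml; apply/andP; split; lra.
Qed.

Lemma abse_sub_le1 (x y : \bar R) : (0 <= x)%E -> (x <= 1)%E -> (0 <= y)%E -> (y <= 1)%E ->
  (`|x - y| <= 1)%E.
Proof.
case: x => [x| |] //; case: y => [y| |] //; rewrite !lee_fin => x0 x1 y0 y1.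
change (`|x - y|%:E <= 1%:E)%E.
by rewrite lee_fin ler_norml; apply/andP; split; lra.
Qed.

Lemma optimal_temporal_mixing_ssm :
  optimal_temporal_mixing d r lam L -> strong_spatial_mixing d r lam.
Proof.
move=> [b [c [b0 c0 mixing]]].
have [beta beta0 decay] := local_bound_decay d r0 L0 b0 c0.
have lb0 := ball_lb_gt0 d r0.
exists (decay_rate d r L c), (beta + (ball_lb d r)^-1).
split; [exact: decay_rate_gt0|by rewrite addr_gt0// invr_gt0|].
have a0 := decay_rate_gt0 d r0 L0 c0.
set alpha := decay_rate _ _ _ _ in decay a0 *.
(* The second summand serves the case [l = 0]: the trivial bound [1] is dominated because
   [ball_lb d r] is a lower bound for [|Lam'|] as soon as [A] is nonempty. *)
set beta' := beta + _.
have beta'0 : 0 < beta' by rewrite addr_gt0// invr_gt0.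
move=> Lam' Lam cLam mLam cLam' mLam' LamLam' tau tau' [mtau tauI] [mtau' tau'I].
have mI : measurable (inner_set r Lam) by exact: measurable_inner_set.
have lam0' := ltW lam0.
pose S := inner_set r Lam `\` tau; pose S' := inner_set r Lam `\` tau'.
have mS : measurable S by exact: measurableD.
have mS' : measurable S' by exact: measurableD.
have [M HM] := compact_row_bounded cLam.
have Soo : (leb S < +oo)%E by apply: (leb_bounded mS (l := M) (x := 0)) => y [[/HM]].
have S'oo : (leb S' < +oo)%E by apply: (leb_bounded mS' (l := M) (x := 0)) => y [[/HM]].
have [M' HM'] := compact_row_bounded cLam'.
have Lam'oo : (leb Lam' < +oo)%E by exact: (leb_bounded mLam' HM').
set A := inner_set r Lam'.
have mA : measurable A by exact: measurable_inner_set.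
have mproj := measurable_proj_config mLam'.
have H0 := @hard_core0 R d r.
have fin (T : set E) (E0 : set C) : measurable T -> (leb T < +oo)%E -> measurable E0 ->
    cond_pois r lam T (eindic R E0) fset0 \is a fin_num.
  move=> mT Too mE0; have /andP[x y] := cond_pois_eindic_bounds lam0' mE0 mT Too H0.
  by rewrite ge0_fin_numE// (le_lt_trans y)// ltry.
set bound := (beta'%:E * leb Lam' * _)%E.
have bound0 : (0 <= bound)%E.
  rewrite !mule_ge0 ?expeR_ge0// lee_fin ltW//.
apply: ge_ereal_sup => _ [E1 mE1 <-].
rewrite /pushforward; set E0 := proj_config r Lam' @^-1` E1.
have mE0 : measurable E0 by rewrite -[X in measurable X]setTI; exact: mproj.
have E0_local Y Y' : (forall y, A y -> (y \in Y) = (y \in Y')) -> E0 Y -> E0 Y'.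
  move=> YY'; rewrite /E0 /= (_ : proj_config r Lam' Y = proj_config r Lam' Y')//.
  apply/fsetP => y; apply/fset_restrP/fset_restrP => -[yY Ay]; split=> //.
    by rewrite -YY'.
  by rewrite YY'.
rewrite (hard_sphereE lam0' mS Soo) (hard_sphereE lam0' mS' S'oo) -/S -/S'.
have fS := fin _ _ mS Soo mE0; have fS' := fin _ _ mS' S'oo mE0.
have [A0|] := pselect (A = set0).
  have -> : cond_pois r lam S (eindic R E0) fset0 = cond_pois r lam S' (eindic R E0) fset0.
    have [EE|EE] := pselect (E0 fset0).
      have -> : eindic R E0 = fun=> 1%E.
        by apply/funext => Y; rewrite eindic_in//; apply: E0_local EE => y; rewrite A0.
      by rewrite !cond_pois1.
    have -> : eindic R E0 = fun=> 0%E.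
      by apply/funext => Y; rewrite eindic_notin// => EY; apply: EE; apply: E0_local EY => y;
        rewrite A0.
    by rewrite (sadd0 (sadd_cond_pois r lam0' _ mS)) (sadd0 (sadd_cond_pois r lam0' _ mS')).
  by rewrite subee// abse0.
move=> /eqP/set0P[a0' Aa0].
have La0 : Lam' a0' by case: Aa0.
set D := tau `+` tau'.
have dist0 : (0 <= set_dist D Lam')%E by apply/set_dist_geP => ? ? _ _; exact: enorm_ge0.
(* An infinite distance to the nonempty [Lam'] means that [tau] and [tau'] coincide. *)
have [Doo|Dfin] := eqVneq (set_dist D Lam') +oo%E.
  have D0 y : ~ D y.
    move=> Dy; have : ((enorm (y - a0') + 1)%:E <= set_dist D Lam')%E by rewrite Doo leey.
    by move/set_dist_geP => /(_ y a0' Dy La0); rewrite gerDl ler10.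
  have tE : tau = tau'.
    apply/seteqP; split => y ty; apply: contrapT => nty; apply: (D0 y); [by left|by right].
  have -> : S = S' by rewrite /S /S' tE.
  by rewrite subee// abse0.
have fD : set_dist D Lam' \is a fin_num by rewrite ge0_fin_numE// ltey.
pose l := fine (set_dist D Lam').
have l0 : 0 <= l by rewrite fine_ge0.
have lE : set_dist D Lam' = l%:E by rewrite /l fineK.
have boundE : bound = (beta' * fine (leb Lam') * expR (- (alpha * l)))%:E.
  by rewrite /bound lE -EFinM /= !EFinM fineK// ge0_fin_numE.
have v1 : ball_lb d r <= fine (leb Lam').
  rewrite -lee_fin fineK ?ge0_fin_numE//.
  apply: (le_trans (leb_eball_ge a0' r0)); apply: le_leb => //; first exact: measurable_eball.
  by move=> y ya; apply: (@nbhd_inner_set _ _ r); exists a0'.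
(* One-sided, to be used in both directions. *)
have key (T T' : set E) : measurable T -> (leb T < +oo)%E -> measurable T' -> (leb T' < +oo)%E ->
   0 < l -> T `&` nbhd l A = T' `&` nbhd l A ->
   (cond_pois r lam T (eindic R E0) fset0 <= cond_pois r lam T' (eindic R E0) fset0 +
     (beta * fine (leb Lam') * expR (- (alpha * l)))%:E)%E.
  move=> mT Too mT' T'oo lp TT'.
  have AW : A `<=` nbhd l A by move=> y Ay; exists y => //; rewrite subrr enorm0.
  have mW : measurable (nbhd l A) := measurable_nbhd l A.
  apply: (cond_pois_localize lam0' mW AW mE0 E0_local) => //.
    by rewrite !mulr_ge0 ?expR_ge0 ?fine_ge0// ltW.
  move=> X X' HX HX' XT X'T'.
  have sub T0 X0 : allowed r (nbhd l A) T0 X0 `<=` inner_set r (thickening (l + r) A).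
    by move=> y [[_ yW] _]; exact: nbhd_sub_inner.
  have s0 : 0 < time_scale d r L * (l + 1).
    by apply: mulr_gt0; [exact: time_scale_gt0|rewrite ltr_wpDl].
  have mismatchP y : ~ mismatch r Lam' l y ->
      allowed r (nbhd l A) T X y <-> allowed r (nbhd l A) T' X' y.
    move=> ny; have [Iy|Iy] := pselect (inner_set r (thickening (l + r) A) y); last first.
      by split => /sub.
    have [a Aa ya] : nbhd (l - 2 * r) A y by apply: contrapT => h; apply: ny.
    (* A center outside the [l]-neighbourhood of [A] cannot block a site that is closer than
       [l - 2 * r] to [A]. *)
    have far (T0 : set E) (X0 : C) : [set` X0] `<=` T0 `\` nbhd l A -> ~ nbhd (2 * r) [set` X0] y.
      move=> X0T0 [x /= xX0 yx]; have [_] := X0T0 x xX0; apply; exists a => //.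
      have := enorm_triangle y x a; rewrite [enorm (x - y)]enormB; lra.
    have : (T `&` nbhd l A) y <-> (T' `&` nbhd l A) y by rewrite TT'.
    move=> h; split => -[h1 _]; split; try exact/h; [exact: far X'T'|exact: far XT].
  apply: (le_trans (cond_pois_local (b := b) (c := c) r0 lam0 L0 b0 _ cLam' mLam' Aa0 l0
    (measurable_allowed _ mW mT X) (measurable_allowed _ mW mT' X') (@sub _ _) (@sub _ _)
    mismatchP mE0 E0_local s0)).
    by move=> Big cBig mBig ne ta bc s sp mu nu h1 h2;
      exact: (mixing Big cBig mBig ne ta bc s sp mu nu h1 h2).
  by rewrite leeD2l// lee_fin; apply: decay => //; rewrite fine_ge0.
rewrite boundE.
have [lz|ln0] := eqVneq l 0.
  apply: (@le_trans _ _ 1%E).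
    have /andP[x0 x1] := cond_pois_eindic_bounds lam0' mE0 mS Soo H0.
    have /andP[y0 y1] := cond_pois_eindic_bounds lam0' mE0 mS' S'oo H0.
    exact: (abse_sub_le1 x0 x1 y0 y1).
  rewrite lee_fin lz mulr0 oppr0 expR0 mulr1.
  apply: (@le_trans _ _ ((ball_lb d r)^-1 * ball_lb d r)); first by rewrite mulVf// gt_eqF.
  apply: ler_pM => //; first by rewrite invr_ge0 ltW.
    exact: ltW.
  by rewrite lerDr ltW.
have lp : 0 < l by rewrite lt_neqAle eq_sym ln0.
(* [A] is contained in [Lam'], and [l] is the distance from [Lam'] to [D], so no point of [D] is
   within [l] of [A]. *)
have SS' : S `&` nbhd l A = S' `&` nbhd l A.
  have agree y : nbhd l A y -> tau y <-> tau' y.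
    move=> [a [La _] ya]; suff nD : ~ D y.
      by split => ty; apply: contrapT => nty; apply: nD; [left|right].
    move=> Dy; have : (l%:E <= set_dist D Lam')%E by rewrite lE.
    by move/set_dist_geP => /(_ y a Dy La); rewrite leNgt ya.
  by apply/seteqP; split => y [[Iy ny] yW]; split => //; split => // ty; apply: ny;
    apply/(agree _ yW).
have le_bound : ((beta * fine (leb Lam') * expR (- (alpha * l)))%:E <=
    (beta' * fine (leb Lam') * expR (- (alpha * l)))%:E)%E.
  by rewrite lee_fin ler_wpM2r ?expR_ge0// ler_wpM2r ?fine_ge0// lerDl invr_ge0 ltW.
apply: le_trans le_bound.
exact: (abse_sub_le fS fS' (key _ _ mS Soo mS' S'oo lp SS')
  (key _ _ mS' S'oo mS Soo lp (esym SS'))).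
Qed.

End main.

Theorem theorem2p3 (R : realType) (d : nat) (r lam L : R) (d_ge2 : (2 <= d)%N)
    (r_gt0 : 0 < r) (unit_ball : lebesgue_row (@eball R d r 0) = 1%E)
    (lam_gt0 : 0 < lam) (L_gt0 : 0 < L) :
  optimal_temporal_mixing d r lam L -> strong_spatial_mixing d r lam.
Proof. exact: optimal_temporal_mixing_ssm. Qed.
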